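(* Fix $a\in(0,1/2)$ and $\lambda>0$. Consider the polymer dynamics restricted to the pinned set $\check{\mathcal S}^a_N$, i.e. the continuous-time Markov chain on $\check{\mathcal S}^a_N$ with generator $\mathcal L_1f(\eta)=\sum_{\eta'\in\check{\mathcal S}^a_N}r^\lambda(\eta,\eta')(f(\eta')-f(\eta))$ (all transitions leaving $\check{\mathcal S}^a_N$ suppressed), which is reversible with respect to $\pi^{\lambda,a}_N(\cdot\mid\check{\mathcal S}^a_N)$, and let ${\rm gap}_1$ be its spectral gap. Then there exists $c(a,\lambda)>0$ such that ${\rm gap}_1\ge c(a,\lambda)N^{-12}$ for every even $N\ge1$ for which $\check{\mathcal S}^a_N\neq\emptyset$.
   Context: $\langle s\rangle$ is the smallest even integer $\ge s$. For $N$ even, $\mathcal S^a_N$ is the set of $\eta=(\eta_x)_{x\in\{0,\dots,N\}}$ with values in $\mathbb Z_{\ge0}$, $\eta_0=\eta_N=\langle aN\rangle$, $|\eta_{x+1}-\eta_x|=1$; $H(\eta)=\#\{x:\eta_x=0\}$; $\pi^{\lambda,a}_N(\eta)\propto\lambda^{H(\eta)}$; $\check{\mathcal S}^a_N=\{\eta\in\mathcal S^a_N:\exists x,\ \eta_x=0\}$. For $x\in\{1,\dots,N-1\}$, $\eta^x$ replaces $\eta_x$ by $\eta_{x+1}+\eta_{x-1}-\eta_x$. The rates are $r^\lambda(\eta,\eta^x)=\frac12$ if $\eta_x>0$ and $\eta^x_x>0$; $\frac{\lambda}{\lambda+1}$ if $\eta_{x\pm1}=1,\eta_x=2$; $\frac1{\lambda+1}$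 if $\eta_x=0$; $0$ if $\eta_{x\pm1}=0$; and $r^\lambda(\eta,\eta')=0$ if $\eta'$ is not of the form $\eta^x$. *)

(* Defs.v *)
From HB Require Import structures.
From mathcomp Require Import all_boot all_order all_algebra.
From mathcomp Require Import all_classical all_reals ereal.
Set Implicit Arguments. Unset Strict Implicit. Unset Printing Implicit Defensive.
Import Order.TTheory GRing.Theory Num.Theory.
Local Open Scope ring_scope.
Local Open Scope classical_set_scope.

Definition evenceil (R : realType) (s : R) : int := 2 * Num.ceil (s / 2).

(* the boundary height <aN> as a natural number (a > 0 in all uses) *)
Definition hgt (R : realType) (a : R) (N : nat) : nat :=
  `|evenceil (a * N%:R)|%N.

(* Every eta in S^a_N satisfies eta_x <= <aN> + N, so configurations can be
   encoded as finite functions {0..N} -> {0..<aN>+N}. *)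
Definition bnd (R : realType) (a : R) (N : nat) : nat := (hgt a N + N).+1.

Definition config (R : realType) (a : R) (N : nat) :=
  {ffun 'I_N.+1 -> 'I_(bnd a N)}.

(* height eta_x, for x in {0..N} (0 outside, never used there) *)
Definition ht (R : realType) (a : R) (N : nat) (eta : config a N) (x : nat) : nat :=
  if (x < N.+1)%N then val (eta (inord x)) else 0%N.

Definition inS (R : realType) (a : R) (N : nat) (eta : config a N) : bool :=
  [&& (ht eta 0)%:Z == evenceil (a * N%:R),
      (ht eta N)%:Z == evenceil (a * N%:R) &
      [forall x : 'I_N, (ht eta x.+1 == (ht eta x).+1) ||
                        (ht eta x == (ht eta x.+1).+1)]].

Definition inCheckS (R : realType) (a : R) (N : nat) (eta : config a N) : bool :=
  inS eta && [exists x : 'I_N.+1, ht eta x == 0%N].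

Definition Hzero (R : realType) (a : R) (N : nat) (eta : config a N) : nat :=
  #|[set x : 'I_N.+1 | ht eta x == 0%N]|.

Definition newval (R : realType) (a : R) (N : nat) (eta : config a N) (x : nat) : int :=
  (ht eta x.+1)%:Z + (ht eta x.-1)%:Z - (ht eta x)%:Z.

Definition is_flip (R : realType) (a : R) (N : nat) (eta eta' : config a N) (x : nat) : bool :=
  [forall y : 'I_N.+1,
     (ht eta' y)%:Z == (if val y == x then newval eta x else (ht eta y)%:Z)].

Definition rate_at (R : realType) (a : R) (N : nat) (lam : R) (eta : config a N) (x : nat) : R :=
  if (ht eta x.-1 == 0%N) && (ht eta x.+1 == 0%N) then 0
  else if ht eta x == 0%N then 1 / (lam + 1)
  else if [&& ht eta x.-1 == 1%N, ht eta x.+1 == 1%N & ht eta x == 2%N]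
       then lam / (lam + 1)
  else if (0 < ht eta x)%N && (0 < newval eta x) then 1 / 2
  else 0.

Definition rate (R : realType) (a : R) (N : nat) (lam : R) (eta eta' : config a N) : R :=
  match [pick x : 'I_N.+1 | (0 < val x < N)%N && is_flip eta eta' x] with
  | Some x => rate_at lam eta x
  | None => 0
  end.

Definition piC (R : realType) (a : R) (N : nat) (lam : R) (eta : config a N) : R :=
  if inCheckS eta then
    lam ^+ Hzero eta / \sum_(e : config a N | inCheckS e) lam ^+ Hzero e
  else 0.

Definition L1 (R : realType) (a : R) (N : nat) (lam : R) (f : config a N -> R)
  (eta : config a N) : R :=
  \sum_(eta' : config a N | inCheckS eta') rate lam eta eta' * (f eta' - f eta).

Definition meanC (R : realType) (a : R) (N : nat) (lam : R) (f : config a N -> R) : R :=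
  \sum_(eta : config a N | inCheckS eta) piC lam eta * f eta.

Definition varC (R : realType) (a : R) (N : nat) (lam : R) (f : config a N -> R) : R :=
  \sum_(eta : config a N | inCheckS eta) piC lam eta * (f eta - meanC lam f) ^+ 2.

Definition dirichlet1 (R : realType) (a : R) (N : nat) (lam : R) (f : config a N -> R) : R :=
  - \sum_(eta : config a N | inCheckS eta) piC lam eta * f eta * L1 lam f eta.

(* spectral gap: inf over non-constant f of E(f,f)/Var(f)  (= +oo if no
   such f exists, i.e. when \check S^a_N has at most one element) *)
Definition gap1 (R : realType) (a lam : R) (N : nat) : \bar R :=
  ereal_inf [set ((dirichlet1 lam f / varC lam f)%:E) | f in
             [set f : config a N -> R | varC lam f != 0]].

(* Main.v *)
Require Import Defs.
From HB Require Import structures.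
From mathcomp Require Import all_boot all_order all_algebra.
From mathcomp Require Import all_classical all_reals ereal.
From mathcomp Require Import finset zify ring lra.
Import Order.TTheory GRing.Theory Num.Theory.
Local Open Scope ring_scope.
Set Implicit Arguments. Unset Strict Implicit. Unset Printing Implicit Defensive.

(** Let X be the zero set of a path and (l, r) its extreme points.  The variance
    of f is split along the chain of conditionings path -> X -> (l, r).

    - Given X the path is uniform, and the corner flips that keep X contract the
      weighted Lipschitz norm with weights x (N - x) (path coupling), which gives
      relaxation time O(N^2).
    - Given (l, r), the set X is a renewal set.  Moving from X to Y through the
      hybrids that follow Y before a cut and X after it changes the product of
      weights by at most N^2, because excursions of length 2j are counted by
      Catalan numbers.
    - The weight of (l, r) is A(l) Z(r - l) A(N - r), where A counts first
      passages from height h to 0 and Z is the partition function of the pinned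
      polymer.  Z is exponential up to a polynomial factor and, as h >= a N, A is
      log-concave up to a constant factor, so that from every (l, r) there is a
      lattice path to the mode along which the weight essentially never drops.

    Neighbouring zero sets X and X \ {x} are compared through the flip 0 -> 2 at
    x, and neighbouring classes (l, r) through deletion of an extreme zero. *)

Section Spectral.
Variable R : realType.

(* Applied to b k = |P^k f|^2: an exponential rate known up to a constant is a bound
   on the norm of P itself. *)
Lemma log_convex_decay (b : nat -> R) (C rho : R) : 0 <= rho ->
  (forall k, 0 <= b k) -> (forall k, b k.+1 ^+ 2 <= b k * b k.+2) ->
  (forall k, b k <= C * rho ^+ k) -> b 1%N <= rho * b 0%N.
Proof.
move=> rho0 b0 bc bC; rewrite leNgt; apply/negP => lt1.
have b00 : 0 < b 0%N.
  rewrite lt_def b0 andbT; apply/eqP => e0.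
  have := bc 0%N; rewrite e0 mul0r => h1.
  have : b 1%N = 0 by apply/eqP; rewrite -sqrf_eq0 eq_le h1 sqr_ge0.
  by move=> e1; move: lt1; rewrite e0 e1 mulr0 ltxx.
pose q := b 1%N / b 0%N.
have qrho : rho < q by rewrite /q ltr_pdivlMr.
have q0 : 0 < q by apply: le_lt_trans qrho.
have grow : forall k, (0 < b k) /\ (q * b k <= b k.+1).
  elim=> [|k [bk qk]].
    by split=> //; rewrite /q divfK // gt_eqF.
  have bk1 : 0 < b k.+1 by apply: lt_le_trans qk; apply: mulr_gt0.
  split=> //; rewrite -(ler_pM2l bk); apply: le_trans (bc k).
  by rewrite mulrA (mulrC (b k)) expr2 ler_pM2r.
have low : forall k, q ^+ k * b 0%N <= b k.
  elim=> [|k IH]; first by rewrite mul1r.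
  apply: le_trans (proj2 (grow k)).
  by rewrite exprS -mulrA ler_pM2l.
case: (ltrgtP rho 0) => [|rpos|r0]; first by rewrite ltNge rho0.
- pose x := q / rho - 1.
  have x0 : 0 < x by rewrite /x subr_gt0 ltr_pdivlMr // mul1r.
  have bern : forall k, 1 + k%:R * x <= (q / rho) ^+ k.
    elim=> [|k IH]; first by rewrite mul0r addr0.
    rewrite exprS -natr1; have E : q / rho = 1 + x by rewrite /x; ring.
    rewrite E.
    rewrite E in IH.
    have p1 : (1 + x) * (1 + k%:R * x) <= (1 + x) * (1 + x) ^+ k by rewrite ler_pM2l //; lra.
    have k0 : (0 : R) <= k%:R by [].
    apply: le_trans p1; nra.
  have bnd k : (q / rho) ^+ k <= C / b 0%N.
    rewrite ler_pdivlMr // expr_div_n mulrAC ler_pdivrMr ?exprn_gt0 //.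
    exact: le_trans (low k) (bC k).
  have [n hn] : exists n : nat, C / b 0%N < 1 + n%:R * x.
    exists (Num.truncn (C / b 0%N / x)).+1.
    have : C / b 0%N / x < (Num.truncn (C / b 0%N / x)).+1%:R by apply: truncnS_gt.
    rewrite ltr_pdivrMr //; lra.
  by have := lt_le_trans hn (le_trans (bern n) (bnd n)); rewrite ltxx.
- have := le_trans (low 1%N) (bC 1%N).
  by rewrite r0 expr1 mulr0 leNgt mulr_gt0.
Qed.

Lemma sqr_sum_le (I : Type) (r : seq I) (P : pred I) (F G : I -> R) :
  (\sum_(i <- r | P i) F i * G i) ^+ 2 <=
  (\sum_(i <- r | P i) F i ^+ 2) * (\sum_(i <- r | P i) G i ^+ 2).
Proof.
set A := \sum_(i <- r | P i) F i ^+ 2; set B := \sum_(i <- r | P i) G i ^+ 2.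
set S := \sum_(i <- r | P i) F i * G i.
have key (t u : R) : 0 <= t ^+ 2 * A + 2 * t * u * S + u ^+ 2 * B.
  rewrite /A /B /S !mulr_sumr -!big_split /=; apply: sumr_ge0 => i _.
  by have := sqr_ge0 (t * F i + u * G i); congr (_ <= _); ring.
have A0 : 0 <= A by apply: sumr_ge0 => i _; apply: sqr_ge0.
have B0 : 0 <= B by apply: sumr_ge0 => i _; apply: sqr_ge0.
have := key B (- S).
have := key 1 (- S); have := key (-S) A.
move: A0; rewrite le_eqVlt => /orP[/eqP <-|A0].
  move=> _; have := key (- (B + 1)) S; have := key (- (B + 1) / 2) S; nra.
move=> k1 _ _; have : 0 <= A * (A * B - S ^+ 2) by apply: le_trans k1 _; lra.
by rewrite pmulr_rge0 // subr_ge0.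
Qed.

Lemma sqr_sum_card (I : finType) (P : pred I) (F : I -> R) :
  (\sum_(i | P i) F i) ^+ 2 <= #|P|%:R * \sum_(i | P i) F i ^+ 2.
Proof.
have := sqr_sum_le (index_enum I) P (fun=> 1) F.
under eq_bigr do rewrite mul1r; under [X in X * _]eq_bigr do rewrite expr1n.
by rewrite sumr_const.
Qed.

Lemma sqrD_le (x y : R) : (x + y) ^+ 2 <= 2 * x ^+ 2 + 2 * y ^+ 2.
Proof. by have := sqr_ge0 (x - y); lra. Qed.

End Spectral.

(** * Path coupling *)

Section PathCoupling.
Variables (R : realType) (T : finType) (Om : {set T}) (N : nat) (sg : nat -> T -> T).
Hypothesis N_ge2 : (2 <= N)%N.
Hypothesis sg_in : forall y x, x \in Om -> sg y x \in Om.
Hypothesis sgK : forall y x, x \in Om -> sg y (sg y x) = x.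
Hypothesis sg_comm : forall y z x, x \in Om -> (y.+1 < z)%N ->
  sg y (sg z x) = sg z (sg y x).
Hypothesis sg_nbr : forall y z x, x \in Om -> (z == y.+1) || (y == z.+1) ->
  sg y x != x -> sg z x = x \/ sg z (sg y x) = sg y x.

Let v (y : nat) : R := y%:R * (N%:R - y%:R).
Let P (f : T -> R) (x : T) : R :=
  (\sum_(1 <= y < N) (f x + f (sg y x)) / 2) / N.-1%:R.
Let rho : R := 1 - 4 / (N%:R ^+ 2 * N.-1%:R).
Let Lip (f : T -> R) (L : R) := forall x y, x \in Om -> (0 < y < N)%N ->
  `|f x - f (sg y x)| <= L * v y.

Hypothesis sg_conn : exists D : R, forall (f : T -> R) (L : R),
  (forall x y, x \in Om -> (0 < y < N)%N -> `|f x - f (sg y x)| <= L) ->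
  forall x x', x \in Om -> x' \in Om -> `|f x - f x'| <= D * L.

Let Npred : N%:R = N.-1%:R + 1 :> R.
Proof. by rewrite -(prednK (ltnW N_ge2)) -natr1. Qed.

Let Np1 : 1 <= N.-1%:R :> R.
Proof. by rewrite ler1n; case: N N_ge2 => // -[]. Qed.

Let v_ge1 y : (0 < y < N)%N -> 1 <= v y.
Proof.
move=> /andP[y0 yN]; rewrite /v -natrB ?(ltnW yN) // -natrM ler1n muln_gt0 y0 /=.
by rewrite subn_gt0.
Qed.

Let v_le y : 4 * v y <= N%:R ^+ 2.
Proof. by rewrite /v; have := sqr_ge0 (N%:R - 2 * y%:R : R); lra. Qed.

Let D0 : 0 < N%:R ^+ 2 * N.-1%:R :> R.
Proof. by apply: mulr_gt0; [rewrite exprn_gt0 // Npred|]; have := Np1; lra. Qed.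

Let rho_ge0 : 0 <= rho.
Proof.
rewrite /rho subr_ge0 ler_pdivrMr // mul1r Npred; have := Np1; set p := N.-1%:R => p1.
have p2 : 4 <= (p + 1) ^+ 2.
  rewrite -subr_ge0; have -> : (p + 1) ^+ 2 - 4 = (p - 1) * (p + 3) by ring.
  by apply: mulr_ge0; lra.
by apply: le_trans p2 _; rewrite ler_peMr // sqr_ge0.
Qed.

Let Lip_P f L : 0 <= L -> Lip f L -> Lip (P f) (rho * L).
Proof.
move=> L0 lf x z xO /andP[z0 zN]; have zz : (0 < z < N)%N by rewrite z0.
have vz1 := v_ge1 zz.
have [->|nez] := eqVneq (sg z x) x.
  by rewrite subrr normr0; apply: mulr_ge0; [apply: mulr_ge0|apply: le_trans vz1].
set x' := sg z x; have x'O : x' \in Om by apply: sg_in.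
have E : P f x - P f x' = (\sum_(1 <= y < N)
    ((f x + f (sg y x)) / 2 - (f x' + f (sg y x')) / 2)) / N.-1%:R.
  by rewrite /P -mulrBl sumrB.
pose c y : R := v z - (if y == z then v z else 0) +
  (if y == z.+1 then v z.+1 / 2 else 0) + (if y == z.-1 then v z.-1 / 2 else 0).
have cb y : (1 <= y < N)%N ->
  `|(f x + f (sg y x)) / 2 - (f x' + f (sg y x')) / 2| <= L * c y.
  move=> yy; have lx := lf x z xO zz.
  have lyx := lf x y xO yy; have lyx' := lf x' y x'O yy.
  rewrite /c; have [->|nyz] := eqVneq y z.
    have -> : (z == z.+1) = false by clear; lia.
    have -> : (z == z.-1) = false by clear -z0; lia.
    rewrite /x' sgK // -/x' (addrC (f x')) subrr normr0; nra.
  have [far|near] := boolP ((y.+1 < z)%N || (z.+1 < y)%N).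
    have -> : (y == z.+1) = false by clear -far; lia.
    have -> : (y == z.-1) = false by clear -far; lia.
    have C : sg y x' = sg z (sg y x).
      by case/orP: far => hh; [exact: (sg_comm xO hh)|exact: (esym (sg_comm xO hh))].
    have ly := lf (sg y x) z (sg_in y xO) zz; rewrite -C in ly.
    rewrite -/x' in lx.
    move: lx ly; rewrite !ler_norml => /andP[? ?] /andP[? ?]; apply/andP; split; lra.
  have nb : (y == z.+1) || (z == y.+1) by clear -near nyz; lia.
  have cE : v z - 0 + (if y == z.+1 then v z.+1 / 2 else 0) +
      (if y == z.-1 then v z.-1 / 2 else 0) = v z + v y / 2.
    case/orP: nb => /eqP e.
      rewrite e eqxx; have -> : (z.+1 == z.-1) = false by clear; lia.
      by lra.
    rewrite e eqxx; have -> : (y == y.+2) = false by clear; lia.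
    by lra.
  rewrite cE -/x' in lx *.
  case: (sg_nbr xO nb nez) => [e|e].
    rewrite e; move: lx lyx'; rewrite !ler_norml => /andP[? ?] /andP[? ?]; apply/andP; split; lra.
  rewrite -/x' in e; rewrite e.
  move: lx lyx; rewrite !ler_norml => /andP[? ?] /andP[? ?]; apply/andP; split; lra.
have sumc : \sum_(1 <= y < N) c y = N.-1%:R * v z - 1.
  rewrite /c !big_split /= sumrN sumr_const_nat.
  rewrite -!(big_mkcond (fun y => y == _)) !big_nat1_eq z0 zN /=.
  have -> : (if (z.+1 < N)%N then v z.+1 / 2 else 0) = v z.+1 / 2.
    case: ifP => // h1; have -> : z.+1 = N by clear -h1 zN; lia.
    by rewrite /v subrr mulr0 mul0r.
  have -> : (if (0 < z.-1)%N && (z.-1 < N)%N then v z.-1 / 2 else 0) = v z.-1 / 2.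
    case: ifP => // h1; have -> : z.-1 = 0%N by clear -h1 zN; lia.
    by rewrite /v mul0r mul0r.
  have -> : v z.+1 = (z%:R + 1) * (N%:R - (z%:R + 1)) by rewrite /v natr1.
  have -> : v z.-1 = (z%:R - 1) * (N%:R - (z%:R - 1)).
    by rewrite /v -[in RHS](prednK z0) -natr1 addrK.
  rewrite subn1 -mulr_natl /v; lra.
rewrite E normrM normfV (ger0_norm (ler0n R _)) ler_pdivrMr; last by have := Np1; lra.
apply: le_trans (ler_norm_sum _ _ _) _.
apply: (@le_trans _ _ (\sum_(1 <= y < N) L * c y)).
  by rewrite !big_nat; apply: ler_sum => y yy; apply: cb.
rewrite -mulr_sumr sumc.
have -> : rho * L * v z * N.-1%:R = L * (N.-1%:R * v z - 4 * v z / N%:R ^+ 2).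
  rewrite /rho; field; rewrite Npred; have := Np1 => hp.
  by apply/andP; split; rewrite gt_eqF //; lra.
apply: ler_wpM2l => //; have := v_le z => hv.
suff : 4 * v z / N%:R ^+ 2 <= 1 by lra.
by rewrite ler_pdivrMr ?mul1r // exprn_gt0 // Npred; have := Np1; lra.
Qed.

Let sum_sg (F : T -> R) y : \sum_(x in Om) F (sg y x) = \sum_(x in Om) F x.
Proof.
rewrite [RHS](reindex_onto (sg y) (sg y)) /=; last by move=> x xO; rewrite sgK.
apply: eq_bigl => x; apply/idP/andP => [xO|[xO /eqP <-]]; last exact: sg_in.
by rewrite sg_in // sgK.
Qed.

Let dot (f g : T -> R) := \sum_(x in Om) f x * g x.

Let dot_P f g : dot (P f) g = dot f (P g).
Proof.
rewrite /dot /P.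
under eq_bigr do rewrite mulrAC mulr_suml; rewrite -mulr_suml exchange_big /=.
under [RHS]eq_bigr do rewrite mulrA mulr_sumr; rewrite -mulr_suml [in RHS]exchange_big /=.
congr (_ / _); apply: eq_bigr => y _.
have E (u w : T -> R) : \sum_(x in Om) (u x + u (sg y x)) / 2 * w x =
  (\sum_(x in Om) u x * w x) / 2 + (\sum_(x in Om) u (sg y x) * w x) / 2.
  by rewrite !mulr_suml -big_split /=; apply: eq_bigr => x _; lra.
rewrite E; under [RHS]eq_bigr do rewrite mulrC; rewrite E.
congr (_ / 2 + _ / 2); first by apply: eq_bigr => x _; rewrite mulrC.
rewrite -(sum_sg (fun x => g (sg y x) * f x) y).
by apply: eq_bigr => x xO /=; rewrite sgK // mulrC.
Qed.

Let sum_P f : \sum_(x in Om) P f x = \sum_(x in Om) f x.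
Proof.
have := dot_P f (fun=> 1); rewrite /dot; under eq_bigr do rewrite mulr1.
move=> ->; apply: eq_bigr => x _; rewrite /P.
under eq_bigr do rewrite divff //; rewrite sumr_const_nat subn1 divff ?mulr1 //.
by rewrite gt_eqF //; have := Np1; lra.
Qed.

Let dirichlet f : dot f f - dot f (P f) =
  (\sum_(x in Om) \sum_(1 <= y < N) (f x - f (sg y x)) ^+ 2) / (4 * N.-1%:R).
Proof.
have p0 : N.-1%:R != 0 :> R by rewrite gt_eqF //; have := Np1; lra.
have -> : dot f f = (\sum_(1 <= y < N) dot f f) / N.-1%:R.
  by rewrite sumr_const_nat subn1 -[X in _ = X / _]mulr_natr mulfK.
have -> : dot f (P f) = (\sum_(1 <= y < N) \sum_(x in Om) f x * ((f x + f (sg y x)) / 2)) / N.-1%:R.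
  rewrite /dot /P; under eq_bigr do rewrite mulrA mulr_sumr.
  by rewrite -mulr_suml exchange_big.
rewrite [in RHS]exchange_big /= -mulrBl -sumrB invfM (mulrC 4^-1) mulrA mulrAC; congr (_ / _).
rewrite mulr_suml; apply: eq_bigr => y _.
have e1 : \sum_(x in Om) f (sg y x) ^+ 2 = dot f f.
  by rewrite (sum_sg (fun x => f x ^+ 2)) /dot; apply: eq_bigr => x _; rewrite expr2.
have -> : \sum_(x in Om) f x * ((f x + f (sg y x)) / 2) =
  dot f f / 2 + (\sum_(x in Om) f x * f (sg y x)) / 2.
  by rewrite /dot !mulr_suml -big_split /=; apply: eq_bigr => x _; lra.
have -> : \sum_(x in Om) (f x - f (sg y x)) ^+ 2 = dot f f - 2 * (\sum_(x in Om) f x * f (sg y x)) + dot f f.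
  rewrite -[in X in _ + X]e1 /dot mulr_sumr -sumrB -big_split /=; apply: eq_bigr => x _; lra.
lra.
Qed.

Lemma path_coupling_poincare (f : T -> R) :
  \sum_(x in Om) (f x - (\sum_(x in Om) f x) / #|Om|%:R) ^+ 2 <=
  N%:R ^+ 2 / 16 * \sum_(x in Om) \sum_(1 <= y < N) (f x - f (sg y x)) ^+ 2.
Proof.
set m := (\sum_(x in Om) f x) / _; pose f0 x := f x - m.
have [O0|O0] := eqVneq #|Om| 0%N.
  by rewrite !big_pred0 ?mulr0 // => x; apply/negbTE; move/eqP: O0; rewrite cards_eq0 => /eqP ->; rewrite inE.
have Opos : 0 < #|Om|%:R :> R by rewrite ltr0n lt0n.
have f0sum : \sum_(x in Om) f0 x = 0.
  rewrite /f0 sumrB sumr_const -[m *+ _]mulr_natr /m divfK ?subrr //.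
  by rewrite gt_eqF.
pose F k := iter k P f0.
have Fsum k : \sum_(x in Om) F k x = 0 by elim: k => //= k IH; rewrite /F /= sum_P.
pose L0 := \sum_(x in Om) \sum_(y < N) `|f0 x - f0 (sg y x)|.
have L00 : 0 <= L0 by do 2!(apply: sumr_ge0 => ? _).
have lip0 : Lip f0 L0.
  move=> x y xO yy; apply: (@le_trans _ _ (L0 * 1)); last first.
    by rewrite ler_wpM2l // v_ge1.
  case/andP: yy => _ yN; rewrite mulr1 /L0 (bigD1 x) //= (bigD1 (Ordinal yN)) //=.
  by apply: ler_wpDr; [|apply: ler_wpDr]; do ?(apply: sumr_ge0 => ? _).
have lipk k : Lip (F k) (rho ^+ k * L0).
  elim: k => [|k IH]; first by rewrite mul1r.
  by rewrite exprS -mulrA; apply: Lip_P => //; rewrite mulr_ge0 // exprn_ge0.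
case: sg_conn => D conn.
pose B k := D * (rho ^+ k * L0 * N%:R ^+ 2).
have Fb k x x' : x \in Om -> x' \in Om -> `|F k x - F k x'| <= B k.
  apply: conn => {}x y xO yy; apply: le_trans (lipk k x y xO yy) _.
  apply: ler_wpM2l; first by rewrite mulr_ge0 // exprn_ge0.
  have := v_le y; have := v_ge1 yy; lra.
have Fk k x : x \in Om -> `|F k x| <= B k.
  move=> xO; rewrite -(ler_pM2l Opos) -{1}(ger0_norm (ltW Opos)) -normrM.
  have -> : #|Om|%:R * F k x = \sum_(x' in Om) (F k x - F k x').
    by rewrite sumrB Fsum subr0 sumr_const mulr_natl.
  apply: le_trans (ler_norm_sum _ _ _) _; rewrite mulr_natl -sumr_const.
  by apply: ler_sum => x' x'O; apply: Fb.
have sqE (g : T -> R) : \sum_(x in Om) g x ^+ 2 = dot g g by apply: eq_bigr => x _; rewrite expr2.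
pose b k := dot (F k) (F k).
have b0 k : 0 <= b k by apply: sumr_ge0 => x _; rewrite -expr2 sqr_ge0.
have bc k : b k.+1 ^+ 2 <= b k * b k.+2.
  have -> : b k.+1 = dot (F k) (F k.+2) by apply: (dot_P (F k) (F k.+1)).
  by rewrite /b -!sqE; apply: sqr_sum_le.
have bC k : b k <= (#|Om|%:R * (D * (L0 * N%:R ^+ 2)) ^+ 2) * (rho ^+ 2) ^+ k.
  have -> : (#|Om|%:R * (D * (L0 * N%:R ^+ 2)) ^+ 2) * (rho ^+ 2) ^+ k = \sum_(x in Om) B k ^+ 2.
    by rewrite sumr_const -[RHS]mulr_natl /B -exprM mulnC exprM; ring.
  apply: ler_sum => x xO; rewrite -expr2 -real_normK ?num_real // lerXn2r ?nnegrE ?normr_ge0 ?Fk //.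
  by apply: le_trans _ (Fk k x xO); apply: normr_ge0.
have r2 : 0 <= rho ^+ 2 by apply: sqr_ge0.
have b1 := log_convex_decay r2 b0 bc bC.
have dd : dot f0 (P f0) <= rho * b 0%N.
  apply: le_trans (ler_norm _) _.
  rewrite -(ler_pXn2r (n := 2)) ?nnegrE ?mulr_ge0 ?normr_ge0 // real_normK ?num_real //.
  have -> : (rho * b 0%N) ^+ 2 = b 0%N * (rho ^+ 2 * b 0%N) by ring.
  apply: (@le_trans _ _ (b 0%N * b 1%N)); last exact: ler_wpM2l.
  by rewrite /b -!sqE; apply: sqr_sum_le.
have di := dirichlet f0.
have -> : \sum_(x in Om) \sum_(1 <= y < N) (f x - f (sg y x)) ^+ 2 =
   \sum_(x in Om) \sum_(1 <= y < N) (f0 x - f0 (sg y x)) ^+ 2.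
  by apply: eq_bigr => x _; apply: eq_bigr => y _; rewrite /f0; congr (_ ^+ 2); ring.
have -> : \sum_(x in Om) (f x - m) ^+ 2 = b 0%N by apply: eq_bigr => x _; rewrite expr2.
set S := \sum_(x in Om) _ in di *.
have le1 : (1 - rho) * b 0%N <= S / (4 * N.-1%:R) by rewrite -di mulrBl mul1r lerB.
have := Np1 => p1; have n0 : 0 < N%:R :> R by rewrite Npred; lra.
have p0 : 0 < N.-1%:R :> R by lra.
have e1 : (1 - rho) * b 0%N = b 0%N * 4 / (N%:R ^+ 2 * N.-1%:R).
  by rewrite /rho; field; rewrite !gt_eqF.
rewrite e1 ler_pdivrMr // in le1.
have e2 : S / (4 * N.-1%:R) * (N%:R ^+ 2 * N.-1%:R) = 4 * (N%:R ^+ 2 / 16 * S).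
  by field; rewrite gt_eqF.
rewrite e2 in le1; lra.
Qed.
End PathCoupling.

(** * Polymer paths *)

Section Paths.
Variables (h N : nat).

Definition cfg := {ffun 'I_N.+1 -> 'I_(h + N).+1}.
Implicit Types (e : cfg) (X : {set 'I_N.+1}).

Definition hh e (x : nat) : nat := if (x < N.+1)%N then val (e (inord x)) else 0%N.

Lemma hh_ord e (i : 'I_N.+1) : hh e i = e i.
Proof. by rewrite /hh ltn_ord inord_val. Qed.

Lemma hh_out e x : (N < x)%N -> hh e x = 0%N.
Proof. by rewrite /hh ltnS ltnNge => /negbTE ->. Qed.

Lemma hh_inj e e' : (forall x, hh e x = hh e' x) -> e = e'.
Proof. by move=> E; apply/ffunP => i; apply: val_inj; rewrite /= -!hh_ord. Qed.

Lemma hh_neq e e' : e != e' -> exists x : 'I_N.+1, hh e x != hh e' x.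
Proof.
move=> ne; apply/existsP; apply: contraNT ne; rewrite negb_exists => /forallP H.
by apply/eqP/ffunP => i; apply: val_inj; have := H i; rewrite negbK !hh_ord => /eqP.
Qed.

Definition mkcfg (F : nat -> nat) : cfg := [ffun i : 'I_N.+1 => inord (F i)].

Lemma hh_mk F x : (x <= N)%N -> (F x <= h + N)%N -> hh (mkcfg F) x = F x.
Proof. by move=> xN FN; rewrite /hh ltnS xN ffunE /= !inordK. Qed.

Definition isP e : bool :=
  [&& hh e 0 == h, hh e N == h &
      [forall x : 'I_N, (hh e x.+1 == (hh e x).+1) || (hh e x == (hh e x.+1).+1)]].

Lemma isPP e : reflect [/\ hh e 0 = h, hh e N = h &
  forall x, (x < N)%N -> hh e x.+1 = (hh e x).+1 \/ hh e x = (hh e x.+1).+1] (isP e).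
Proof.
apply: (iffP and3P) => [[/eqP -> /eqP -> /forallP H]|[-> -> H]]; split => //.
  by move=> x xN; have := H (Ordinal xN) => /orP[/eqP|/eqP] /=; [left|right].
by apply/forallP => x; case: (H x (ltn_ord x)) => ->; rewrite eqxx ?orbT.
Qed.

Lemma isP_le e x : isP e -> (x <= N)%N -> (hh e x <= h + x)%N.
Proof.
case/isPP => e0 _ st; elim: x => [|x IH] xN; first by rewrite e0 addn0.
by have := IH (ltnW xN); case: (st x xN); lia.
Qed.

Lemma isP_odd e x : isP e -> (x <= N)%N -> odd (hh e x) = odd (h + x).
Proof.
case/isPP => e0 _ st; elim: x => [|x IH] xN; first by rewrite e0 addn0.
by have := IH (ltnW xN); case: (st x xN); lia.
Qed.

Definition Zs e : {set 'I_N.+1} := [set x : 'I_N.+1 | hh e x == 0%N].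

Definition Om X : {set cfg} := [set e | isP e && (Zs e == X)].

Lemma OmP e X : reflect (isP e /\ Zs e = X) (e \in Om X).
Proof. by rewrite inE; apply: (iffP andP) => -[? /eqP]. Qed.

(* The corner at y can be flipped without creating or destroying a zero. *)
Definition flippable e y : bool :=
  [&& (0 < y < N)%N, hh e y.-1 == hh e y.+1, (0 < hh e y)%N & (hh e y < (hh e y.-1).*2)%N].

Definition upd e y z : cfg := mkcfg (fun x => if x == y then z else hh e x).

Definition flip y e : cfg :=
  if flippable e y then upd e y ((hh e y.-1).*2 - hh e y) else e.

Lemma hh_bound e x : (hh e x <= h + N)%N.
Proof. by rewrite /hh; case: ifP => // _; rewrite -ltnS ltn_ord. Qed.

Lemma hh_upd e y z x : (y <= N)%N -> (z <= h + N)%N ->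
  hh (upd e y z) x = if x == y then z else hh e x.
Proof.
move=> yN zN; have [xN|xN] := leqP x N; last first.
  by rewrite hh_out // hh_out // ifF //; lia.
by rewrite hh_mk //; case: eqP => // _; apply: hh_bound.
Qed.

Lemma hh_flip y e x : isP e ->
  hh (flip y e) x = if flippable e y && (x == y) then ((hh e y.-1).*2 - hh e y)%N else hh e x.
Proof.
move=> eP; rewrite /flip; have [fl|//] := boolP (flippable e y); rewrite andTb.
case/and4P: (fl) => /andP[y0 yN] /eqP c p q.
rewrite hh_upd //; first exact: ltnW.
have h1 := isP_le eP (ltnW yN).
have h2 : (y.-1 <= N)%N by lia.
have := isP_le eP h2.
case/isPP: eP => _ _ st; have := st y.-1; rewrite prednK // => st1; move: (st1 (ltnW yN)); lia.
Qed.

Lemma isP_flip y e : isP e -> isP (flip y e).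
Proof.
move=> eP; have H := hh_flip y; case/isPP: (eP) => e0 eN st.
have [fl|nf] := boolP (flippable e y); last by rewrite /flip (negbTE nf).
case/and4P: (fl) => /andP[y0 yN] /eqP c p q.
apply/isPP; split; rewrite ?H // ?fl ?andTb.
- by rewrite ifF //; lia.
- by rewrite ifF //; lia.
move=> x xN; rewrite !H // fl !andTb.
have := st x xN; have := st y yN; have := st y.-1; rewrite prednK // => /(_ (ltnW yN)).
have [->|n1] := eqVneq x y; first by rewrite ifF //; lia.
have [e1|n2] := eqVneq x.+1 y; last by [].
have -> : x = y.-1 by lia.
by lia.
Qed.

Lemma Zs_flip y e : isP e -> Zs (flip y e) = Zs e.
Proof.
move=> eP; apply/setP => x; rewrite !inE hh_flip //.
case: ifP => // /andP[/and4P[_ _ p q] /eqP ->].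
lia.
Qed.

Lemma flip_Om y e X : e \in Om X -> flip y e \in Om X.
Proof. by case/OmP => eP zX; apply/OmP; rewrite isP_flip // Zs_flip. Qed.

Lemma flipK y e : isP e -> flip y (flip y e) = e.
Proof.
move=> eP; apply: hh_inj => x; rewrite !hh_flip ?isP_flip //.
have [fl|nf] := boolP (flippable e y); last by rewrite /flip !(negbTE nf).
case/and4P: (fl) => /andP[y0 yN] /eqP c p q.
have fl2 : flippable (flip y e) y.
  rewrite /flippable !hh_flip // fl !andTb y0 yN /= eqxx.
  have -> : (y.-1 == y) = false by lia.
  have -> : (y.+1 == y) = false by lia.
  rewrite -c eqxx /=; lia.
rewrite fl2 !andTb eqxx; case: eqP => // ->.
rewrite ifF; last by lia.
by lia.
Qed.

Lemma flippable_far y z e : isP e -> (y.+1 < z)%N || (z.+1 < y)%N ->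
  flippable (flip y e) z = flippable e z.
Proof.
move=> eP far; rewrite /flippable !hh_flip //.
have -> : (z.-1 == y) = false by lia.
have -> : (z == y) = false by lia.
have -> : (z.+1 == y) = false by lia.
by rewrite !andbF.
Qed.

Lemma flip_comm y z e : isP e -> (y.+1 < z)%N -> flip y (flip z e) = flip z (flip y e).
Proof.
move=> eP far; have eyP := isP_flip y eP; have ezP := isP_flip z eP.
apply: hh_inj => x; rewrite (hh_flip y _ ezP) (hh_flip z _ eyP).
rewrite flippable_far ?far ?orbT // flippable_far ?far //.
rewrite !(hh_flip _ _ eP).
have -> : (y.-1 == z) = false by lia.
have -> : (y == z) = false by lia.
have -> : (z.-1 == y) = false by lia.
have -> : (z == y) = false by lia.
rewrite !andbF.
case: (eqVneq x y) => [->|ny]; last by rewrite !andbF.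
by rewrite (_ : (y == z) = false) ?andbF //; lia.
Qed.

Lemma flip_nbr y z e : isP e -> (z == y.+1) || (y == z.+1) ->
  flip y e != e -> flip z e = e \/ flip z (flip y e) = flip y e.
Proof.
move=> eP nb ne.
have fl : flippable e y by apply: contraNT ne => nf; rewrite /flip (negbTE nf).
have [fz|nz] := boolP (flippable e z); last by left; rewrite /flip (negbTE nz).
right; rewrite {1}/flip ifF //; apply/negbTE/negP => fz'.
case/and4P: fl (fl) => /andP[y0 yN] /eqP c p q fl.
case/and4P: fz => /andP[z0 zN] /eqP cz pz qz.
case/and4P: fz' => _ /eqP cz' _ _; rewrite !hh_flip // fl !andTb in cz'.
case/isPP: eP => _ _ st; have := st y yN; have := st y.-1; rewrite prednK // => /(_ (ltnW yN)).
case/orP: nb => /eqP E; subst.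
- move: cz cz'; rewrite /= eqxx (_ : (y.+2 == y) = false); last by lia.
  lia.
- move: cz cz'; rewrite /= eqxx (_ : (z.-1 == z.+1) = false); last by lia.
  lia.
Qed.

Definition dist e e' : nat := \sum_(x < N.+1) ((hh e x - hh e' x) + (hh e' x - hh e x))%N.

Lemma dist_decr X e e' (x0 : 'I_N.+1) : e \in Om X -> e' \in Om X -> (hh e' x0 < hh e x0)%N ->
  exists2 y, (0 < y < N)%N & (dist (flip y e) e' < dist e e')%N.
Proof.
case/OmP => eP zX /OmP[eP' zX'] lt0.
have := @arg_maxnP _ x0 (fun x : 'I_N.+1 => (hh e' x < hh e x)%N) (fun x : 'I_N.+1 => hh e x) lt0.
case=> y lty mx.
have ylN : (y <= N)%N by rewrite -ltnS.
case/isPP: (eP) => e0 eN st; case/isPP: (eP') => e0' eN' st'.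
have y0 : (0 < y)%N by case: (posnP y) => // E; move: lty; rewrite E e0 e0' ltnn.
have yN : (y < N)%N.
  by rewrite ltn_neqAle ylN andbT; apply/eqP => E; move: lty; rewrite E eN eN' ltnn.
have up : hh e y = (hh e y.+1).+1.
  case: (st y yN) => // E; have lt1 : (y.+1 < N.+1)%N by [].
  have /= H2 := mx (Ordinal lt1); have H1 := st' y yN.
  have : (hh e y.+1 <= hh e y)%N by apply: H2; lia.
  by rewrite E ltnn.
have dn : hh e y = (hh e y.-1).+1.
  have py : (y.-1 < N)%N by lia.
  have := st _ py; have := st' _ py; rewrite prednK // => H1 [//|E].
  have lt1 : (y.-1 < N.+1)%N by lia.
  have /= H2 := mx (Ordinal lt1); have : (hh e y.-1 <= hh e y)%N by apply: H2; lia.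
  by lia.
have pos' : (0 < hh e' y)%N.
  rewrite lt0n; apply/eqP => z0; have : y \in Zs e' by rewrite inE z0.
  by rewrite zX' -zX inE; move: lty; lia.
have par : odd (hh e y) = odd (hh e' y) by rewrite !isP_odd.
have fl : flippable e y by rewrite /flippable y0 yN /=; lia.
exists y; first by rewrite y0.
rewrite /dist (bigD1 y) //= [X in (_ < X)%N](bigD1 y) //= hh_flip // fl eqxx /=.
rewrite (eq_bigr (fun x : 'I_N.+1 => (hh e x - hh e' x) + (hh e' x - hh e x))%N).
  by rewrite ltn_add2r; lia.
by move=> i /negbTE ni; rewrite hh_flip // fl andTb (inj_eq val_inj) ni.
Qed.

Lemma distC e e' : dist e e' = dist e' e.
Proof. by apply: eq_bigr => x _; rewrite addnC. Qed.

Lemma dist_le e e' : (dist e e' <= N.+1 * (h + N).+1)%N.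
Proof.
rewrite -[X in (_ <= X * _)%N]card_ord -sum_nat_const; apply: leq_sum => x _.
rewrite !hh_ord; have := ltn_ord (e x); have := ltn_ord (e' x).
by move: (val (e x)) (val (e' x)) => /=; lia.
Qed.

Lemma Om_conn (R : realType) X : (2 <= N)%N -> exists D : R, forall (f : cfg -> R) (L : R),
  (forall e y, e \in Om X -> (0 < y < N)%N -> `|f e - f (flip y e)| <= L) ->
  forall e e', e \in Om X -> e' \in Om X -> `|f e - f e'| <= D * L.
Proof.
move=> N2; exists (N.+1 * (h + N).+1)%:R => f L lf e e' eX eX'.
have L0 : 0 <= L by apply: le_trans (lf e 1%N eX _); rewrite ?normr_ge0.
suff H : forall n e e', e \in Om X -> e' \in Om X -> (dist e e' <= n)%N -> `|f e - f e'| <= n%:R * L.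
  by apply: H => //; apply: dist_le.
elim=> [|n IH] {eX eX'} {}e {}e' eX eX' dn;
  have [->|ne] := eqVneq e e'; rewrite ?subrr ?normr0 ?mulr_ge0 //.
- have := hh_neq ne.
  case=> x; move: dn; rewrite leqn0 /dist sum_nat_eq0 => /forallP/(_ x) /=; lia.
- have := hh_neq ne.
  have key a b : a \in Om X -> b \in Om X -> (dist a b <= n.+1)%N ->
      (exists x : 'I_N.+1, (hh b x < hh a x)%N) -> `|f a - f b| <= n.+1%:R * L.
    move=> aX bX dab [x lt]; have [y yy dy] := dist_decr aX bX lt.
    have -> : f a - f b = (f a - f (flip y a)) + (f (flip y a) - f b) by ring.
    apply: le_trans (ler_normD _ _) _; rewrite -natr1 mulrDl mul1r addrC lerD ?lf //.
    by apply: IH; rewrite ?flip_Om //; rewrite -ltnS; apply: leq_trans dab.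
  case=> x; rewrite neq_ltn => /orP[lt|lt]; last by apply: key => //; exists x.
  by rewrite distrC; apply: key => //; [rewrite distC|exists x].
Qed.

Definition avg (R : realType) (f : cfg -> R) X : R := (\sum_(e in Om X) f e) / #|Om X|%:R.

Lemma Om_poincare (R : realType) (f : cfg -> R) X : (2 <= N)%N ->
  \sum_(e in Om X) (f e - avg f X) ^+ 2 <=
  N%:R ^+ 2 / 16 * \sum_(e in Om X) \sum_(1 <= y < N) (f e - f (flip y e)) ^+ 2.
Proof.
move=> N2; apply: path_coupling_poincare => //.
- by move=> y e; apply: flip_Om.
- by move=> y e /OmP[eP _]; apply: flipK.
- by move=> y z e /OmP[eP _]; apply: flip_comm.
- by move=> y z e /OmP[eP _]; apply: flip_nbr.
- exact: Om_conn.
Qed.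

Definition lift0 (x : 'I_N.+1) e : cfg := upd e x 2.

Lemma isP_zero_nbr e (x : 'I_N.+1) : (0 < h)%N -> isP e -> x \in Zs e ->
  [/\ (0 < x < N)%N, hh e x.-1 = 1%N & hh e x.+1 = 1%N].
Proof.
move=> h0 eP; rewrite inE => /eqP xz; case/isPP: eP => e0 eN st.
have x0 : (0 < x)%N by case: (posnP x) => // E; move: xz; rewrite E e0; lia.
have xN : (x < N)%N.
  have : (x <= N)%N by rewrite -ltnS.
  by rewrite leq_eqVlt => /orP[/eqP E|//]; move: xz; rewrite E eN; lia.
have := st x xN; have := st x.-1; rewrite prednK // => /(_ (ltnW xN)).
by move=> H1 H2; rewrite x0 xN; split=> //; lia.
Qed.

Lemma hh_lift0 e (x : 'I_N.+1) z : (0 < h)%N -> isP e -> x \in Zs e ->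
  hh (lift0 x e) z = if z == x then 2%N else hh e z.
Proof.
move=> h0 eP xz; have [/andP[x0 xN] _ _] := isP_zero_nbr h0 eP xz.
by rewrite hh_upd //; lia.
Qed.

Lemma lift0_Om e X (x : 'I_N.+1) : (0 < h)%N -> e \in Om X -> x \in X -> lift0 x e \in Om (X :\ x).
Proof.
move=> h0 /OmP[eP zX] xX; have xz : x \in Zs e by rewrite zX.
have [/andP[x0 xN] p1 p2] := isP_zero_nbr h0 eP xz.
have H z := hh_lift0 z h0 eP xz.
case/isPP: (eP) => e0 eN st; apply/OmP; split.
  apply/isPP; split; rewrite ?H; [by rewrite ifF //; lia|by rewrite ifF //; lia|].
  move=> z zN; rewrite !H; have := st z zN.
  have [->|n1] := eqVneq z x; first by rewrite ifF ?p2 //; lia.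
  have [E|n2] := eqVneq z.+1 x; last by [].
  by move: p1; rewrite -E /= => -> _; left.
apply/setP => z; rewrite !inE -zX inE H.
by rewrite (_ : (nat_of_ord z == x) = (z == x)) //; case: (z == x).
Qed.

Lemma lift0_inj X (x : 'I_N.+1) : (0 < h)%N -> x \in X -> {in Om X &, injective (lift0 x)}.
Proof.
move=> h0 xX e e' /OmP[eP zX] /OmP[eP' zX'] E; apply: hh_inj => z.
have xz : x \in Zs e by rewrite zX.
have xz' : x \in Zs e' by rewrite zX'.
have := congr1 (fun e => hh e z) E; rewrite !hh_lift0 //.
by case: eqP => // -> _; move: xz xz'; rewrite !inE => /eqP -> /eqP ->.
Qed.

Lemma Om_parity X (x : 'I_N.+1) : (0 < #|Om X|)%N -> x \in X -> (h <= x)%N /\ ~~ odd (h + x).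
Proof.
case/card_gt0P => e /OmP[eP zX] xX; have xN : (x <= N)%N by rewrite -ltnS.
have : x \in Zs e by rewrite zX.
rewrite inE => /eqP e0; have := isP_odd eP xN; rewrite e0 => <-; split => //.
case/isPP: eP => eh _ st.
suff : (h <= hh e x + x)%N by rewrite e0.
elim: (nat_of_ord x) xN => [|n IH] nN; first by rewrite eh addn0.
by have := IH (ltnW nN); have := st n nN; lia.
Qed.

Lemma Om_parity_right X (x : 'I_N.+1) : (0 < #|Om X|)%N -> x \in X -> (x + h <= N)%N.
Proof.
case/card_gt0P => e /OmP[eP zX] xX; have xN : (x <= N)%N by rewrite -ltnS.
have : x \in Zs e by rewrite zX.
rewrite inE => /eqP e0; case/isPP: eP => _ eN st.
have H n : (x + n <= N)%N -> (hh e (x + n) <= n)%N.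
  elim: n => [|n IH] nN; first by rewrite addn0 e0.
  by rewrite addnS in nN *; have := IH (ltnW nN); have := st _ nN; lia.
by have := H (N - x)%N; rewrite subnKC // eN => /(_ (leqnn _)); lia.
Qed.

End Paths.

(** * Conditioning on the zero set *)

Section Averages.
Variable R : realType.

Lemma jensen_sqr (I : Type) (r : seq I) (P : pred I) (p d : I -> R) (c : R) :
  (\sum_(i <- r | P i) p i) * c = \sum_(i <- r | P i) p i * d i ->
  (forall i, P i -> 0 <= p i) ->
  (\sum_(i <- r | P i) p i) * c ^+ 2 <= \sum_(i <- r | P i) p i * d i ^+ 2.
Proof.
move=> E p0; have : 0 <= \sum_(i <- r | P i) p i * (d i - c) ^+ 2.
  by apply: sumr_ge0 => i /p0 ?; rewrite mulr_ge0 // sqr_ge0.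
have -> : \sum_(i <- r | P i) p i * (d i - c) ^+ 2 = \sum_(i <- r | P i) p i * d i ^+ 2 -
   2 * c * (\sum_(i <- r | P i) p i * d i) + c ^+ 2 * \sum_(i <- r | P i) p i.
  by rewrite !mulr_sumr -sumrB -big_split /=; apply: eq_bigr => i _; ring.
rewrite -E; lra.
Qed.

Section Hybrid.
Variables (N : nat) (W g : {set 'I_N.+1} -> R).
Implicit Types X Y : {set 'I_N.+1}.

Definition hyb (s : nat) X Y : {set 'I_N.+1} :=
  [set x : 'I_N.+1 | if (x < s)%N then x \in Y else x \in X].

Definition cls (l r : 'I_N.+1) X : bool :=
  [&& l \in X, r \in X & [forall (x | x \in X), (l <= x <= r)%N]].

Lemma clsP l r X : reflect [/\ l \in X, r \in X & forall x, x \in X -> (l <= x <= r)%N] (cls l r X).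
Proof.
apply: (iffP and3P) => -[lX rX H]; split => //.
  by move=> x xX; have /forallP/(_ x) := H; rewrite xX.
by apply/forallP => x; apply/implyP => /H.
Qed.

Lemma hyb0 X Y : hyb 0 X Y = X. Proof. by apply/setP => x; rewrite inE ltn0. Qed.

Lemma hybN X Y : hyb N.+1 X Y = Y. Proof. by apply/setP => x; rewrite inE ltn_ord. Qed.

Lemma hybK s X Y : hyb s (hyb s X Y) (hyb s Y X) = X.
Proof. by apply/setP => x; rewrite !inE; case: ltnP. Qed.

Lemma cls_hyb s l r X Y : cls l r X -> cls l r Y -> cls l r (hyb s X Y).
Proof.
move=> /clsP[lX rX HX] /clsP[lY rY HY]; apply/clsP; rewrite !inE lX lY rX rY.
split; [by case: ifP|by case: ifP|].
by move=> x; rewrite inE; case: ifP => _; [apply: HY|apply: HX].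
Qed.

Lemma hybS (s : 'I_N.+1) X Y : hyb s.+1 X Y =
  if s \in Y then s |: hyb s X Y else hyb s X Y :\ s.
Proof.
apply/setP => x; case sY: (s \in Y); rewrite !inE ltnS;
  case: (eqVneq x s) => [->|nxs] /=; rewrite ?leqnn ?ltnn ?sY //.
all: by rewrite leq_eqVlt (inj_eq val_inj) (negbTE nxs).
Qed.

Definition wmass (P : pred {set 'I_N.+1}) : R := \sum_(X | P X) W X.
Definition wmean (P : pred {set 'I_N.+1}) : R := (\sum_(X | P X) W X * g X) / wmass P.
Definition wvar (P : pred {set 'I_N.+1}) : R := \sum_(X | P X) W X * (g X - wmean P) ^+ 2.

Hypothesis W_ge0 : forall X, 0 <= W X.

Lemma wmass_eq0 (P : pred {set 'I_N.+1}) : wmass P = 0 -> forall X, P X -> W X = 0.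
Proof.
move=> w0 X PX; apply/eqP; rewrite eq_le W_ge0 andbT -w0 /wmass (bigD1 X) //= lerDl.
by apply: sumr_ge0.
Qed.

Lemma wmass_mean (P : pred {set 'I_N.+1}) : wmass P * wmean P = \sum_(X | P X) W X * g X.
Proof.
have [w0|w0] := eqVneq (wmass P) 0; last by rewrite /wmean mulrC divfK.
by rewrite w0 mul0r big1 // => X PX; rewrite (wmass_eq0 w0 PX) mul0r.
Qed.

Lemma hybrid_poincare (l r : 'I_N.+1) (kappa : R) : 0 <= kappa ->
  (forall s X Y, cls l r X -> cls l r Y ->
     W X * W Y <= kappa * (W (hyb s X Y) * W (hyb s Y X))) ->
  wvar (cls l r) <= 2 * N.+1%:R * kappa *
   \sum_(X | cls l r X) \sum_(x in X | (x != l) && (x != r)) W X * (g X - g (X :\ x)) ^+ 2.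
Proof.
move=> k0 swapW; set A := cls l r; set S := \sum_(X | _) _.
have S0 : 0 <= S.
  by do 2!(apply: sumr_ge0 => ? _); rewrite mulr_ge0 // sqr_ge0.
have [w0|w0] := eqVneq (wmass A) 0.
  rewrite /wvar big1; last by move=> X AX; rewrite (wmass_eq0 w0 AX) mul0r.
  by rewrite !mulr_ge0.
have wpos : 0 < wmass A by rewrite lt_def w0 /=; apply: sumr_ge0.
pose d (s : 'I_N.+1) X : R :=
  if [&& s \in X, s != l & s != r] then (g X - g (X :\ s)) ^+ 2 else 0.
have d0 s X : 0 <= d s X by rewrite /d; case: ifP => // _; apply: sqr_ge0.
have SE : S = \sum_(s < N.+1) \sum_(X | A X) W X * d s X.
  rewrite exchange_big /=; apply: eq_bigr => X _.
  rewrite big_mkcond /=; apply: eq_bigr => x _; rewrite /d; case: ifP => //.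
  by rewrite mulr0.
have step (s : 'I_N.+1) X Y : A X -> A Y ->
  W X * W Y * (g (hyb s X Y) - g (hyb s.+1 X Y)) ^+ 2 <=
  kappa * (W (hyb s X Y) * W (hyb s Y X) * d s (hyb s X Y)) +
  kappa * (W (hyb s.+1 X Y) * W (hyb s.+1 Y X) * d s (hyb s.+1 X Y)).
  move=> AX AY.
  have p0 Z Z' Z'' : 0 <= kappa * (W Z * W Z' * d s Z'') by rewrite !mulr_ge0.
  have HS := hybS s X Y; case/clsP: (AX) => lX rX _; case/clsP: (AY) => lY rY _.
  have sH : (s \in hyb s X Y) = (s \in X) by rewrite inE ltnn.
  have sH1 : (s \in hyb s.+1 X Y) = (s \in Y) by rewrite inE ltnSn.
  case sY: (s \in Y) HS sH1 => HS sH1; case sX : (s \in X) sH => sH.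
  - have -> : hyb s.+1 X Y = hyb s X Y by rewrite HS; apply/setP => x; rewrite !inE; case: (eqVneq x s) => // ->; rewrite ltnn sX.
    by rewrite subrr expr0n mulr0 addr_ge0.
  - have nl : s != l by apply: contraFneq sX => ->.
    have nr : s != r by apply: contraFneq sX => ->.
    have E : hyb s X Y = hyb s.+1 X Y :\ s by rewrite HS setU1K // sH.
    have -> : d s (hyb s.+1 X Y) = (g (hyb s X Y) - g (hyb s.+1 X Y)) ^+ 2.
      by rewrite /d sH1 nl nr /= -E -sqrrN opprB.
    apply: (@le_trans _ _ (kappa * (W (hyb s.+1 X Y) * W (hyb s.+1 Y X) * (g (hyb s X Y) - g (hyb s.+1 X Y)) ^+ 2))).
      by rewrite [X in _ <= X]mulrA ler_wpM2r ?sqr_ge0 // swapW.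
    by rewrite lerDr.
  - have nl : s != l by apply: contraFneq sY => ->.
    have nr : s != r by apply: contraFneq sY => ->.
    have -> : d s (hyb s X Y) = (g (hyb s X Y) - g (hyb s.+1 X Y)) ^+ 2.
      by rewrite /d sH nl nr /= -HS.
    apply: (@le_trans _ _ (kappa * (W (hyb s X Y) * W (hyb s Y X) * (g (hyb s X Y) - g (hyb s.+1 X Y)) ^+ 2))).
      by rewrite [X in _ <= X]mulrA ler_wpM2r ?sqr_ge0 // swapW.
    by rewrite lerDl.
  - have -> : hyb s.+1 X Y = hyb s X Y.
      by rewrite HS; apply/setP => x; rewrite !inE; case: (eqVneq x s) => // ->; rewrite ltnn sX.
    by rewrite subrr expr0n mulr0 addr_ge0.
have swapS (s : nat) (G : {set 'I_N.+1} -> R) :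
  \sum_(X | A X) \sum_(Y | A Y) W (hyb s X Y) * W (hyb s Y X) * G (hyb s X Y) =
  wmass A * \sum_(X | A X) W X * G X.
  rewrite pair_big /=.
  rewrite (reindex_onto (fun p : _ * _ => (hyb s p.1 p.2, hyb s p.2 p.1))
                        (fun p : _ * _ => (hyb s p.1 p.2, hyb s p.2 p.1))) /=; last first.
    by case=> X Y _ /=; rewrite !hybK.
  rewrite (eq_bigl (fun p : _ * _ => A p.1 && A p.2)) /=; last first.
    case=> X Y /=; rewrite !hybK eqxx andbT; apply/andP/andP => -[AX AY].
      by split; [have := cls_hyb s AX AY|have := cls_hyb s AY AX]; rewrite hybK.
    by split; apply: cls_hyb.
  under eq_bigr do rewrite !hybK.
  rewrite -(pair_big A A (fun X Y => W X * W Y * G X)) /= mulrC mulr_suml.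
  apply: eq_bigr => X _; rewrite /wmass mulr_sumr; apply: eq_bigr => Y _; ring.
have tele X Y : (g X - g Y) ^+ 2 <=
   N.+1%:R * \sum_(s < N.+1) (g (hyb s X Y) - g (hyb s.+1 X Y)) ^+ 2.
  have -> : g X - g Y = \sum_(s < N.+1) (g (hyb s X Y) - g (hyb s.+1 X Y)).
    rewrite -(big_mkord xpredT (fun s => g (hyb s X Y) - g (hyb s.+1 X Y))).
    have := @telescope_sumr R 0 N.+1 (fun s => g (hyb s X Y)) (leq0n _).
    rewrite hyb0 hybN => /(congr1 -%R); rewrite opprB -sumrN => <-.
    by apply: eq_bigr => s _; rewrite opprB.
  by apply: le_trans (sqr_sum_card _ _) _; rewrite card_ord.
rewrite -(ler_pM2l wpos).
apply: (@le_trans _ _ (\sum_(X | A X) \sum_(Y | A Y) W X * W Y * (g X - g Y) ^+ 2)).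
  rewrite /wvar mulr_sumr; apply: ler_sum => X _; rewrite mulrCA.
  under eq_bigr do rewrite -mulrA; rewrite -mulr_sumr; apply: ler_wpM2l => //.
  apply: jensen_sqr; last by move=> Y _.
  under [RHS]eq_bigr do rewrite mulrBr; rewrite sumrB -mulr_suml mulrBr -/(wmass A).
  by rewrite wmass_mean.
apply: (@le_trans _ _ (\sum_(X | A X) \sum_(Y | A Y) N.+1%:R * \sum_(s < N.+1)
  (kappa * (W (hyb s X Y) * W (hyb s Y X) * d s (hyb s X Y)) +
  kappa * (W (hyb s.+1 X Y) * W (hyb s.+1 Y X) * d s (hyb s.+1 X Y))))).
  apply: ler_sum => X AX; apply: ler_sum => Y AY.
  apply: (@le_trans _ _ (W X * W Y * (N.+1%:R * \sum_(s < N.+1) (g (hyb s X Y) - g (hyb s.+1 X Y)) ^+ 2))).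
    by rewrite ler_wpM2l // mulr_ge0.
  rewrite mulrCA ler_wpM2l // mulr_sumr; apply: ler_sum => s _; exact: step.
have -> : wmass A * (2 * N.+1%:R * kappa * S) = N.+1%:R * \sum_(s < N.+1)
   (kappa * (wmass A * \sum_(X | A X) W X * d s X) + kappa * (wmass A * \sum_(X | A X) W X * d s X)).
  rewrite SE !mulr_sumr; apply: eq_bigr => s _; ring.
rewrite le_eqVlt; apply/orP; left; apply/eqP.
under eq_bigr do rewrite -mulr_sumr; rewrite -mulr_sumr; congr (_ * _).
under eq_bigr do rewrite exchange_big; rewrite exchange_big /=; apply: eq_bigr => s _.
under eq_bigr do rewrite big_split -!mulr_sumr; rewrite big_split /= -!mulr_sumr.
by rewrite (swapS s (d s)) (swapS s.+1 (d s)).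
Qed.

Lemma class_edge (P P' U : pred {set 'I_N.+1}) (tau : {set 'I_N.+1} -> {set 'I_N.+1}) (c : R) :
  (forall X, U X -> P X) -> c != 0 ->
  (forall F : {set 'I_N.+1} -> R, \sum_(X | P' X) F X = \sum_(X | U X) F (tau X)) ->
  (forall X, U X -> W (tau X) = c * W X) ->
  wmass U * (wmean P - wmean P') ^+ 2 <=
  2 * wvar P + 2 * \sum_(X | U X) W X * (g X - g (tau X)) ^+ 2.
Proof.
move=> UP c0 tauP Wc.
have mE : wmass P' = c * wmass U.
  by rewrite /wmass tauP mulr_sumr; apply: eq_bigr => X /Wc.
have sE : \sum_(X | U X) W X * g (tau X) = wmass U * wmean P'.
  apply: (mulfI c0); rewrite mulrA -mE wmass_mean tauP mulr_sumr.
  by apply: eq_bigr => X UX; rewrite Wc // mulrA.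
apply: (@le_trans _ _ (\sum_(X | U X) W X * ((wmean P - g X) + (g X - g (tau X))) ^+ 2)).
  apply: jensen_sqr; last by move=> X _.
  have -> : \sum_(X | U X) W X * (wmean P - g X + (g X - g (tau X))) =
    \sum_(X | U X) W X * wmean P - \sum_(X | U X) W X * g (tau X).
    by rewrite -sumrB; apply: eq_bigr => X _; ring.
  by rewrite -mulr_suml sE mulrBr.
apply: (@le_trans _ _ (\sum_(X | U X) (2 * (W X * (g X - wmean P) ^+ 2) + 2 * (W X * (g X - g (tau X)) ^+ 2)))).
  apply: ler_sum => X _; apply: le_trans (ler_wpM2l (W_ge0 X) (sqrD_le _ _)) _.
  by rewrite le_eqVlt; apply/orP; left; apply/eqP; ring.
rewrite big_split /= -!mulr_sumr lerD2r ler_pM2l // /wvar.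
rewrite [X in _ <= X](bigID U) /= [X in _ <= X + _](eq_bigl U); last first.
  by move=> X; case UX: (U X); rewrite ?andbF // andbT UP.
by rewrite lerDl; apply: sumr_ge0 => X _; rewrite mulr_ge0 // sqr_ge0.
Qed.

End Hybrid.

Section ZeroSets.
Variables (h N : nat) (lam : R) (f : cfg h N -> R).
Hypotheses (h_gt0 : (0 < h)%N) (N_ge2 : (2 <= N)%N) (lam_gt0 : 0 < lam).
Implicit Types X : {set 'I_N.+1}.

Definition Wt X : R := lam ^+ #|X| * #|Om h X|%:R.

Lemma Wt_ge0 X : 0 <= Wt X.
Proof. by rewrite mulr_ge0 // exprn_ge0 // ltW. Qed.

Definition flip_energy : R :=
  \sum_(X | X != set0) lam ^+ #|X| * \sum_(e in Om h X) \sum_(1 <= y < N) (f e - f (flip y e)) ^+ 2.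

Definition pin_energy : R :=
  \sum_(X | X != set0) \sum_(x in X | X :\ x != set0)
    lam ^+ #|X| * \sum_(e in Om h X) (f e - f (lift0 x e)) ^+ 2.

Definition inner_var : R :=
  \sum_(X | X != set0) lam ^+ #|X| * \sum_(e in Om h X) (f e - avg f X) ^+ 2.

Definition set_energy : R :=
  \sum_(X | X != set0) \sum_(x in X | X :\ x != set0) Wt X * (avg f X - avg f (X :\ x)) ^+ 2.

Lemma inner_var_le : inner_var <= N%:R ^+ 2 / 16 * flip_energy.
Proof.
rewrite /flip_energy mulr_sumr; apply: ler_sum => X _.
rewrite mulrCA; apply: ler_wpM2l; first by rewrite exprn_ge0 // ltW.
exact: Om_poincare.
Qed.

Lemma pin_step X (x : 'I_N.+1) : x \in X ->
  Wt X * (avg f X - avg f (X :\ x)) ^+ 2 <=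
  2 * (lam ^+ #|X| * \sum_(e in Om h X) (f e - f (lift0 x e)) ^+ 2) +
  2 * lam * (lam ^+ #|X :\ x| * \sum_(e in Om h (X :\ x)) (f e - avg f (X :\ x)) ^+ 2).
Proof.
move=> xX; set Y := X :\ x.
have -> : 2 * lam * (lam ^+ #|Y| * \sum_(e in Om h Y) (f e - avg f Y) ^+ 2) =
   2 * (lam ^+ #|X| * \sum_(e in Om h Y) (f e - avg f Y) ^+ 2).
  by rewrite (cardsD1 x X) xX add1n exprS; ring.
rewrite /Wt -mulrA !(mulrCA 2) -mulrDr; apply: ler_wpM2l; first by rewrite exprn_ge0 // ltW.
have cE : #|Om h X|%:R = \sum_(e in Om h X) (1 : R) by rewrite sumr_const.
apply: (@le_trans _ _ (\sum_(e in Om h X) 1 * ((f e - f (lift0 x e)) + (f (lift0 x e) - avg f Y)) ^+ 2)).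
  rewrite cE; apply: jensen_sqr => //.
  have -> : \sum_(e in Om h X) 1 * (f e - f (lift0 x e) + (f (lift0 x e) - avg f Y)) =
     \sum_(e in Om h X) f e - \sum_(e in Om h X) 1 * avg f Y.
    by rewrite -sumrB; apply: eq_bigr => e _; ring.
  rewrite -mulr_suml -cE mulrBr; congr (_ - _); rewrite /avg.
  have [O0|O0] := eqVneq #|Om h X| 0%N; last by rewrite mulrC divfK // pnatr_eq0.
  rewrite O0 mul0r big_pred0 // => e; apply/negbTE; move/eqP: O0.
  by rewrite cards_eq0 => /eqP ->; rewrite inE.
apply: (@le_trans _ _ (\sum_(e in Om h X) (2 * (f e - f (lift0 x e)) ^+ 2 + 2 * (f (lift0 x e) - avg f Y) ^+ 2))).
  by apply: ler_sum => e _; rewrite mul1r sqrD_le.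
rewrite big_split /= -!mulr_sumr lerD2l ler_pM2l //.
rewrite -(big_imset (fun e => (f e - avg f Y) ^+ 2) (lift0_inj h_gt0 xX)) /=.
rewrite [X in _ <= X](big_setID (lift0 x @: Om h X)) /= (setIidPr _); last first.
  by apply/fintype.subsetP => e /imsetP[e' e'X ->]; apply: lift0_Om.
by rewrite lerDl; apply: sumr_ge0 => e _; apply: sqr_ge0.
Qed.

Lemma set_energy_le : set_energy <= 2 * pin_energy + 2 * lam * N.+1%:R * inner_var.
Proof.
pose F X := lam ^+ #|X| * \sum_(e in Om h X) (f e - avg f X) ^+ 2.
have F0 X : 0 <= F X.
  apply: mulr_ge0; first by rewrite exprn_ge0 // ltW.
  by apply: sumr_ge0 => e _; apply: sqr_ge0.
apply: (@le_trans _ _ (\sum_(X | X != set0) \sum_(x in X | X :\ x != set0)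
  (2 * (lam ^+ #|X| * \sum_(e in Om h X) (f e - f (lift0 x e)) ^+ 2) + 2 * lam * F (X :\ x)))).
  by apply: ler_sum => X _; apply: ler_sum => x /andP[xX _]; apply: pin_step.
have -> : \sum_(X | X != set0) \sum_(x in X | X :\ x != set0)
  (2 * (lam ^+ #|X| * \sum_(e in Om h X) (f e - f (lift0 x e)) ^+ 2) + 2 * lam * F (X :\ x)) =
  2 * pin_energy + 2 * lam * \sum_(X | X != set0) \sum_(x in X | X :\ x != set0) F (X :\ x).
  rewrite /pin_energy !mulr_sumr -big_split; apply: eq_bigr => X _.
  by rewrite !mulr_sumr -big_split.
rewrite lerD2l -[X in _ <= X]mulrA ler_wpM2l //; first by rewrite mulr_ge0 // ltW.
have -> : N.+1%:R * inner_var = \sum_(x < N.+1) \sum_(X | X != set0) F X.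
  by rewrite sumr_const card_ord mulr_natl.
rewrite (exchange_big_dep xpredT) //=; apply: ler_sum => x _.
rewrite (eq_bigl (fun X => (x \in X) && (X :\ x != set0))); last first.
  move=> X; case xX: (x \in X) => /=; last by rewrite andbF.
  by rewrite andbC; case: (X :\ x != set0) => //=; apply/set0Pn; exists x.
have inj : {in [set X : {set 'I_N.+1} | (x \in X) && (X :\ x != set0)] &, injective (fun X => X :\ x)}.
  move=> X Y; rewrite !inE => /andP[xX _] /andP[xY _] E.
  by rewrite -(setD1K xX) E setD1K.
rewrite -big_set -(big_imset F inj) /=.
rewrite big_mkcond [X in _ <= X]big_mkcond; apply: ler_sum => X _.
case: ifP => [/imsetP[Y]|_]; last by case: ifP.
by rewrite inE => /andP[_ nz] ->; rewrite nz.
Qed.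

End ZeroSets.
End Averages.

(** * Transfer matrices *)

Section Transfer.
Variable R : realType.
Implicit Types (u : nat -> nat -> R) (v w : nat -> R).

Definition step w v : nat -> R :=
  fun y => w y * ((if y is y'.+1 then v y' else 0) + v y.+1).

Fixpoint ev u (p : nat) v (n : nat) : nat -> R :=
  if n is n'.+1 then step (u (p + n')%N.+1) (ev u p v n') else v.

Definition delta (i : nat) : nat -> R := fun y => (y == i)%:R.
Definition posw : nat -> R := fun y => (y != 0)%:R.

Lemma step_ext w w' v v' : w =1 w' -> v =1 v' -> step w v =1 step w' v'.
Proof. by move=> E F [|y]; rewrite /step E !F. Qed.

Lemma step_scale c w v y : step w (fun z => c * v z) y = c * step w v y.
Proof. by rewrite /step; case: y => [|y]; ring. Qed.

Lemma ev_ext u u' p v v' n : v =1 v' ->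
  (forall x, (p < x <= p + n)%N -> u x =1 u' x) -> ev u p v n =1 ev u' p v' n.
Proof.
move=> E; elim: n => [|n IH] H //=; apply: step_ext; first by apply: H; lia.
by apply: IH => x xx; apply: H; lia.
Qed.

Lemma ev_scale c u p v n y : ev u p (fun z => c * v z) n y = c * ev u p v n y.
Proof.
elim: n y => [|n IH] y //=.
by rewrite -step_scale; apply: step_ext => // z; apply: IH.
Qed.

Lemma ev_add u p v n m : ev u p v (n + m) =1 ev u (p + n) (ev u p v n) m.
Proof.
elim: m => [|m IH] y; first by rewrite addn0.
by rewrite addnS /= addnA; apply: step_ext.
Qed.

Lemma ev_iter u p v w n : (forall x, (p < x <= p + n)%N -> u x =1 w) ->
  ev u p v n =1 iter n (step w) v.
Proof.
elim: n => [|n IH] H y //=; apply: step_ext; first by apply: H; lia.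
by apply: IH => x xx; apply: H; lia.
Qed.

Lemma iter_ext w v v' n : v =1 v' -> iter n (step w) v =1 iter n (step w) v'.
Proof. by move=> E; elim: n => [|n IH] //=; apply: step_ext. Qed.

Lemma iter_scale c w v n y : iter n (step w) (fun z => c * v z) y = c * iter n (step w) v y.
Proof.
elim: n y => [|n IH] y //=.
by rewrite -step_scale; apply: step_ext => // z; apply: IH.
Qed.

Lemma ev_pin u p v n m y : (forall z, u (p + n)%N.+1 z.+1 = 0) ->
  ev u p v (n.+1 + m) y = ev u p v n.+1 0%N * ev u (p + n.+1) (delta 0) m y.
Proof.
move=> z0; rewrite ev_add -ev_scale; apply: ev_ext => // -[|z]; rewrite /delta /=.
  by rewrite mulr1.
by rewrite mulr0 /step z0 mul0r.
Qed.

Section Sum.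
Variables (h N : nat).
Variable u : nat -> nat -> R.

Let pk (k : nat) (e : cfg h N) : bool :=
  [&& hh e 0 == h, [forall x : 'I_N, (x < k)%N ==> ((hh e x.+1 == (hh e x).+1) || (hh e x == (hh e x.+1).+1))] &
      [forall x : 'I_N.+1, (k < x)%N ==> (hh e x == 0%N)]].

Let pkP k e : reflect [/\ hh e 0 = h,
   forall x, (x < k)%N -> (x < N)%N -> hh e x.+1 = (hh e x).+1 \/ hh e x = (hh e x.+1).+1 &
   forall x, (k < x)%N -> hh e x = 0%N] (pk k e).
Proof.
apply: (iffP and3P) => [[/eqP -> /forallP H /forallP K]|[-> H K]]; split => //.
- move=> x xk xN; have := H (Ordinal xN) => /implyP/(_ xk) /orP[/eqP|/eqP] /=; [left|right] => //.
- move=> x xk; have [xN|xN] := ltnP x N.+1; last by rewrite hh_out.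
  by have := K (Ordinal xN) => /implyP/(_ xk)/eqP.
- apply/forallP => x; apply/implyP => xk; case: (H x xk (ltn_ord x)) => ->; rewrite eqxx ?orbT //.
- by apply/forallP => x; apply/implyP => xk; rewrite K.
Qed.

Let G k y : R := \sum_(e : cfg h N | pk k e && (hh e k == y)) \prod_(x < k.+1) u x (hh e x).

Let v0 : nat -> R := fun y => u 0%N y * delta h y.

Let ev_supp k y : (h + k < y)%N -> ev u 0 v0 k y = 0.
Proof.
elim: k y => [|k IH] y hk /=; first by rewrite /v0 /delta gtn_eqF ?mulr0 // -[h]addn0.
by case: y hk => [|y] hk //; rewrite /step !IH ?addr0 ?mulr0 //; lia.
Qed.

Let G_ev k y : (k <= N)%N -> G k y = ev u 0 v0 k y.
Proof.
elim: k y => [|k IH] y kN.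
  rewrite /G /= /v0 /delta; have [->|nyh] := eqVneq y h; last first.
    rewrite mulr0 big_pred0 // => e; apply/negbTE/negP => /andP[/pkP[-> _ _]].
    by rewrite eq_sym (negbTE nyh).
  pose e0 : cfg h N := mkcfg h N (fun x => if x == 0%N then h else 0%N).
  have He0 x : hh e0 x = if x == 0%N then h else 0%N.
    have [xN|xN] := leqP x N; last by rewrite hh_out // ifF //; lia.
    by rewrite hh_mk //; case: ifP => // _; lia.
  rewrite (big_pred1 e0) => [|e]; first by rewrite big_ord_recl big_ord0 He0.
  apply/andP/eqP => [[/pkP[e0h _ ez] _]|->].
    apply: hh_inj => x; rewrite He0; case: (posnP x) => [->|x0]; first by rewrite e0h.
    by rewrite ez // ifF //; lia.
  rewrite He0 /= eqxx; split => //; apply/pkP; split; [by rewrite He0|by []|].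
  by move=> x x0; rewrite He0 ifF //; lia.
have [yb|yb] := leqP y (h + N); last first.
  rewrite ev_supp; last by lia.
  by rewrite /G big_pred0 // => e; apply/negbTE; have := hh_bound e k.+1; lia.
rewrite /G (reindex_onto (fun e => upd e k.+1 y) (fun e => upd e k.+1 0%N)) /=; last first.
  move=> e /andP[_ /eqP ey]; apply: hh_inj => x; rewrite !hh_upd //.
  by case: eqP => // ->.
have P1 e : (pk k.+1 (upd e k.+1 y) && (hh (upd e k.+1 y) k.+1 == y)) &&
   (upd (upd e k.+1 y) k.+1 0 == e) =
   pk k e && ((y == (hh e k).+1) || (hh e k == y.+1)).
  rewrite hh_upd // eqxx eqxx andbT; apply/andP/andP => [[/pkP[e0 st ez] /eqP E]|[/pkP[e0 st ez] ad]].
    have ek1 : hh e k.+1 = 0%N by rewrite -E hh_upd // eqxx.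
    have kk : (k == k.+1) = false by lia.
    have := st k (ltnSn _) kN; rewrite !hh_upd // eqxx kk => ad; split.
      apply/pkP; split.
      - by move: e0; rewrite hh_upd.
      - move=> x xk xN; have := st x (ltnW xk) xN; rewrite !hh_upd //.
        have -> : (x.+1 == k.+1) = false by clear -xk; lia.
        by have -> : (x == k.+1) = false by clear -xk; lia.
      move=> x xk; have [->//|nx] := eqVneq x k.+1.
      have kx : (k.+1 < x)%N by clear -xk nx; lia.
      by have := ez x kx; rewrite hh_upd // (negbTE nx).
    by case: ad => ->; rewrite eqxx ?orbT.
  have ek1 : hh e k.+1 = 0%N by rewrite ez.
  split; last first.
    by apply/eqP/hh_inj => x; rewrite !hh_upd //; case: eqP => // ->.
  apply/pkP; split.
  - by rewrite hh_upd.
  - move=> x xk xN; rewrite !hh_upd //.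
    have -> : (x == k.+1) = false by clear -xk; lia.
    have [E|nx] := eqVneq x.+1 k.+1; last by apply: st => //; clear -xk nx; lia.
    by case: E => ->; case/orP: ad => /eqP ->; [left|right].
  - by move=> x xk; rewrite hh_upd // gtn_eqF // ez // ltnW.
rewrite (eq_bigl _ _ P1).
have P2 (e : cfg h N) : \prod_(x < k.+2) u x (hh (upd e k.+1 y) x) = (\prod_(x < k.+1) u x (hh e x)) * u k.+1 y.
  rewrite big_ord_recr /= (hh_upd e k.+1 kN yb) eqxx; congr (_ * _); apply: eq_bigr => x _.
  by rewrite (hh_upd e x kN yb) ltn_eqF.
under eq_bigr do rewrite P2; rewrite -mulr_suml mulrC /step add0n; congr (_ * _).
rewrite -(IH y.+1) ?(ltnW kN) // (bigID (fun e => hh e k == y.+1)) /= addrC; congr (_ + _).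
  case: y yb {P1 P2} => [|y] yb.
    rewrite big_pred0 // => e; apply/negbTE/negP => /andP[/andP[_ /orP[/eqP//|->]]] //.
  rewrite -(IH y) ?(ltnW kN) // /G; apply: eq_bigl => e.
  by case: (pk k e) => //=; lia.
by rewrite /G; apply: eq_bigl => e; case: (pk k e) => //=; lia.
Qed.

Lemma path_sum : \sum_(e : cfg h N | isP e) \prod_(x < N.+1) u x (hh e x) =
  ev u 0 (fun y => u 0%N y * delta h y) N h.
Proof.
rewrite -[RHS](G_ev h (leqnn N)) /G; apply: eq_bigl => e.
apply/isPP/andP => [[e0 eN st]|[/pkP[e0 st _] /eqP eN]].
  rewrite eN eqxx; split=> //; apply/pkP; split => //; first by move=> x _; apply: st.
  by move=> x xN; rewrite hh_out.
by split=> // x xN; apply: st.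
Qed.

End Sum.
End Transfer.

(** * First passages and excursions *)

Section Counting.
Variable R : realType.
Implicit Types lam : R.

Definition posev (i n : nat) : nat -> R :=
  iter n (step (@posw R)) (@delta R i).

Lemma posev_zero i n y : (i + n < y)%N || odd (i + n + y) -> posev i n y = 0.
Proof.
elim: n y => [|n IH] y H; first by rewrite /posev /= /delta; case: eqP H => //; lia.
rewrite /posev /= /step /posw; case: y H => [|y] H; first by rewrite mul0r.
by rewrite -![iter n _ _ _]/(posev i n _) !IH ?addr0 ?mulr0 //; lia.
Qed.

(* Reflection principle: b is the number of down steps. *)
Lemma posev_bin i n y b : (0 < i)%N -> (y + b.*2 = i + n)%N ->
  posev i n y = 'C(n, b)%:R - (if (i <= b)%N then 'C(n, b - i)%:R else 0).
Proof.
move=> i0; elim: n y b => [|n IH] y b E.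
  rewrite /posev /= /delta; have -> : (i <= b)%N = false by lia.
  case: b E => [|b] E; first by rewrite bin0 subr0 (_ : y == i) //; lia.
  have -> : (y == i) = false by lia.
  by rewrite bin_small // subrr.
rewrite /posev /= /step /posw.
case: y E => [|y] E.
  rewrite mul0r; case: ifP => ib.
    have -> : (b - i)%N = (n.+1 - b)%N by lia.
    by rewrite bin_sub ?subrr //; lia.
  by rewrite bin_small ?subrr //; lia.
rewrite /= mul1r -![iter n _ _ _]/(posev i n _) (IH y b); last by lia.
case: b E => [|b] E.
  rewrite posev_zero; last by lia.
  have -> : (i <= 0)%N = false by lia.
  by rewrite !bin0 addr0.
rewrite (IH y.+2 b); last by lia.
rewrite binS natrD; case: (ltngtP i b.+1) => ib.
- have -> : (i <= b)%N by lia.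
  have -> : (b.+1 - i = (b - i).+1)%N by lia.
  by rewrite binS natrD; ring.
- have -> : (i <= b)%N = false by lia.
  ring.
- have -> : (i <= b)%N = false by lia.
  by rewrite ib subnn !bin0; ring.
Qed.

Lemma posev0S n y : posev 0 n.+1 y = posev 1 n y.
Proof.
rewrite /posev iterSr; apply: iter_ext => -[|[|z]]; rewrite /step /posw /delta /=.
- by rewrite mul0r.
- by rewrite addr0 mulr1.
- by rewrite addr0 mulr0.
Qed.

(* Number of paths from height h > 0 that hit 0 for the first time after h + 2 i steps. *)
Definition fpass (h i : nat) : R :=
  'C((h + i.*2).-1, i)%:R - (if i is i'.+1 then 'C((h + i.*2).-1, i')%:R else 0).

Lemma posev_fpass h i : (0 < h)%N -> posev h (h + i.*2).-1 1 = fpass h i.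
Proof.
move=> h0; rewrite (@posev_bin _ _ _ (h + i).-1) //; last by lia.
rewrite /fpass; congr (_ - _).
  by rewrite -bin_sub; [congr ('C(_, _)%:R)|]; lia.
case: i => [|i]; first by have -> : (h <= (h + 0).-1)%N = false by lia.
have -> : (h <= (h + i.+1).-1)%N by lia.
by congr ('C(_, _)%:R); lia.
Qed.

Lemma posev_lastexit h i : (0 < h)%N -> posev 1 (h + i.*2).-1 h = fpass h i.
Proof.
move=> h0; rewrite (@posev_bin _ _ _ i) //; last by lia.
by rewrite /fpass; congr (_ - _); case: i => //= i; rewrite subSS subn0.
Qed.

Lemma fpass_ballot h i : (0 < h)%N -> (h%:R + 2 * i%:R) * fpass h i = h%:R * 'C(h + i.*2, i)%:R.
Proof.
move=> h0; set n := (h + i.*2).-1.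
have nE : (h + i.*2 = n.+1)%N by rewrite prednK //; lia.
have e1 : ('C(n.+1, i) * (h + i) = (h + i.*2) * 'C(n, i))%N.
  have -> : (h + i = n.+1 - i)%N by lia.
  by rewrite mulnC -mul_bin_down nE.
have e2 : (h + i)%:R * fpass h i = h%:R * 'C(n, i)%:R.
  rewrite /fpass -/n; clearbody n; case: i nE e1 => [|i] nE e1; first by rewrite subr0 addn0.
  have e3 : ((h + i.+1) * 'C(n, i) = i.+1 * 'C(n, i.+1))%N.
    by rewrite mul_bin_left; congr (_ * _)%N; lia.
  have e4 : (h + i.+1)%:R * 'C(n, i)%:R = i.+1%:R * 'C(n, i.+1)%:R :> R by rewrite -!natrM e3.
  by rewrite mulrBr e4 -mulrBl natrD addrK.
have p0 : (h + i)%:R != 0 :> R by rewrite pnatr_eq0; lia.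
have e5 : 'C(n.+1, i)%:R * (h + i)%:R = (h + i.*2)%:R * 'C(n, i)%:R :> R by rewrite -!natrM e1.
have e6 : h%:R + 2 * i%:R = (h + i.*2)%:R :> R by rewrite natrD -mul2n natrM.
apply: (mulfI p0); rewrite e6 mulrCA e2 mulrCA -e5 nE; ring.
Qed.

Lemma fpassS h i : (0 < h)%N ->
  fpass h i.+1 * ((i%:R + 1) * (h%:R + i%:R + 1)) =
  fpass h i * ((h%:R + 2 * i%:R) * (h%:R + 2 * i%:R + 1)).
Proof.
move=> h0; have b0 := fpass_ballot i h0; have b1 := fpass_ballot i.+1 h0.
have e1 : ('C(h + i.+1.*2, i.+1) * (i.+1 * (h + i).+1) =
   ((h + i.*2).+2 * (h + i.*2).+1) * 'C(h + i.*2, i))%N.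
  have -> : (h + i.+1.*2 = (h + i.*2).+2)%N by lia.
  have := mul_bin_diag (h + i.*2).+2 i; have := mul_bin_down (h + i.*2).+1 i.
  rewrite /= => d1 d2; have -> : ((h + i).+1 = (h + i.*2).+1 - i)%N by lia.
  by rewrite mulnA (mulnC 'C(_, _)) -d2 -mulnA (mulnC 'C(_, _)) -d1 mulnA.
have e2 : 'C(h + i.+1.*2, i.+1)%:R * ((i%:R + 1) * (h%:R + i%:R + 1)) =
  ((h%:R + 2 * i%:R + 2) * (h%:R + 2 * i%:R + 1)) * 'C(h + i.*2, i)%:R :> R.
  have := congr1 (fun n => n%:R : R) e1; rewrite !natrM -!natr1 !natrD -!mul2n !natrM.
  by move=> E; rewrite -addrA -(addrA h%:R) in E *; rewrite E; ring.
have p1 : h%:R + 2 * i.+1%:R != 0 :> R.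
  by rewrite gt_eqF // -natrM -natrD ltr0n; lia.
apply: (mulfI p1); rewrite [LHS]mulrA b1 -[LHS]mulrA e2.
have -> : h%:R + 2 * i.+1%:R = h%:R + 2 * i%:R + 2 :> R by rewrite -natr1; ring.
transitivity ((h%:R + 2 * i%:R + 2 : R) * (h%:R + 2 * i%:R + 1) * (h%:R * 'C(h + i.*2, i)%:R)).
  by ring.
by rewrite -b0; ring.
Qed.

Lemma fpass0 h : fpass h 0 = 1.
Proof. by rewrite /fpass bin0 subr0. Qed.

Lemma fpass_gt0 h i : (0 < h)%N -> 0 < fpass h i.
Proof.
move=> h0; have := fpass_ballot i h0.
have p1 : 0 < h%:R + 2 * i%:R :> R by rewrite -natrM -natrD ltr0n; lia.
by rewrite -(pmulr_rgt0 _ p1) => ->; rewrite -natrM ltr0n muln_gt0 h0 bin_gt0; lia.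
Qed.

(* A log-concave proxy of fpass: the factor (h + 2i)(h + 2i + 1) of fpassS is
   replaced by (h + 2i + 2)^2, which costs at most the factor ((h + 2i) / h)^2. *)
Fixpoint psi (h i : nat) : R :=
  if i is i'.+1 then psi h i' * ((h%:R + 2 * i'%:R + 2) ^+ 2 / ((i'%:R + 1) * (h%:R + i'%:R + 1)))
  else 1.

Lemma psi_den (h i : nat) : 0 < (i%:R + 1) * (h%:R + i%:R + 1) :> R.
Proof. by rewrite !natr1 -natrD natr1 -natrM ltr0n. Qed.

Lemma psi_gt0 h i : (0 < h)%N -> 0 < psi h i.
Proof.
move=> h0; elim: i => [|i IH] //=; rewrite mulr_gt0 // divr_gt0 ?psi_den //.
Qed.

Lemma fpass_rec h i : (0 < h)%N -> fpass h i.+1 = fpass h i *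
  (((h%:R + 2 * i%:R) * (h%:R + 2 * i%:R + 1)) / ((i%:R + 1) * (h%:R + i%:R + 1))).
Proof.
by move=> h0; rewrite mulrA -fpassS // mulfK // gt_eqF // psi_den.
Qed.

Lemma fpass_le_psi h i : (0 < h)%N -> fpass h i <= psi h i.
Proof.
move=> h0; elim: i => [|i IH]; first by rewrite fpass0.
rewrite fpass_rec //=; have n0 : 0 <= h%:R + 2 * i%:R :> R by rewrite -natrM -natrD.
apply: ler_pM => //; first exact: ltW (fpass_gt0 i h0).
by rewrite ler_pM2r ?invr_gt0 ?psi_den //; nra.
Qed.

Lemma psi_le_fpass h i : (0 < h)%N ->
  h%:R ^+ 2 * psi h i <= (h%:R + 2 * i%:R) ^+ 2 * fpass h i.
Proof.
move=> h0; elim: i => [|i IH]; first by rewrite fpass0 mulr0 addr0.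
rewrite fpass_rec //= mulrA.
have n0 : 0 < h%:R + 2 * i%:R :> R by rewrite -natrM -natrD ltr0n; lia.
have -> : (h%:R + 2 * i.+1%:R) ^+ 2 * (fpass h i * ((h%:R + 2 * i%:R) * (h%:R + 2 * i%:R + 1) / ((i%:R + 1) * (h%:R + i%:R + 1)))) =
  (fpass h i * ((h%:R + 2 * i%:R) * (h%:R + 2 * i%:R + 1))) * ((h%:R + 2 * i%:R + 2) ^+ 2 / ((i%:R + 1) * (h%:R + i%:R + 1))).
  by rewrite -natr1; ring.
apply: ler_wpM2r.
  by rewrite divr_ge0 ?ltW ?psi_den // exprn_ge0 //; lra.
apply: le_trans IH _; have := fpass_gt0 i h0; move: (fpass h i) => F F0.
rewrite mulrC ler_pM2l // expr2; nra.
Qed.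

Definition excur (n : nat) : R := posev 0 n.-1 1.

Lemma excurE i : excur i.+1.*2 = fpass 1 i.
Proof. by rewrite /excur doubleS -[_.+2.-1]/(i.*2.+1) posev0S -(@posev_fpass 1). Qed.

Let nexc (i : nat) : R := fpass 1 i / 4 ^+ i.

Let nexc_gt0 i : 0 < nexc i.
Proof. by rewrite divr_gt0 ?fpass_gt0 ?exprn_gt0. Qed.

Let nexcS i : nexc i.+1 * (2 * (i%:R + 2)) = nexc i * (2 * i%:R + 1).
Proof.
rewrite /nexc fpass_rec // exprS; have p0 : 0 <= i%:R :> R by [].
have q0 : (4 : R) ^+ i != 0 by rewrite gt_eqF // exprn_gt0.
field; rewrite q0 /= !gt_eqF //; lra.
Qed.

Let nexc_decr i j : (i <= j)%N -> nexc j <= nexc i.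
Proof.
move=> ij; rewrite -(subnKC ij); elim: (j - i)%N => [|k IH]; first by rewrite addn0.
apply: le_trans IH; rewrite addnS; set n := (i + k)%N; have := nexcS n; have := nexc_gt0 n.
have p0 : 0 <= n%:R :> R by [].
move: (nexc n) (nexc n.+1) (n%:R) p0 => a b x x0 a0 E.
have : (b - a) * (2 * (x + 2)) <= 0 by rewrite mulrBl E; nra.
by rewrite pmulr_lle0 ?subr_le0 //; lra.
Qed.

Let nexc_incr i j : (i <= j)%N -> (i%:R + 1) ^+ 2 * nexc i <= (j%:R + 1) ^+ 2 * nexc j.
Proof.
move=> ij; rewrite -(subnKC ij); elim: (j - i)%N => [|k IH]; first by rewrite addn0.
apply: le_trans IH _; rewrite addnS; set n := (i + k)%N; have := nexcS n; have := nexc_gt0 n.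
have p0 : 0 <= n%:R :> R by [].
rewrite -[n.+1%:R]natr1; move: (nexc n) (nexc n.+1) (n%:R) p0 => a b x x0 a0 E.
have q0 : 0 < 2 * (x + 2) by lra.
rewrite -(ler_pM2r q0) -!mulrA E.
rewrite -subr_ge0.
apply: (@le_trans _ _ (a * ((x + 2) * x))); first by rewrite !mulr_ge0 //; lra.
by rewrite le_eqVlt; apply/orP; left; apply/eqP; ring.
Qed.

Let nexc_ratio a b c d : (a + b = c + d)%N -> (a <= b)%N -> (c <= d)%N ->
  nexc a * nexc b <= 4 * (c%:R + 1) ^+ 2 * (nexc c * nexc d).
Proof.
move=> E ab cd.
have h1 : nexc a <= (c%:R + 1) ^+ 2 * nexc c.
  apply: le_trans (nexc_decr (leq0n a)) _.
  by have := nexc_incr (leq0n c); rewrite add0r expr1n mul1r.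
have h2 : nexc b <= 4 * nexc d.
  have [db|bd] := leqP d b.
    by apply: le_trans (nexc_decr db) _; have := nexc_gt0 d; lra.
  have := nexc_incr (ltnW bd) => h3.
  have p0 : (0 : R) < (b%:R + 1) ^+ 2 by rewrite natr1 exprn_gt0.
  rewrite -(ler_pM2l p0); apply: le_trans h3 _.
  rewrite [X in _ <= X]mulrA ler_pM2r // !natr1.
  have : (d.+1%:R : R) <= 2 * b.+1%:R by rewrite -natrM ler_nat; lia.
  have : (0 : R) <= d.+1%:R by [].
  nra.
apply: (@le_trans _ _ (((c%:R + 1) ^+ 2 * nexc c) * (4 * nexc d))).
  by apply: ler_pM => //; apply: ltW.
by rewrite le_eqVlt; apply/orP; left; apply/eqP; ring.
Qed.

Lemma excur_ratio (n a b c d : nat) :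
  (0 < a)%N -> (0 < b)%N -> (0 < c)%N -> (0 < d)%N -> (a + b = c + d)%N ->
  (c.*2 <= n)%N -> (d.*2 <= n)%N ->
  excur a.*2 * excur b.*2 <= n%:R ^+ 2 * (excur c.*2 * excur d.*2).
Proof.
case: a b c d => [|a] // [|b] // [|c] // [|d] // _ _ _ _ E cn dn.
rewrite !excurE.
have nE i : fpass 1 i = nexc i * 4 ^+ i by rewrite /nexc divfK // gt_eqF // exprn_gt0.
rewrite !nE.
have -> : nexc a * 4 ^+ a * (nexc b * 4 ^+ b) = nexc a * nexc b * 4 ^+ (a + b) by rewrite exprD; ring.
have -> : n%:R ^+ 2 * (nexc c * 4 ^+ c * (nexc d * 4 ^+ d)) = n%:R ^+ 2 * (nexc c * nexc d) * 4 ^+ (a + b).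
  have -> : (a + b = c + d)%N by lia.
  by rewrite exprD; ring.
rewrite ler_pM2r ?exprn_gt0 //.
have key a' b' c' d' : (a' + b' = c' + d')%N -> (a' <= b')%N -> (c' <= d')%N -> (c'.+1.*2 <= n)%N ->
   nexc a' * nexc b' <= n%:R ^+ 2 * (nexc c' * nexc d').
  move=> E' ab cd cn'; apply: le_trans (nexc_ratio E' ab cd) _.
  apply: ler_wpM2r; first by rewrite mulr_ge0 // ltW.
  have : (2 * (c'%:R + 1) : R) <= n%:R by rewrite natr1 -natrM ler_nat; lia.
  have : (0 : R) <= c'%:R by [].
  nra.
have E' : (a + b = c + d)%N by lia.
case: (leqP a b) => ab; case: (leqP c d) => cd.
- exact: key.
- by rewrite (mulrC (nexc c)); apply: key; lia.
- by rewrite (mulrC (nexc a)); apply: key; lia.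
- by rewrite (mulrC (nexc a)) (mulrC (nexc c)); apply: key; lia.
Qed.

Lemma excur_low m : 4 ^+ m <= m.+1%:R ^+ 2 * excur m.+1.*2.
Proof.
rewrite excurE; have := nexc_incr (leq0n m).
by rewrite add0r expr1n mul1r /nexc fpass0 divr1 natr1 mulrA ler_pdivlMr ?exprn_gt0 // mul1r.
Qed.

End Counting.

Section Pinned.
Variable R : realType.
Variable lam : R.
Hypothesis lam_gt0 : 0 < lam.

Definition pinw : nat -> R := fun y => if y == 0%N then lam else 1.

Definition pinev (n : nat) : nat -> R := iter n (step pinw) (fun y => lam * delta R 0 y).

Definition pinZ (n : nat) : R := pinev n 0.

Let pinw_gt0 y : 0 < pinw y. Proof. by rewrite /pinw; case: eqP. Qed.

Lemma pinevS n y : pinev n.+1 y = pinw y * ((if y is y'.+1 then pinev n y' else 0) + pinev n y.+1).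
Proof. by []. Qed.

Lemma pinev_ge0 n y : 0 <= pinev n y.
Proof.
elim: n y => [|n IH] y; first by rewrite /pinev /= /delta mulr_ge0 // ltW.
rewrite /pinev /= /step; apply: mulr_ge0; first exact: ltW.
by apply: addr_ge0; [case: y => [|y] //; apply: IH|apply: IH].
Qed.

Lemma pinev_supp n y : (n < y)%N -> pinev n y = 0.
Proof.
elim: n y => [|n IH] y ny; first by rewrite /pinev /= /delta gtn_eqF ?mulr0.
rewrite /pinev /= /step; case: y ny => [|y] ny //.
by rewrite -![iter n _ _ _]/(pinev n _) !IH ?addr0 ?mulr0 //; lia.
Qed.

Lemma pinev_excur n : lam ^+ 2 * excur R n.+2 <= pinZ n.+2.
Proof.
have low m y : lam * posev R 0 m y <= pinev m y.
  elim: m y => [|m IH] y; first by [].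
  rewrite /posev /pinev /= /step /posw /pinw.
  case: y => [|y] /=; last first.
    by rewrite !mul1r mulrDr lerD // IH.
  by rewrite mul0r mulr0 add0r; apply: mulr_ge0; [apply: ltW|apply: pinev_ge0].
rewrite /pinZ /pinev iterS /step /pinw /= add0r expr2 -mulrA ler_pM2l //.
exact: low n.+1 1%N.
Qed.

Section Super.
Variable s : R.
Hypotheses (s_gt0 : 0 < s) (lam_s : lam * s ^+ 2 <= 1 + s ^+ 2).
Let theta := s + s^-1.
Let Phi (y : nat) : R := if y is 0%N then lam^-1 else s ^+ y.

(* Phi is superharmonic: its pairing with pinev grows at most by the factor theta
   at each step, and exactly by theta when lam = 1 + s^-2. *)
Let drift n K : (n < K)%N ->
  \sum_(y < K.+1) pinev n.+1 y * Phi y =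
  theta * (\sum_(y < K.+1) pinev n y * Phi y) - (theta / lam - s) * pinev n 0.
Proof.
move=> nK.
rewrite big_ord_recl [in RHS]big_ord_recl /=.
have -> : pinev n.+1 0 * lam^-1 = pinev n 1.
  by rewrite pinevS /= add0r mulrAC divff ?mul1r // gt_eqF.
have -> : \sum_(i < K) pinev n.+1 (bump 0 i) * s ^+ bump 0 i =
  \sum_(i < K) pinev n i * s ^+ i.+1 + \sum_(i < K) pinev n i.+2 * s ^+ i.+1.
  rewrite -big_split /=; apply: eq_bigr => i _.
  by rewrite /step -[bump 0 i]/(i.+1) /= mul1r mulrDl.
have e1 : pinev n 1 + \sum_(i < K) pinev n i.+2 * s ^+ i.+1 = \sum_(i < K) pinev n i.+1 * s ^+ i.
  transitivity (\sum_(i < K.+1) pinev n i.+1 * s ^+ i); first by rewrite big_ord_recl /= mulr1.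
  by rewrite big_ord_recr /= (@pinev_supp n K.+1) ?mul0r ?addr0 // ltnW.
have e2 : \sum_(i < K) pinev n i * s ^+ i.+1 = pinev n 0 * s + \sum_(i < K) pinev n i.+1 * s ^+ i.+2.
  transitivity (\sum_(i < K.+1) pinev n i * s ^+ i.+1); last by rewrite big_ord_recl.
  by rewrite big_ord_recr /= (@pinev_supp n K) // mul0r addr0.
rewrite e2.
have -> : \sum_(i < K) pinev n (bump 0 i) * s ^+ bump 0 i = \sum_(i < K) pinev n i.+1 * s ^+ i.+1 by [].
transitivity (pinev n 0 * s + \sum_(i < K) pinev n i.+1 * s ^+ i.+2 + \sum_(i < K) pinev n i.+1 * s ^+ i).
  by rewrite -e1; ring.
have -> : \sum_(i < K) pinev n i.+1 * s ^+ i.+2 = s * \sum_(i < K) pinev n i.+1 * s ^+ i.+1.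
  by rewrite mulr_sumr; apply: eq_bigr => i _; rewrite exprS; ring.
have -> : \sum_(i < K) pinev n i.+1 * s ^+ i = s^-1 * \sum_(i < K) pinev n i.+1 * s ^+ i.+1.
  rewrite mulr_sumr; apply: eq_bigr => i _; rewrite exprS; field.
  by rewrite gt_eqF.
by rewrite /theta; field; rewrite !gt_eqF.
Qed.

Let slack : 0 <= theta / lam - s.
Proof.
rewrite subr_ge0 ler_pdivlMr // /theta -(ler_pM2r s_gt0) mulrDl mulVf ?gt_eqF //.
by move: lam_s; rewrite expr2; lra.
Qed.

Let base K : \sum_(y < K.+1) pinev 0 y * Phi y = 1.
Proof.
rewrite big_ord_recl big1 => [|i _]; last by rewrite /pinev /= /delta mulr0 mul0r.
by rewrite /pinev /= /delta eqxx mulr1 divff ?addr0 // gt_eqF.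
Qed.

Lemma pinZ_upper n : pinZ n <= lam * theta ^+ n.
Proof.
have th0 : 0 <= theta by apply: addr_ge0; rewrite ?invr_ge0 ltW.
have S m : (m <= n)%N -> \sum_(y < n.+1) pinev m y * Phi y <= theta ^+ m.
  elim: m => [|m IH] mn; first by rewrite base.
  rewrite drift //; have := IH (ltnW mn) => IH'.
  apply: (@le_trans _ _ (theta * \sum_(y < n.+1) pinev m y * Phi y)).
    by rewrite gerBl mulr_ge0 // pinev_ge0.
  by rewrite exprS ler_wpM2l.
have := S n (leqnn n); rewrite big_ord_recl /= => H.
rewrite mulrC -ler_pdivrMr //; apply: le_trans H; rewrite lerDl; apply: sumr_ge0 => i _.
by rewrite mulr_ge0 ?pinev_ge0 // exprn_ge0 // ltW.
Qed.

Let norm_lower : lam * s ^+ 2 = 1 + s ^+ 2 ->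
  forall n K, (n <= K)%N -> \sum_(y < K.+1) pinev n y * Phi y = theta ^+ n.
Proof.
move=> E; have sl : theta / lam - s = 0.
  have l0 : lam != 0 by rewrite gt_eqF.
  have s0 : s != 0 by rewrite gt_eqF.
  apply: (mulfI l0); rewrite mulr0 mulrBr mulrCA divff // mulr1.
  by apply: (mulIf s0); rewrite mul0r mulrBl /theta mulrDl mulVf // -!expr2 -mulrA -expr2 E; ring.
elim=> [|n IH] K nK; first by rewrite base.
by rewrite drift // sl mul0r subr0 IH ?exprS // ltnW.
Qed.

Let adj (a c : nat -> R) K : a K.+1 = 0 -> c K.+1 = 0 ->
  \sum_(y < K.+1) step pinw a y * c y / pinw y = \sum_(y < K.+1) a y * step pinw c y / pinw y.
Proof.
move=> a0 c0.
have key (b d : nat -> R) : b K.+1 = 0 -> \sum_(y < K.+1) step pinw b y * d y / pinw y =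
   \sum_(y < K) (b y * d y.+1 + b y.+1 * d y).
  move=> b0; have -> : \sum_(y < K.+1) step pinw b y * d y / pinw y =
    \sum_(y < K.+1) (if val y is y'.+1 then b y' else 0) * d y + \sum_(y < K.+1) b y.+1 * d y.
    rewrite -big_split /=; apply: eq_bigr => y _; rewrite /step.
    have p0 : pinw y != 0 by rewrite gt_eqF.
    by rewrite -mulrDl mulrAC (mulrC (pinw y)) mulfK.
  rewrite big_ord_recl /= mul0r add0r [X in _ + X]big_ord_recr /= b0 mul0r addr0.
  by rewrite big_split.
rewrite key //; under [RHS]eq_bigr do rewrite (mulrC (a _)); rewrite key //.
by apply: eq_bigr => y _; ring.
Qed.

Let pinZ_sq m : pinZ m.*2 = \sum_(y < m.*2.+2) pinev m y ^+ 2 / pinw y.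
Proof.
have H k : (k <= m)%N -> pinZ m.*2 = \sum_(y < m.*2.+2) pinev (m.*2 - k) y * pinev k y / pinw y.
  elim: k => [|k IH] km.
    rewrite subn0 big_ord_recl big1 => [|i _]; last by rewrite /pinev /= /delta !(mulr0, mul0r).
    rewrite addr0 /pinev /= /delta /pinw /= mulr1 mulfK // gt_eqF //.
  rewrite IH ?(ltnW km) //; have -> : (m.*2 - k = (m.*2 - k.+1).+1)%N by lia.
  by apply: adj; apply: pinev_supp; lia.
rewrite (H m (leqnn m)); apply: eq_bigr => y _.
by have -> : (m.*2 - m = m)%N by lia.
Qed.

Lemma pinZ_lower m : s <= 1 -> 1 <= lam -> lam * s ^+ 2 = 1 + s ^+ 2 ->
  theta ^+ m.*2 <= m.+1%:R * pinZ m.*2.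
Proof.
move=> s1 lam1 E; have := norm_lower E (leqnn m) => N0.
have th0 : 0 < theta by rewrite addr_gt0 ?invr_gt0.
pose rt (y : nat) : R := Num.sqrt (pinw y).
have rt0 y : rt y != 0 by rewrite gt_eqF // sqrtr_gt0.
have rt2 y : rt y ^+ 2 = pinw y by rewrite sqr_sqrtr // ltW.
have CS := sqr_sum_le (index_enum 'I_m.+1) xpredT (fun y => rt y * Phi y) (fun y => pinev m y / rt y).
have E1 : \sum_(y < m.+1) rt y * Phi y * (pinev m y / rt y) = theta ^+ m.
  by rewrite -N0; apply: eq_bigr => y _; field.
have E2 : \sum_(y < m.+1) (rt y * Phi y) ^+ 2 <= m.+1%:R.
  apply: (@le_trans _ _ (\sum_(y < m.+1) 1)); last by rewrite sumr_const card_ord.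
  apply: ler_sum => y _; rewrite exprMn rt2 /pinw /Phi; case: (val y) => [|z] /=.
    by rewrite expr2 mulrA divff ?mul1r ?invf_le1 // gt_eqF.
  by rewrite mul1r -exprM exprn_ile1 // ltW.
have E3 : \sum_(y < m.+1) (pinev m y / rt y) ^+ 2 <= pinZ m.*2.
  rewrite pinZ_sq; have le1 : (m.+1 <= m.*2.+2)%N by lia.
  have q0 (y : nat) : 0 <= pinev m y ^+ 2 / pinw y by rewrite divr_ge0 ?sqr_ge0 // ltW.
  rewrite (big_ord_widen _ (fun y => (pinev m y / rt y) ^+ 2) le1) big_mkcond.
  apply: ler_sum => y _; case: ifP => _; last exact: q0.
  by rewrite expr_div_n rt2.
rewrite E1 -exprM muln2 in CS; apply: le_trans CS _.
have A0 : 0 <= \sum_(y < m.+1) (pinev m y / rt y) ^+ 2 by apply: sumr_ge0 => y _; apply: sqr_ge0.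
by apply: ler_pM => //; apply: sumr_ge0 => y _; apply: sqr_ge0.
Qed.

End Super.

Lemma pinZ_bounds : exists theta c : R, [/\ 2 <= theta, 0 < c &
  forall m, c * theta ^+ m.*2 <= m.+1%:R ^+ 2 * pinZ m.*2 /\ pinZ m.*2 <= lam * theta ^+ m.*2].
Proof.
have [l2|l2] := leP lam 2.
  exists 2, (Num.min lam (lam ^+ 2 / 4)); split => //.
    by rewrite lt_min lam_gt0 divr_gt0 // exprn_gt0.
  move=> m; split; last first.
    have := @pinZ_upper 1 ltr01 _ m.*2; rewrite invr1; apply.
    by rewrite expr1n mulr1; lra.
  case: m => [|m].
    rewrite /= expr1n mul1r mulr1 ge_min /pinZ /pinev /= /delta eqxx mulr1 lexx //.
  have k1 := pinev_excur m.*2; have k2 := excur_low R m.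
  apply: (@le_trans _ _ (lam ^+ 2 / 4 * 2 ^+ m.+1.*2)).
    by rewrite ler_pM2r ?exprn_gt0 // ge_min lexx orbT.
  have -> : lam ^+ 2 / 4 * 2 ^+ m.+1.*2 = lam ^+ 2 * 4 ^+ m.
    rewrite -mul2n exprM; have -> : (2 : R) ^+ 2 = 4 by ring.
    by rewrite [4 ^+ m.+1]exprS; field.
  apply: (@le_trans _ _ (lam ^+ 2 * (m.+1%:R ^+ 2 * excur R m.+1.*2))).
    by rewrite ler_wpM2l // sqr_ge0.
  rewrite mulrCA; apply: ler_pM.
  - by rewrite sqr_ge0.
  - by rewrite mulr_ge0 ?sqr_ge0 // excurE ltW // fpass_gt0.
  - by rewrite lerXn2r ?nnegrE // ler_nat.
  - by rewrite doubleS.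
have l1 : 0 < lam - 1 by lra.
pose s := (Num.sqrt (lam - 1))^-1.
have r0 : 0 < Num.sqrt (lam - 1) by rewrite sqrtr_gt0.
have s0 : 0 < s by rewrite invr_gt0.
have s2 : s ^+ 2 = (lam - 1)^-1 by rewrite /s exprVn sqr_sqrtr // ltW.
have s1 : s <= 1.
  rewrite -(ler_pXn2r (n := 2)) ?nnegrE ?ler01 ?(ltW s0) // s2 expr1n invf_le1 //; lra.
have E : lam * s ^+ 2 = 1 + s ^+ 2.
  by rewrite s2; field; rewrite gt_eqF.
exists (s + s^-1), 1; split => //.
  rewrite -subr_ge0; have -> : s + s^-1 - 2 = (s - 1) ^+ 2 / s by field; rewrite gt_eqF.
  by rewrite divr_ge0 ?sqr_ge0 // ltW.
move=> m; split; last by apply: pinZ_upper => //; rewrite E.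
have H : (s + s^-1) ^+ m.*2 <= m.+1%:R * pinZ m.*2 by apply: pinZ_lower => //; lra.
rewrite mul1r; apply: le_trans H _.
rewrite ler_wpM2r ?pinev_ge0 // -natrX ler_nat; lia.
Qed.

End Pinned.

(** * Weights of zero sets *)

Section ClassWeights.
Variables (R : realType) (h N : nat) (lam : R).
Hypotheses (h_gt0 : (0 < h)%N) (lam_gt0 : 0 < lam).
Implicit Types (X Y : {set 'I_N.+1}) (l r a b : 'I_N.+1).

Lemma prod_bool n (b : 'I_n -> bool) : \prod_(x < n) ((b x)%:R : R) = [forall x, b x]%:R.
Proof.
case: forallP => [H|/forallP]; first by rewrite big1 // => x _; rewrite H.
by rewrite negb_forall => /existsP[x /negbTE bx]; rewrite (bigD1 x) //= bx mul0r.
Qed.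

Let inX X (x : nat) : bool := (x < N.+1)%N && (inord x \in X).

Let inXE X (x : 'I_N.+1) : inX X x = (x \in X).
Proof. by rewrite /inX ltn_ord inord_val. Qed.

Let uset X (x y : nat) : R := ((y == 0%N) == inX X x)%:R.

Let vset X : nat -> R := fun y => uset X 0 y * delta R h y.

Lemma card_Om X : #|Om h X|%:R = ev (uset X) 0 (vset X) N h :> R.
Proof.
rewrite -path_sum -sum1_card natr_sum /=.
rewrite [RHS](eq_bigr (fun e => ((Zs e == X)%:R : R))) => [|e eP]; last first.
  rewrite (prod_bool (fun x : 'I_N.+1 => (hh e x == 0%N) == inX X x)); congr (_%:R).
  congr nat_of_bool; apply/forallP/eqP => [H|E x]; last by rewrite inXE -E inE eqxx.
  by apply/setP => x; rewrite inE; have /eqP := H x; rewrite inXE.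
rewrite (bigID (fun e => Zs e == X)) /= [X in _ + X]big1 ?addr0; last first.
  by move=> e; rewrite inE; case/andP=> /andP[_ ->].
rewrite [RHS](bigID (fun e => Zs e == X)) /= [X in _ = _ + X]big1 ?addr0; last first.
  by move=> e /andP[_ /negbTE ->].
apply: eq_big => e; first by rewrite inE -andbA andbb.
by case/andP=> _ ->.
Qed.

Let Lsum X (a : nat) : R := ev (uset X) 0 (vset X) a 0.
Let Rsum X (b : nat) : R := ev (uset X) b (@delta R 0) (N - b) h.

Let Lsum_ext X Y (n : nat) : (forall x : 'I_N.+1, (x <= n)%N -> (x \in X) = (x \in Y)) ->
  Lsum X n = Lsum Y n.
Proof.
move=> H; have E x : (x <= n)%N -> uset X x =1 uset Y x.
  move=> xn y; rewrite /uset /inX; case: ltnP => //= xN; rewrite H // inordK //.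
apply: ev_ext => [y|x /andP[_ xn]]; last exact: E.
by rewrite /vset E.
Qed.

Let Rsum_ext X Y (n : nat) : (forall x : 'I_N.+1, (n < x)%N -> (x \in X) = (x \in Y)) ->
  Rsum X n = Rsum Y n.
Proof.
move=> H; apply: ev_ext => // x /andP[nx _] y.
by rewrite /uset /inX; case: ltnP => //= xN; rewrite H // inordK.
Qed.

Let pin_uset X a z : a \in X -> uset X a z.+1 = 0.
Proof. by move=> aX; rewrite /uset inXE aX. Qed.

Let pos_uset X (x : nat) : ~~ inX X x -> uset X x =1 @posw R.
Proof. by move=> /negbTE xX y; rewrite /uset xX /posw; case: (y == 0%N). Qed.

Lemma card_pin X a : a \in X -> (0 < a)%N -> #|Om h X|%:R = Lsum X a * Rsum X a :> R.
Proof.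
move=> aX a0; have aN : (a <= N)%N by rewrite -ltnS.
rewrite card_Om; have E : (N = a.-1.+1 + (N - a))%N by lia.
rewrite [in LHS]E ev_pin ?add0n ?(prednK a0) // => z; exact: pin_uset.
Qed.

Let Rsum_gap X a b : a \in X -> b \in X -> (a < b)%N ->
  (forall x : 'I_N.+1, (a < x < b)%N -> x \notin X) ->
  Rsum X a = excur R (b - a) * Rsum X b.
Proof.
move=> aX bX ab gap; have bN : (b <= N)%N by rewrite -ltnS.
rewrite /Rsum; have E : (N - a = (b - a).-1.+1 + (N - b))%N by lia.
have e1 : (a + (b - a).-1).+1 = b :> nat by lia.
rewrite E ev_pin; last by move=> z; rewrite e1; exact: pin_uset.
rewrite addnS e1; congr (_ * _).
rewrite /= e1 /step {1}/uset inXE bX /= mul1r add0r /excur.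
apply: ev_iter => x xx y; apply: pos_uset; apply/negP => /andP[xN xX].
by have := gap (inord x); rewrite xX inordK // => /(_ _) /negP; apply; lia.
Qed.

Lemma card_gap X a b : a \in X -> b \in X -> (0 < a < b)%N ->
  (forall x : 'I_N.+1, (a < x < b)%N -> x \notin X) ->
  #|Om h X|%:R = Lsum X a * (excur R (b - a) * Rsum X b) :> R.
Proof. by move=> aX bX /andP[a0 ab] gap; rewrite (card_pin aX a0) (Rsum_gap aX bX ab gap). Qed.

Lemma card_hyb s X Y : (#|X| + #|Y| = #|hyb s X Y| + #|hyb s Y X|)%N.
Proof.
have H (Z Z' : {set 'I_N.+1}) : #|hyb s Z Z'| = (\sum_(x : 'I_N.+1) (if (x < s)%N then x \in Z' else x \in Z))%N.
  rewrite -sum1_card big_mkcond /=; apply: eq_bigr => x _; rewrite inE.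
  by case: (x < s)%N; [case: (x \in Z')|case: (x \in Z)].
have K (Z : {set 'I_N.+1}) : #|Z| = (\sum_(x : 'I_N.+1) (x \in Z))%N.
  by rewrite -sum1_card big_mkcond /=; apply: eq_bigr => x _; case: (x \in Z).
rewrite !H !K -!big_split /=; apply: eq_bigr => x _; case: (x < s)%N => //; exact: addnC.
Qed.

Lemma swap_weight l r s X Y : cls l r X -> cls l r Y ->
  Wt h lam X * Wt h lam Y <= N%:R ^+ 2 * (Wt h lam (hyb s X Y) * Wt h lam (hyb s Y X)).
Proof.
move=> /clsP[lX rX HX] /clsP[lY rY HY].
have rhs0 (Z Z' : {set 'I_N.+1}) : 0 <= N%:R ^+ 2 * (Wt h lam Z * Wt h lam Z').
  by apply: mulr_ge0; [apply: exprn_ge0|apply: mulr_ge0; apply: Wt_ge0].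
case: (posnP #|Om h X|) => [E|oX]; first by rewrite {1}/Wt E mulr0 mul0r.
case: (posnP #|Om h Y|) => [E|oY]; first by rewrite {2}/Wt E !mulr0.
have N1 : 1 <= N%:R ^+ 2 :> R.
  have [hl _] := Om_parity oX lX; have lN : (l <= N)%N by rewrite -ltnS.
  by rewrite -natrX ler1n expn_gt0 (leq_trans h_gt0 (leq_trans hl lN)).
have triv (Z Z' : {set 'I_N.+1}) : Wt h lam Z * Wt h lam Z' <= N%:R ^+ 2 * (Wt h lam Z * Wt h lam Z').
  by rewrite ler_peMl // mulr_ge0 // Wt_ge0.
have [sl|ls] := leqP s l.
  have E (Z Z' : {set 'I_N.+1}) : (forall x, x \in Z -> (l <= x <= r)%N) -> (forall x, x \in Z' -> (l <= x <= r)%N) ->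
     hyb s Z Z' = Z.
    move=> HZ HZ'; apply/setP => x; rewrite inE; case: ltnP => // xs.
    by apply/idP/idP => [/HZ' H|/HZ H]; clear -H xs sl; lia.
  by rewrite !E.
have [rs|sr] := ltnP r s.
  have E (Z Z' : {set 'I_N.+1}) : (forall x, x \in Z -> (l <= x <= r)%N) -> (forall x, x \in Z' -> (l <= x <= r)%N) ->
     hyb s Z Z' = Z'.
    move=> HZ HZ'; apply/setP => x; rewrite inE; case: ltnP => // xs.
    by apply/idP/idP => [/HZ H|/HZ' H]; clear -H xs rs; lia.
  by rewrite !E // (mulrC (Wt h lam X)) triv.
have gapE (Z : {set 'I_N.+1}) : l \in Z -> r \in Z -> exists a b : 'I_N.+1,
   [/\ a \in Z, b \in Z, (l <= a)%N, (a < s)%N & (s <= b)%N] /\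
   (forall x : 'I_N.+1, x \in Z -> (x <= a)%N || (b <= x)%N).
  move=> lZ rZ.
  have Pl : (l \in Z) && (l < s)%N by rewrite lZ.
  have Pr : (r \in Z) && (s <= r)%N by rewrite rZ.
  have [a /andP[aZ as_] amax] := @arg_maxnP _ l (fun x : 'I_N.+1 => (x \in Z) && (x < s)%N) (fun x : 'I_N.+1 => val x) Pl.
  have [b /andP[bZ sb] bmin] := @arg_minnP _ r (fun x : 'I_N.+1 => (x \in Z) && (s <= x)%N) (fun x : 'I_N.+1 => val x) Pr.
  exists a, b; split; first by split => //; apply: amax.
  move=> x xZ; case: (ltnP x s) => xs.
    by have -> : (x <= a)%N by apply: (amax x); rewrite xZ.
  by have -> : (b <= x)%N; [apply: (bmin x); rewrite xZ|rewrite orbT].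
have [a1 [a2 [[a1X a2X la1 a1s sa2] gX]]] := gapE X lX rX.
have [b1 [b2 [[b1Y b2Y lb1 b1s sb2] gY]]] := gapE Y lY rY.
have a2N : (a2 <= N)%N by rewrite -ltnS.
have b2N : (b2 <= N)%N by rewrite -ltnS.
have [hl pl] := Om_parity oX lX.
have [_ pa1] := Om_parity oX a1X; have [_ pa2] := Om_parity oX a2X.
have [_ pb1] := Om_parity oY b1Y; have [_ pb2] := Om_parity oY b2Y.
have cE (Z Z' : {set 'I_N.+1}) (u v u' v' : 'I_N.+1) :
  [/\ u \in Z, (l <= u)%N & (u < s)%N] -> [/\ v' \in Z' & (s <= v')%N] ->
  (forall x : 'I_N.+1, x \in Z -> (x <= u)%N || (v <= x)%N) -> (s <= v)%N ->
  (forall x : 'I_N.+1, x \in Z' -> (x <= u')%N || (v' <= x)%N) -> (u' < s)%N ->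
  #|Om h (hyb s Z' Z)|%:R = Lsum Z u * (excur R (v' - u) * Rsum Z' v') :> R.
  move=> [uZ lu us] [vZ sv] gZ sv2 gZ' us2.
  rewrite (@card_gap (hyb s Z' Z) u v').
  - congr (_ * (_ * _)).
      by apply: Lsum_ext => x xu; rewrite inE (leq_ltn_trans xu us).
    by apply: Rsum_ext => x xv; rewrite inE ltnNge (leq_trans sv (ltnW xv)).
  - by rewrite inE us.
  - by rewrite inE ltnNge sv.
  - by rewrite (leq_trans (leq_trans h_gt0 hl) lu) (leq_trans us sv).
  - move=> x xx; rewrite inE; case: ltnP => xs; apply/negP.
      by move=> /gZ H; clear -xx xs H sv2; lia.
    by move=> /gZ' H; clear -xx xs H us2; lia.
have hyb_id (Z : {set 'I_N.+1}) : hyb s Z Z = Z by apply/setP => x; rewrite inE; case: ifP.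
have eX : #|Om h X|%:R = Lsum X a1 * (excur R (a2 - a1) * Rsum X a2) :> R.
  by rewrite -{1}(hyb_id X); apply: (@cE X X a1 a2 a1 a2).
have eY : #|Om h Y|%:R = Lsum Y b1 * (excur R (b2 - b1) * Rsum Y b2) :> R.
  by rewrite -{1}(hyb_id Y); apply: (@cE Y Y b1 b2 b1 b2).
have eXY : #|Om h (hyb s X Y)|%:R = Lsum Y b1 * (excur R (a2 - b1) * Rsum X a2) :> R.
  by apply: (@cE Y X b1 b2 a1 a2).
have eYX : #|Om h (hyb s Y X)|%:R = Lsum X a1 * (excur R (b2 - a1) * Rsum Y b2) :> R.
  by apply: (@cE X Y a1 a2 b1 b2).
have ratio : excur R (a2 - a1) * excur R (b2 - b1) <= N%:R ^+ 2 * (excur R (a2 - b1) * excur R (b2 - a1)).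
  have ev2 (x y : nat) : (x < y)%N -> ~~ odd (h + x) -> ~~ odd (h + y) -> exists2 k, (y - x = k.*2)%N & (0 < k)%N.
    by clear; move=> xy ox oy; exists ((y - x)./2); lia.
  have [x Ex x0] := ev2 _ _ (leq_trans a1s sa2) pa1 pa2.
  have [y Ey y0] := ev2 _ _ (leq_trans b1s sb2) pb1 pb2.
  have [z Ez z0] := ev2 _ _ (leq_trans b1s sa2) pb1 pa2.
  have [t Et t0] := ev2 _ _ (leq_trans a1s sb2) pa1 pb2.
  by rewrite Ex Ey Ez Et; apply: excur_ratio => //; clear -Ex Ey Ez Et a1s sa2 b1s sb2 a2N b2N; lia.
rewrite /Wt eX eY eXY eYX.
have wE : lam ^+ #|X| * lam ^+ #|Y| = lam ^+ #|hyb s X Y| * lam ^+ #|hyb s Y X|.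
  by rewrite -!exprD (card_hyb s).
have Ls0 (Z : {set 'I_N.+1}) (n y : nat) : 0 <= ev (uset Z) 0 (vset Z) n y.
  elim: n y => [|n IH] y /=; first by apply: mulr_ge0; apply: ler0n.
  by rewrite /step; apply: mulr_ge0; [apply: ler0n|apply: addr_ge0 => //; case: y => [|y] //; apply: IH].
have Rs0 (Z : {set 'I_N.+1}) (n m y : nat) : 0 <= ev (uset Z) n (@delta R 0) m y.
  elim: m y => [|m IH] y /=; first exact: ler0n.
  by rewrite /step; apply: mulr_ge0; [apply: ler0n|apply: addr_ge0 => //; case: y => [|y] //; apply: IH].
set K := lam ^+ #|X| * lam ^+ #|Y| * (Lsum X a1 * Lsum Y b1 * Rsum X a2 * Rsum Y b2).
have K0 : 0 <= K.
  by rewrite /K !mulr_ge0 ?exprn_ge0 ?(ltW lam_gt0) //; [apply: Ls0|apply: Ls0|apply: Rs0|apply: Rs0].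
have -> : lam ^+ #|X| * (Lsum X a1 * (excur R (a2 - a1) * Rsum X a2)) *
  (lam ^+ #|Y| * (Lsum Y b1 * (excur R (b2 - b1) * Rsum Y b2))) =
  K * (excur R (a2 - a1) * excur R (b2 - b1)) by rewrite /K; ring.
have -> : N%:R ^+ 2 *
  (lam ^+ #|hyb s X Y| * (Lsum Y b1 * (excur R (a2 - b1) * Rsum X a2)) *
   (lam ^+ #|hyb s Y X| * (Lsum X a1 * (excur R (b2 - a1) * Rsum Y b2)))) =
  K * (N%:R ^+ 2 * (excur R (a2 - b1) * excur R (b2 - a1))) by rewrite /K wE; ring.
exact: ler_wpM2l.
Qed.

Let Lsum_first X l i : val l = (h + i.*2)%N -> l \in X -> (forall x, x \in X -> (l <= x)%N) ->
  Lsum X l = fpass R h i.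
Proof.
move=> lE lX lmin; rewrite /Lsum lE.
have l0 : (h + i.*2 = (h + i.*2).-1.+1)%N by rewrite prednK // addn_gt0 h_gt0.
have notin x : (x < l)%N -> ~~ inX X x.
  move=> xl; apply/negP => /andP[xN xX]; have := lmin _ xX; rewrite inordK //.
  by clear -xl; lia.
rewrite l0 [LHS]/= ?add0n -l0 /step -lE {1}/uset inXE lX mul1r add0r -posev_fpass //.
rewrite (@ev_iter _ _ _ _ (@posw R)) => [|x xx].
  rewrite lE; apply: iter_ext => y; rewrite /vset /uset (negbTE (notin 0%N _)); last by rewrite lE addn_gt0 h_gt0.
  by rewrite /delta; case: (eqVneq y h) => [->|_]; rewrite ?mulr0 // mulr1; case: (h) h_gt0.
by apply: pos_uset; apply: notin; move: xx h_gt0 lE => /=; clear; lia.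
Qed.

Let Rsum_last X r j : (r + (h + j.*2))%N = N -> (forall x, x \in X -> (x <= r)%N) ->
  Rsum X r = fpass R h j.
Proof.
move=> rE rmax; rewrite /Rsum; have -> : (N - r = h + j.*2)%N by move: rE; clear; lia.
have l0 : (h + j.*2 = (h + j.*2).-1.+1)%N by rewrite prednK // addn_gt0 h_gt0.
rewrite (@ev_iter _ _ _ _ (@posw R)) => [|x /andP[xr _]].
  by rewrite -[iter _ _ _ _]/(posev R 0 (h + j.*2) h) l0 posev0S posev_lastexit.
apply: pos_uset; apply/negP => /andP[xN xX]; have := rmax _ xX; rewrite inordK //.
by clear -xr; lia.
Qed.

Lemma excur2 : excur R 2 = 1.
Proof. by rewrite (@excurE _ 0) fpass0. Qed.

Lemma left_edge_weight i (l l' r : 'I_N.+1) X : val l = (h + i.*2)%N -> val l' = (h + i.+1.*2)%N ->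
  l \in X -> cls l' r (X :\ l) ->
  Wt h lam (X :\ l) = fpass R h i.+1 / (lam * fpass R h i) * Wt h lam X.
Proof.
move=> lE l'E lX /clsP[l'X _ H].
have ll : (l < l')%N by rewrite lE l'E; clear; lia.
have l0 : (0 < l)%N by rewrite lE addn_gt0 h_gt0.
have l'0 : (0 < l')%N by apply: ltn_trans ll.
have l'X' : l' \in X by move: l'X; rewrite inE => /andP[].
have mem x : x \in X -> x != l -> (l' <= x)%N.
  by move=> xX xl; have /H /andP[] : x \in X :\ l by rewrite !inE xl.
have e1 : #|Om h X|%:R = fpass R h i * Rsum X l' :> R.
  rewrite (@card_gap X l l') //; last 2 first.
  - by rewrite l0.
  - move=> x /andP[lx xl']; apply/negP => xX; have := mem x xX.
    by rewrite leqNgt xl' => /(_ _)/negP; apply => //; apply: contraTneq lx => ->; rewrite ltnn.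
  rewrite (Lsum_first lE lX) => [|x xX].
    have -> : (l' - l = 2)%N by rewrite lE l'E; clear; lia.
    by rewrite excur2 mul1r.
  by have [->//|xl] := eqVneq x l; apply: ltnW; apply: leq_trans (mem x xX xl).
have e2 : #|Om h (X :\ l)|%:R = fpass R h i.+1 * Rsum X l' :> R.
  rewrite (card_pin l'X l'0) (Lsum_first l'E l'X) => [|x /H /andP[] //]; congr (_ * _).
  apply: Rsum_ext => x xl'; rewrite !inE; suff -> : x != l by [].
  by apply: contraTneq xl' => ->; rewrite -leqNgt ltnW.
rewrite /Wt e1 e2 (cardsD1 l X) lX add1n exprS; field.
by rewrite !gt_eqF // fpass_gt0.
Qed.

Lemma right_edge_weight j (l r r' : 'I_N.+1) X :
  (r + (h + j.*2))%N = N -> (r' + (h + j.+1.*2))%N = N -> (h <= l)%N ->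
  r \in X -> cls l r' (X :\ r) ->
  Wt h lam (X :\ r) = fpass R h j.+1 / (lam * fpass R h j) * Wt h lam X.
Proof.
move=> rE r'E hl rX /clsP[lX r'X H].
have rr : (r' < r)%N by move: rE r'E; clear; lia.
have r'0 : (0 < r')%N.
  by have /andP[lr _] := H _ r'X; apply: leq_trans lr; apply: leq_trans hl.
have r'X' : r' \in X by move: r'X; rewrite inE => /andP[].
have mem x : x \in X -> x != r -> (x <= r')%N.
  by move=> xX xl; have /H /andP[] : x \in X :\ r by rewrite !inE xl.
have e1 : #|Om h X|%:R = Lsum X r' * fpass R h j :> R.
  rewrite (@card_gap X r' r) //; last 2 first.
  - by rewrite r'0.
  - move=> x /andP[lx xl']; apply/negP => xX; have := mem x xX.
    by rewrite leqNgt lx => /(_ _)/negP; apply => //; apply: contraTneq xl' => ->; rewrite ltnn.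
  rewrite (Rsum_last rE) => [|x xX].
    have -> : (r - r' = 2)%N by move: rE r'E; clear; lia.
    by rewrite excur2 mul1r.
  by have [->//|xl] := eqVneq x r; apply: leq_trans (mem x xX xl) (ltnW rr).
have e2 : #|Om h (X :\ r)|%:R = Lsum X r' * fpass R h j.+1 :> R.
  rewrite (card_pin r'X r'0) (Rsum_last r'E) => [|x /H /andP[] //]; congr (_ * _).
  apply: Lsum_ext => x xl'; rewrite !inE; suff -> : x != r by [].
  by apply: contraTneq xl' => ->; rewrite -ltnNge.
rewrite /Wt e1 e2 (cardsD1 r X) rX add1n exprS; field.
by rewrite !gt_eqF // fpass_gt0.
Qed.

Lemma cls_mass i j (l r : 'I_N.+1) : val l = (h + i.*2)%N -> (r + (h + j.*2))%N = N -> (l <= r)%N ->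
  wmass (Wt h lam) (cls l r) = fpass R h i * pinZ lam (r - l) * fpass R h j.
Proof.
move=> lE rE lr.
have l0 : (0 < l)%N by rewrite lE addn_gt0 h_gt0.
have rN : (r <= N)%N by rewrite -ltnS.
pose ucl (x y : nat) : R := if y == 0%N then (if (l <= x <= r)%N then lam else 0)
  else (if (x == l) || (x == r) then 0 else 1).
have e1 : wmass (Wt h lam) (cls l r) = \sum_(e : cfg h N | isP e) \prod_(x < N.+1) ucl x (hh e x).
  rewrite [RHS](bigID (fun e => cls l r (Zs e))) /= [X in _ = _ + X]big1 ?addr0; last first.
    move=> e /andP[_ nc]; apply/eqP; rewrite prodf_seq_eq0; apply/hasP.
    suff [x /eqP Hx] : exists x : 'I_N.+1, ucl x (hh e x) = 0 by exists x; rewrite ?mem_index_enum.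
    move: nc; rewrite /cls !negb_and => /or3P[]; rewrite ?inE => H.
    - by exists l; rewrite /ucl (negbTE H) eqxx.
    - by exists r; rewrite /ucl (negbTE H) eqxx orbT.
    - move: H; rewrite negb_forall => /existsP[x]; rewrite negb_imply inE => /andP[xz nx].
      by exists x; rewrite /ucl xz (negbTE nx).
  rewrite (partition_big (@Zs h N) (cls l r)) /=; last by move=> e /andP[].
  apply: eq_bigr => X cX; rewrite /Wt -[#|Om h X|]sum1_card natr_sum mulr_sumr.
  apply: eq_big => e; first by rewrite inE; case: eqP => [->|]; rewrite ?cX ?andbT ?andbF.
  case/OmP => _ zX; rewrite mulr1.
  rewrite (eq_bigr (fun x : 'I_N.+1 => if x \in X then lam else 1)).
    by rewrite -big_mkcond /= prodr_const.
  case/clsP: cX => lX rX H x _; rewrite /ucl -zX inE; case: ifP => xz.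
    by rewrite H // -zX inE xz.
  by rewrite ifF //; apply/negbTE; rewrite negb_or; apply/andP; split;
     apply: contraFneq xz => E; [move: lX|move: rX]; rewrite -zX inE -(val_inj E).
rewrite e1 path_sum.
have E1 : (N = l.-1.+1 + (N - l))%N by rewrite prednK // subnKC // (leq_trans lr).
rewrite [LHS](congr1 (fun n => ev ucl 0 _ n h) E1).
rewrite ev_pin ?add0n ?(prednK l0) => [|z]; last by rewrite /ucl eqxx.
have -> : ev ucl 0 (fun y => ucl 0%N y * delta R h y) l 0 = lam * fpass R h i.
  rewrite -[in LHS](prednK l0) [LHS]/= ?add0n (prednK l0) /step {1}/ucl eqxx leqnn lr add0r; congr (_ * _).
  rewrite -posev_fpass // -lE (@ev_iter _ _ _ _ (@posw R)) => [|x xx y].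
    apply: iter_ext => y; rewrite /delta; case: (eqVneq y h) => [->|_]; rewrite ?mulr0 // mulr1.
    rewrite /ucl; case: (h) h_gt0 => //= _ _.
    by rewrite !ltn_eqF // (leq_trans l0).
  rewrite /ucl /posw; case: (y == 0%N); first by rewrite ifF //; move: xx l0; clear; lia.
  by rewrite ifF //; move: xx l0 lr; clear; lia.
have last : ev ucl r (@delta R 0) (N - r) h = fpass R h j.
  have -> : (N - r = h + j.*2)%N by move: rE; clear; lia.
  have q0 : (h + j.*2 = (h + j.*2).-1.+1)%N by rewrite prednK // addn_gt0 h_gt0.
  rewrite (@ev_iter _ _ _ _ (@posw R)) => [|x xx y].
    by rewrite -[iter _ _ _ _]/(posev R 0 (h + j.*2) h) q0 posev0S posev_lastexit.
  rewrite /ucl /posw; case: (y == 0%N); first by rewrite ifF //; move: xx; clear; lia.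
  by rewrite ifF //; move: xx lr; clear; lia.
move: lr; rewrite leq_eqVlt => /orP[/eqP E|lr].
  rewrite E last subnn /pinZ /pinev /= /delta eqxx mulr1; ring.
have E2 : (N - l = (r - l).-1.+1 + (N - r))%N by move: lr rN; clear; lia.
have E3 : ((l + (r - l).-1).+1 = r)%N by move: lr; clear; lia.
rewrite E2 ev_pin; last by move=> z; rewrite E3 /ucl eqxx orbT.
rewrite addnS E3 last; set Q := ev _ _ _ _ _.
suff QE : lam * Q = pinZ lam (r - l) by rewrite -QE; ring.
have E4 : (r - l = (r - l).-1.+1)%N by move: lr; clear; lia.
rewrite /pinZ /pinev iter_scale; congr (_ * _); rewrite {1}E4 /Q /= E3.
rewrite /step /ucl /pinw /= leqnn (ltnW lr) /= !add0r; congr (_ * _).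
apply: ev_iter => x xx y; rewrite /ucl /pinw; case: (y == 0%N); first by rewrite ifT //; move: xx E3; clear; lia.
by rewrite ifF //; move: xx E3; clear; lia.
Qed.

End ClassWeights.

(** * Extreme zeros *)

Section Triangle.
Variables (R : realType) (M : nat) (phi : nat -> R) (rho : R).
Variables (H E1 E2 : nat -> nat -> R).
Hypothesis phi_gt0 : forall i, 0 < phi i.
Hypothesis phi_lc : forall i, (i.+2 <= M)%N -> phi i * phi i.+2 <= phi i.+1 ^+ 2.
Hypothesis rho_ge1 : 1 <= rho.
Hypothesis phi_rho : forall i, (i.+1 <= M)%N -> phi i.+1 <= rho * phi i.
Hypothesis E1_ge0 : forall i j, 0 <= E1 i j.
Hypothesis E2_ge0 : forall i j, 0 <= E2 i j.
Hypothesis H_E1 : forall i j, (i.+1 + j <= M)%N ->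
  phi i * phi j * (H i.+1 j - H i j) ^+ 2 <= E1 i j.
Hypothesis H_E2 : forall i j, (i + j.+1 <= M)%N ->
  phi i * phi j * (H i j.+1 - H i j) ^+ 2 <= E2 i j.

Let phi_cross j k : (j <= k)%N -> (k.+1 <= M)%N -> phi k.+1 * phi j <= phi k * phi j.+1.
Proof.
move=> jk; rewrite -(subnKC jk); elim: (k - j)%N => [|n IH] kM; first by rewrite addn0 mulrC.
rewrite addnS in kM *; set m := (j + n)%N in IH kM *.
have IH' := IH (ltnW kM); have lc := phi_lc kM.
rewrite -(ler_pM2l (phi_gt0 m)).
apply: (@le_trans _ _ (phi m.+1 ^+ 2 * phi j)).
  by rewrite mulrA ler_pM2r.
have -> : phi m * (phi m.+1 * phi j.+1) = phi m.+1 * (phi m * phi j.+1) by ring.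
by rewrite expr2 -mulrA ler_pM2l.
Qed.

Let stop i : bool := (M < i.+1.*2)%N || (phi i.+1 < phi i).

Let stop_ex : exists i, stop i.
Proof. by exists M; rewrite /stop; apply/orP; left; lia. Qed.

Let c := ex_minn stop_ex.

Let c_spec : [/\ (c.*2 <= M)%N, forall i, (i < c)%N -> phi i <= phi i.+1 &
  (M <= c.*2.+1)%N \/ forall i, (c <= i)%N -> (i.+1 <= M)%N -> phi i.+1 <= phi i].
Proof.
rewrite /c; case: ex_minnP => m sm mmin.
have below i : (i < m)%N -> ~~ stop i by move=> im; apply/negP => /mmin; rewrite leqNgt im.
split.
- case: m {sm mmin} below => [|m] below //.
  by have := below m (ltnSn m); rewrite /stop negb_or -leqNgt => /andP[].
- by move=> i /below; rewrite /stop negb_or -!leNgt => /andP[].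
case/orP: sm => [h1|lt]; first by left; move: h1; clear; lia.
right => i; move=> mi; rewrite -(subnKC mi); elim: (i - m)%N => [|n IH] kM.
  by rewrite addn0 ltW.
rewrite addnS in kM *; set k := (m + n)%N in IH kM *.
have IH' := IH (ltnW kM); have lc := phi_lc kM.
rewrite -(ler_pM2l (phi_gt0 k)); apply: le_trans lc _.
by rewrite expr2 ler_pM2r.
Qed.

Let d (i j : nat) : nat := ((i - c) + (c - i) + ((j - c) + (c - j)))%N.

Let EL (n : nat) : R := \sum_(i < M.+1) \sum_(j < M.+1)
  ((if maxn (d i j) (d i.+1 j) == n then E1 i j else 0) +
   (if maxn (d i j) (d i j.+1) == n then E2 i j else 0)).

Let EL_ge0 n : 0 <= EL n.
Proof. by do 2!(apply: sumr_ge0 => ? _); rewrite addr_ge0 //; case: ifP. Qed.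

Let EL_term (n : nat) i j : (i <= M)%N -> (j <= M)%N ->
  (if maxn (d i j) (d i.+1 j) == n then E1 i j else 0) +
  (if maxn (d i j) (d i j.+1) == n then E2 i j else 0) <= EL n.
Proof.
move=> iM jM; have iM' : (i < M.+1)%N by []. have jM' : (j < M.+1)%N by [].
rewrite /EL (bigD1 (Ordinal iM')) //= (bigD1 (Ordinal jM')) //= -addrA lerDl addr_ge0 //.
  by apply: sumr_ge0 => ? _; rewrite addr_ge0 //; case: ifP.
by do 2!(apply: sumr_ge0 => ? _); rewrite addr_ge0 //; case: ifP.
Qed.

Let EL_E1 n i j : (i.+1 + j <= M)%N -> maxn (d i j) (d i.+1 j) = n -> E1 i j <= EL n.
Proof.
move=> ij E; have iM : (i <= M)%N by move: ij; clear; lia.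
have jM : (j <= M)%N by move: ij; clear; lia.
apply: le_trans (EL_term n iM jM); rewrite E eqxx lerDl; by case: ifP.
Qed.

Let EL_E2 n i j : (i + j.+1 <= M)%N -> maxn (d i j) (d i j.+1) = n -> E2 i j <= EL n.
Proof.
move=> ij E; have iM : (i <= M)%N by move: ij; clear; lia.
have jM : (j <= M)%N by move: ij; clear; lia.
apply: le_trans (EL_term n iM jM); rewrite E eqxx lerDr; by case: ifP.
Qed.

Let chain (w A B Q q : R) (k : nat) : 0 < w -> w * A ^+ 2 <= rho * k%:R * Q ->
  w * B ^+ 2 <= rho * q -> 0 <= Q -> w * (A + B) ^+ 2 <= rho * k.+1%:R * (Q + q).
Proof.
move=> w0 hA hB Q0; have r0 : 0 < rho by apply: lt_le_trans rho_ge1.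
case: k hA => [|k] hA.
  have A0 : A = 0.
    apply/eqP; rewrite -sqrf_eq0 eq_le sqr_ge0 andbT -(ler_pM2l w0) mulr0.
    by apply: le_trans hA _; rewrite mulr0 mul0r.
  rewrite A0 add0r mulr1; apply: le_trans hB _; rewrite ler_pM2l // lerDr //.
set K := k.+1%:R in hA *; have K0 : 0 < K by rewrite ltr0n.
have -> : k.+2%:R = K + 1 by rewrite natr1.
rewrite -(ler_pM2l K0).
have sq : K * (A + B) ^+ 2 <= (K + 1) * A ^+ 2 + K * (K + 1) * B ^+ 2.
  by have := sqr_ge0 (A - K * B); lra.
apply: (@le_trans _ _ ((K + 1) * (w * A ^+ 2) + K * (K + 1) * (w * B ^+ 2))).
  have := ler_wpM2l (ltW w0) sq; lra.
have t1 : (K + 1) * (w * A ^+ 2) <= (K + 1) * (rho * K * Q) by rewrite ler_pM2l //; lra.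
have t2 : K * (K + 1) * (w * B ^+ 2) <= K * (K + 1) * (rho * q).
  by rewrite ler_pM2l // mulr_gt0 //; lra.
lra.
Qed.

Let S (n : nat) : R := \sum_(k < n) EL k.+1.

Let S_ge0 n : 0 <= S n. Proof. by apply: sumr_ge0. Qed.

Let S_rec n : S n.+1 = S n + EL n.+1. Proof. by rewrite /S big_ord_recr. Qed.

Let step_bound (w A B q : R) n : 0 < w -> w * A ^+ 2 <= rho * n%:R * S n ->
  w * B ^+ 2 <= rho * q -> q <= EL n.+1 -> w * (A + B) ^+ 2 <= rho * n.+1%:R * S n.+1.
Proof.
move=> w0 hA hB hq; apply: le_trans (chain w0 hA hB (S_ge0 n)) _.
have r0 : 0 <= rho by apply: le_trans rho_ge1.
by rewrite S_rec ler_wpM2l ?mulr_ge0 // lerD2l.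
Qed.

Let weight_down (w w' A Q : R) : w <= w' -> w' * A ^+ 2 <= Q -> w * A ^+ 2 <= Q.
Proof. by move=> ww; apply: le_trans; rewrite ler_wpM2r // sqr_ge0. Qed.

Let le_rho (x : R) : 0 <= x -> x <= rho * x.
Proof. by move=> x0; rewrite ler_peMl. Qed.

(* Each step brings (i, j) closer to (c, c) without decreasing the weight.  On the
   diagonal i + j = M this takes two edges, one lowering the larger index and one
   raising the smaller; only the intermediate point loses a factor rho. *)
Let descent n : forall i j, (i + j <= M)%N -> d i j = n ->
  phi i * phi j * (H i j - H c c) ^+ 2 <= rho * n%:R * S n.
Proof.
have [c2 cup cdn] := c_spec.
have w_gt0 i j : 0 < phi i * phi j by apply: mulr_gt0.
have ph i : 0 <= phi i by apply: ltW.
elim/ltn_ind: n => n IH i j ij dn.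
have splitH i' j' : H i j - H c c = (H i' j' - H c c) + (H i j - H i' j') by ring.
have [/andP[ic ij1]|n1] := boolP ((i < c)%N && (i.+1 + j <= M)%N).
  have dE : d i.+1 j = n.-1 by move: dn ic; rewrite /d; clear; lia.
  have n0 : (n = n.-1.+1)%N by move: dn ic; rewrite /d; clear; lia.
  rewrite (splitH i.+1 j) n0; apply: (@step_bound _ _ _ (E1 i j)) => //.
  - apply: (weight_down (w' := phi i.+1 * phi j)); first by rewrite ler_wpM2r // cup.
    by apply: IH => //; rewrite [X in (_ < X)%N]n0.
  - by rewrite -sqrrN opprB; apply: le_trans (H_E1 ij1) (le_rho (E1_ge0 _ _)).
  - by apply: EL_E1 => //; rewrite dn dE n0; clear; lia.
have [/andP[jc ij1]|n2] := boolP ((j < c)%N && (i + j.+1 <= M)%N).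
  have dE : d i j.+1 = n.-1 by move: dn jc; rewrite /d; clear; lia.
  have n0 : (n = n.-1.+1)%N by move: dn jc; rewrite /d; clear; lia.
  rewrite (splitH i j.+1) n0; apply: (@step_bound _ _ _ (E2 i j)) => //.
  - apply: (weight_down (w' := phi i * phi j.+1)); first by rewrite ler_wpM2l // cup.
    by apply: IH => //; rewrite [X in (_ < X)%N]n0.
  - by rewrite -sqrrN opprB; apply: le_trans (H_E2 ij1) (le_rho (E2_ge0 _ _)).
  - by apply: EL_E2 => //; rewrite dn dE n0; clear; lia.
have base : i = c -> j = c -> phi i * phi j * (H i j - H c c) ^+ 2 <= rho * n%:R * S n.
  move=> -> ->; rewrite subrr expr0n mulr0 !mulr_ge0 //; exact: le_trans rho_ge1.
have low : (i <= c)%N -> (j <= c)%N -> phi i * phi j * (H i j - H c c) ^+ 2 <= rho * n%:R * S n.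
  by move=> ic jc; apply: base; move: ic jc n1 n2 c2; clear; lia.
case: cdn => [cM|dec]; last first.
  have [ci|ic] := ltnP c i.
    case: i ij dn splitH n1 n2 base low ci => [|i] // ij dn splitH n1 n2 base low ci.
    have dE : d i j = n.-1 by move: dn ci; rewrite /d; clear; lia.
    have n0 : (n = n.-1.+1)%N by move: dn ci; rewrite /d; clear; lia.
    have ij1 : (i + j <= M)%N by move: ij; clear; lia.
    have iM : (i.+1 <= M)%N by move: ij; clear; lia.
    have pp : phi i.+1 <= phi i by apply: dec.
    rewrite (splitH i j) n0; apply: (@step_bound _ _ _ (E1 i j)) => //.
    - apply: (weight_down (w' := phi i * phi j)); first by rewrite ler_wpM2r.
      by apply: IH => //; rewrite [X in (_ < X)%N]n0.
    - apply: (weight_down (w' := phi i * phi j)); first by rewrite ler_wpM2r.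
      by apply: le_trans (H_E1 ij) (le_rho (E1_ge0 _ _)).
    - by apply: EL_E1 => //; rewrite dn dE n0; clear; lia.
  have [cj|jc] := ltnP c j; last exact: low.
  case: j ij dn splitH n1 n2 base low cj => [|j] // ij dn splitH n1 n2 base low cj.
  have dE : d i j = n.-1 by move: dn cj; rewrite /d; clear; lia.
  have n0 : (n = n.-1.+1)%N by move: dn cj; rewrite /d; clear; lia.
  have ij1 : (i + j <= M)%N by move: ij; clear; lia.
  have jM : (j.+1 <= M)%N by move: ij; clear; lia.
  have pp : phi j.+1 <= phi j by apply: dec.
  rewrite (splitH i j) n0; apply: (@step_bound _ _ _ (E2 i j)) => //.
  - apply: (weight_down (w' := phi i * phi j)); first by rewrite ler_wpM2l.
    by apply: IH => //; rewrite [X in (_ < X)%N]n0.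
  - apply: (weight_down (w' := phi i * phi j)); first by rewrite ler_wpM2l.
    by apply: le_trans (H_E2 ij) (le_rho (E2_ge0 _ _)).
  - by apply: EL_E2 => //; rewrite dn dE n0; clear; lia.
have [ci|ic] := ltnP c i.
  case: i ij dn splitH n1 n2 base low ci => [|i] // ij dn splitH n1 n2 base low ci.
  have iM : (i.+1 <= M)%N by move: ij; clear; lia.
  have wrho : phi i.+1 * phi j <= rho * (phi i * phi j) by rewrite mulrA ler_wpM2r // phi_rho.
  have rB : phi i.+1 * phi j * (H i.+1 j - H i j) ^+ 2 <= rho * E1 i j.
    apply: (weight_down wrho); rewrite -mulrA ler_wpM2l ?H_E1 //; exact: le_trans rho_ge1.
  have jc : (j <= c)%N by move: ij ci cM; clear; lia.
  have [E|jlt] := eqVneq j c.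
    have ie : i = c by move: ij ci cM E; clear; lia.
    have nE : n = 1%N by move: dn; rewrite /d ie E; clear; lia.
    rewrite (splitH i j) nE; apply: (@step_bound _ _ _ (E1 i j)) => //.
      by rewrite ie E subrr expr0n !mulr0 mul0r.
    by apply: EL_E1 => //; rewrite /d ie E; clear; lia.
  have jlt' : (j < c)%N by move: jc jlt; clear; lia.
  have sM : (i.+1 + j = M)%N by move: n2 jlt' ij; clear; lia.
  have d1 : d i j = n.-1 by move: dn ci; rewrite /d; clear; lia.
  have d2 : d i j.+1 = n.-2 by move: dn ci jlt'; rewrite /d; clear; lia.
  have n0 : (n = n.-2.+2)%N by move: dn ci jlt'; rewrite /d; clear; lia.
  have ij2 : (i + j.+1 <= M)%N by move: sM; clear; lia.
  have wd : phi i.+1 * phi j <= phi i * phi j.+1 by apply: phi_cross => //; move: jlt' ci; clear; lia.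
  have i1 : phi i.+1 * phi j * (H i j.+1 - H c c + (H i j - H i j.+1)) ^+ 2 <= rho * n.-2.+1%:R * S n.-2.+1.
    apply: (@step_bound _ _ _ (E2 i j)) => //.
    - apply: (weight_down wd); apply: IH => //; by rewrite [X in (_ < X)%N]n0.
    - apply: (weight_down wrho); rewrite -mulrA ler_wpM2l //; first exact: le_trans rho_ge1.
      by rewrite -sqrrN opprB H_E2.
    - by apply: EL_E2 => //; rewrite d1 d2; move: n0; clear; lia.
  rewrite (splitH i j) n0; apply: (@step_bound _ _ _ (E1 i j)) => //.
    by rewrite addrC subrKA in i1.
  by apply: EL_E1 => //; rewrite dn d1; move: n0; clear; lia.
have [cj|jc] := ltnP c j; last exact: low.
case: j ij dn splitH n1 n2 base low cj => [|j] // ij dn splitH n1 n2 base low cj.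
have jM : (j.+1 <= M)%N by move: ij; clear; lia.
have wrho : phi i * phi j.+1 <= rho * (phi i * phi j) by rewrite mulrCA ler_wpM2l // phi_rho.
have rB : phi i * phi j.+1 * (H i j.+1 - H i j) ^+ 2 <= rho * E2 i j.
  apply: (weight_down wrho); rewrite -mulrA ler_wpM2l ?H_E2 //; exact: le_trans rho_ge1.
have [E|ilt] := eqVneq i c.
  have je : j = c by move: ij cj cM E; clear; lia.
  have nE : n = 1%N by move: dn; rewrite /d je E; clear; lia.
  rewrite (splitH i j) nE; apply: (@step_bound _ _ _ (E2 i j)) => //.
    by rewrite je E subrr expr0n !mulr0 mul0r.
  by apply: EL_E2 => //; rewrite /d je E; clear; lia.
have ilt' : (i < c)%N by move: ic ilt; clear; lia.
have sM : (i + j.+1 = M)%N by move: n1 ilt' ij; clear; lia.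
have d1 : d i j = n.-1 by move: dn cj; rewrite /d; clear; lia.
have d2 : d i.+1 j = n.-2 by move: dn cj ilt'; rewrite /d; clear; lia.
have n0 : (n = n.-2.+2)%N by move: dn cj ilt'; rewrite /d; clear; lia.
have ij2 : (i.+1 + j <= M)%N by move: sM; clear; lia.
have wd : phi i * phi j.+1 <= phi i.+1 * phi j.
  by rewrite mulrC (mulrC (phi i.+1)); apply: phi_cross => //; move: ilt' cj; clear; lia.
have i1 : phi i * phi j.+1 * (H i.+1 j - H c c + (H i j - H i.+1 j)) ^+ 2 <= rho * n.-2.+1%:R * S n.-2.+1.
  apply: (@step_bound _ _ _ (E1 i j)) => //.
  - apply: (weight_down wd); apply: IH => //; by rewrite [X in (_ < X)%N]n0.
  - apply: (weight_down wrho); rewrite -mulrA ler_wpM2l //; first exact: le_trans rho_ge1.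
    by rewrite -sqrrN opprB H_E1.
  - by apply: EL_E1 => //; rewrite d1 d2; move: n0; clear; lia.
rewrite (splitH i j) n0; apply: (@step_bound _ _ _ (E2 i j)) => //.
  by rewrite addrC subrKA in i1.
by apply: EL_E2 => //; rewrite dn d1; move: n0; clear; lia.
Qed.

Let S_le n : S n <= \sum_(i < M.+1) \sum_(j < M.+1) (E1 i j + E2 i j).
Proof.
have ind (m : nat) (x : R) : 0 <= x -> \sum_(k < n) (if m == k.+1 then x else 0) <= x.
  move=> x0; elim: n => [|k IH]; first by rewrite big_ord0.
  rewrite big_ord_recr /=; case: eqP => [->|_]; last by rewrite addr0.
  rewrite big1 ?add0r // => i _; rewrite ifF //; have := ltn_ord i; clear; lia.
rewrite /S /EL exchange_big /=; apply: ler_sum => i _; rewrite exchange_big /=.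
by apply: ler_sum => j _; rewrite big_split /= lerD // ind.
Qed.

Lemma triangle_poincare : exists h0 : R, forall i j, (i + j <= M)%N ->
  phi i * phi j * (H i j - h0) ^+ 2 <=
  rho * (2 * M.+1)%:R * \sum_(i < M.+1) \sum_(j < M.+1) (E1 i j + E2 i j).
Proof.
exists (H c c) => i j ij; apply: le_trans (descent ij (erefl _)) _.
have [c2 _ _] := c_spec; have r0 : 0 <= rho by apply: le_trans rho_ge1.
apply: ler_pM => //; first by rewrite mulr_ge0.
rewrite ler_wpM2l // ler_nat /d; move: c2 ij; clear; lia.
Qed.

End Triangle.

Section Classes.
Variables (R : realType) (h N M : nat).
Hypotheses (h_gt0 : (0 < h)%N) (NE : N = (h.*2 + M.*2)%N).
Implicit Types (X : {set 'I_N.+1}) (p : 'I_M.+1 * 'I_M.+1).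

Definition lpt (i : nat) : 'I_N.+1 := inord (h + i.*2).
Definition rpt (j : nat) : 'I_N.+1 := inord (N - (h + j.*2)).

Lemma lptE i : (i <= M)%N -> val (lpt i) = (h + i.*2)%N.
Proof. by move=> iM; rewrite /lpt /= inordK //; move: iM NE; clear; lia. Qed.

Lemma rptE j : (j <= M)%N -> (rpt j + (h + j.*2))%N = N.
Proof. by move=> jM; rewrite /rpt inordK; move: jM NE; clear; lia. Qed.

Definition pcls p : pred {set 'I_N.+1} := cls (lpt p.1) (rpt p.2).

Lemma cls_uniq (l r l' r' : 'I_N.+1) X : cls l r X -> cls l' r' X -> l = l' /\ r = r'.
Proof.
move=> /clsP[lX rX H] /clsP[lX' rX' H'].
have /andP[a1 _] := H _ lX'; have /andP[_ a2] := H _ rX'.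
have /andP[b1 _] := H' _ lX; have /andP[_ b2] := H' _ rX.
by split; apply: val_inj; apply/eqP; rewrite eqn_leq ?a1 ?b1 ?a2 ?b2.
Qed.

Lemma pcls_uniq p q X : pcls p X -> pcls q X -> p = q.
Proof.
move=> cp cq; have [el er] := cls_uniq cp cq; case: p q cp cq el er => [p1 p2] [q1 q2] /= _ _ el er.
have := congr1 val el; rewrite (lptE (ltn_ord p1)) (lptE (ltn_ord q1)) => e1.
have e2 := congr1 val er; have e3 := rptE (ltn_ord p2); have e4 := rptE (ltn_ord q2).
by congr pair; apply: val_inj => /=; move: e1 e2 e3 e4 => /=; clear; lia.
Qed.

Lemma pcls_ex X : X != set0 -> (0 < #|Om h X|)%N ->
  exists2 p : 'I_M.+1 * 'I_M.+1, (p.1 + p.2 <= M)%N & pcls p X.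
Proof.
case/set0Pn => x0 x0X oX.
have [l lX lmin] := @arg_minnP _ x0 (fun x : 'I_N.+1 => x \in X) (fun x : 'I_N.+1 => val x) x0X.
have [r rX rmax] := @arg_maxnP _ x0 (fun x : 'I_N.+1 => x \in X) (fun x : 'I_N.+1 => val x) x0X.
have [hl pl] := Om_parity oX lX; have [_ pr] := Om_parity oX rX.
have rN := Om_parity_right oX rX; have lr : (l <= r)%N by apply: lmin.
have [i iE] : exists i, (val l = h + i.*2)%N by exists ((l - h)./2); move: hl pl => /=; clear; lia.
have [j jE] : exists j, (r + (h + j.*2) = N)%N.
  by exists ((N - h - r)./2); move: rN pr NE => /=; clear; lia.
have ijM : (i + j <= M)%N by move: lr iE jE NE => /=; clear; lia.
have iM : (i <= M)%N by move: ijM; clear; lia.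
have jM : (j <= M)%N by move: ijM; clear; lia.
have iM' : (i < M.+1)%N by []. have jM' : (j < M.+1)%N by [].
exists (Ordinal iM', Ordinal jM') => //=.
have -> : pcls (Ordinal iM', Ordinal jM') = cls l r.
  rewrite /pcls /=; congr cls; apply: val_inj; first by rewrite lptE.
  by have := rptE jM; move: jE => /=; clear; lia.
by apply/clsP; split => // x xX; apply/andP; split; [apply: lmin|apply: rmax].
Qed.

Lemma pcls_pack (K : {set 'I_N.+1} -> R) : (forall X, 0 <= K X) ->
  \sum_(p : 'I_M.+1 * 'I_M.+1 | (p.1 + p.2 <= M)%N) \sum_(X | pcls p X) K X <= \sum_(X | X != set0) K X.
Proof.
move=> K0; under eq_bigr do rewrite big_mkcond; rewrite exchange_big /= [X in _ <= X]big_mkcond /=.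
apply: ler_sum => X _; case: (pickP (fun p : 'I_M.+1 * 'I_M.+1 => (p.1 + p.2 <= M)%N && pcls p X)) => [q /andP[qM cq]|none].
  rewrite (bigD1 q) //= cq big1 ?addr0 => [|p /andP[_ pq]]; last first.
    by case: ifP => // cp; move: pq; rewrite (pcls_uniq cp cq) eqxx.
  by rewrite ifT //; apply/set0Pn; exists (lpt q.1); case/clsP: cq.
rewrite big1 => [|p pM]; first by case: ifP.
by have := none p; rewrite pM /= => ->.
Qed.

Lemma pcls_cover (K : {set 'I_N.+1} -> R) : (forall X, 0 <= K X) ->
  (forall X, #|Om h X| = 0%N -> K X = 0) ->
  \sum_(X | X != set0) K X <= \sum_(p : 'I_M.+1 * 'I_M.+1 | (p.1 + p.2 <= M)%N) \sum_(X | pcls p X) K X.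
Proof.
move=> K0 Kz; under [X in _ <= X]eq_bigr do rewrite big_mkcond.
rewrite [X in _ <= X]exchange_big /= [X in X <= _]big_mkcond /=; apply: ler_sum => X _.
have nn p : 0 <= (if pcls p X then K X else 0) by case: ifP.
case: ifP => [X0|_]; last by apply: sumr_ge0.
case: (posnP #|Om h X|) => [/Kz ->|oX]; first by apply: sumr_ge0 => p _; case: ifP.
have [q qM cq] := pcls_ex X0 oX; rewrite (bigD1 q) //= cq lerDl.
by apply: sumr_ge0.
Qed.

End Classes.

Section Polymer.
Variables (R : realType) (a lam theta c : R).
Hypotheses (a_gt0 : 0 < a) (lam_gt0 : 0 < lam) (theta_ge2 : 2 <= theta) (c_gt0 : 0 < c).
Hypothesis Zlow : forall m, c * theta ^+ m.*2 <= m.+1%:R ^+ 2 * pinZ lam m.*2.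
Hypothesis Zup : forall m, pinZ lam m.*2 <= lam * theta ^+ m.*2.
Variables (h N M : nat) (f : cfg h N -> R).
Hypotheses (h_gt0 : (0 < h)%N) (NE : N = (h.*2 + M.*2)%N) (aNh : a * N%:R <= h%:R).

Let theta_gt0 : 0 < theta. Proof. by apply: lt_le_trans theta_ge2. Qed.
Let N_gt0 : (0 < N)%N. Proof. by move: h_gt0 NE; clear; lia. Qed.
Let NR_gt0 : 0 < N%:R :> R. Proof. by rewrite ltr0n. Qed.

Let W := Wt (N := N) h lam.
Let g := avg f.
Let phi (i : nat) : R := psi R h i / theta ^+ i.*2.
Let q (i : nat) : R := (h%:R + 2 * i%:R + 2) ^+ 2 / ((i%:R + 1) * (h%:R + i%:R + 1)).

Let phiS i : phi i.+1 = phi i * (q i / theta ^+ 2).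
Proof.
rewrite /phi /= -/(q i) doubleS -addn2 exprD; field.
by rewrite !expf_neq0 // gt_eqF.
Qed.

Let phi_gt0 i : 0 < phi i.
Proof. by rewrite divr_gt0 ?psi_gt0 ?exprn_gt0. Qed.

Let q_decr i : q i.+1 <= q i.
Proof.
rewrite /q ler_pdivrMr ?psi_den // mulrAC ler_pdivlMr ?psi_den // -[i.+1%:R]natr1.
have : 0 <= h%:R :> R by []. have : 0 <= i%:R :> R by [].
move: (h%:R) (i%:R) => x y y0 x0.
have -> : (x + 2 * (y + 1) + 2) ^+ 2 = x ^+ 2 + 4 * ((y + 2) * (x + y + 2)) by ring.
have -> : (x + 2 * y + 2) ^+ 2 = x ^+ 2 + 4 * ((y + 1) * (x + y + 1)) by ring.
have -> : (y + 1 + 1) * (x + (y + 1) + 1) = (y + 2) * (x + y + 2) by ring.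
set A := (y + 1) * _; set B := (y + 2) * _.
have AB : A <= B by rewrite /A /B; apply: ler_pM; lra.
have : 0 <= x ^+ 2 * (B - A) by rewrite mulr_ge0 ?sqr_ge0 // subr_ge0.
by move: (x ^+ 2) => z; lra.
Qed.

Let phi_lc i : phi i * phi i.+2 <= phi i.+1 ^+ 2.
Proof.
rewrite (phiS i.+1) (phiS i) [X in _ <= X]expr2.
have -> : phi i * (phi i * (q i / theta ^+ 2) * (q i.+1 / theta ^+ 2)) =
   phi i * (q i / theta ^+ 2) * (phi i / theta ^+ 2) * q i.+1 by ring.
have -> : phi i * (q i / theta ^+ 2) * (phi i * (q i / theta ^+ 2)) =
   phi i * (q i / theta ^+ 2) * (phi i / theta ^+ 2) * q i by ring.
have p0 := phi_gt0 i; have p1 := phi_gt0 i.+1; rewrite phiS in p1.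
apply: ler_wpM2l; last exact: q_decr.
by apply: mulr_ge0; [apply: ltW|rewrite divr_ge0 ?exprn_ge0 // ltW].
Qed.

Let a_le1 : a <= 1.
Proof.
rewrite -(ler_pM2r NR_gt0) mul1r; apply: le_trans aNh _; rewrite ler_nat.
by move: NE; clear; lia.
Qed.

Let rho := N%:R / a.

Let rho_ge1 : 1 <= rho.
Proof.
rewrite /rho ler_pdivlMr // mul1r; apply: le_trans a_le1 _; by rewrite ler1n.
Qed.

Let phi_rho i : (i.+1 <= M)%N -> phi i.+1 <= rho * phi i.
Proof.
move=> iM; rewrite phiS mulrC ler_pM2r // /q.
have hi : (h%:R + 2 * i%:R + 2) <= N%:R :> R.
  by rewrite -natrM -!natrD ler_nat; move: iM NE; clear; lia.
have th2 : 1 <= theta ^+ 2 by rewrite expr2; have := theta_ge2; nra.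
have i0 : 0 <= i%:R :> R by []. have h1 : 1 <= h%:R :> R by rewrite ler1n.
rewrite ler_pdivrMr ?exprn_gt0 // ler_pdivrMr ?psi_den //.
apply: (@le_trans _ _ (N%:R ^+ 2)).
  by rewrite lerXn2r ?nnegrE //; lra.
have hden : a * N%:R <= (i%:R + 1) * (h%:R + i%:R + 1).
  by apply: le_trans aNh _; nra.
have -> : N%:R ^+ 2 = rho * (a * N%:R) :> R by rewrite /rho; field; rewrite gt_eqF.
have r0 : 0 < rho by apply: lt_le_trans rho_ge1.
rewrite -mulrA ler_pM2l //; apply: le_trans hden _.
by rewrite ler_peMl // ltW // psi_den.
Qed.

Let SE (i j : nat) : R := \sum_(X | cls (lpt h N i) (rpt h N j) X)
  \sum_(x in X | X :\ x != set0) W X * (g X - g (X :\ x)) ^+ 2.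

Let SE_ge0 i j : 0 <= SE i j.
Proof.
by do 2!(apply: sumr_ge0 => ? _); apply: mulr_ge0; [apply: Wt_ge0|apply: sqr_ge0].
Qed.

Let W_ge0 X : 0 <= W X. Proof. exact: Wt_ge0. Qed.

Let Wvar i j := wvar W g (cls (lpt h N i) (rpt h N j)).

Let wvar_le i j : Wvar i j <= 2 * N.+1%:R * N%:R ^+ 2 * SE i j.
Proof.
apply: le_trans (hybrid_poincare g W_ge0 _ _) _; last first.
- apply: ler_wpM2l; first by rewrite !mulr_ge0 ?exprn_ge0.
  apply: ler_sum => X /clsP[lX _ _]; rewrite [X in _ <= X]big_mkcond [X in X <= _]big_mkcond /=.
  apply: ler_sum => x _; have t0 : 0 <= W X * (g X - g (X :\ x)) ^+ 2 by rewrite mulr_ge0 ?sqr_ge0.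
  case: ifP => [/and3P[xX xl xr]|_]; last by case: ifP.
  rewrite xX ifT //; apply/set0Pn; exists (lpt h N i); by rewrite !inE eq_sym xl.
- by move=> s X Y; apply: swap_weight.
- exact: exprn_ge0.
Qed.

Let D : R := 4 * N.+1%:R * N%:R ^+ 2 + 2.
Let K : R := N%:R ^+ 2 * theta ^+ 2 / (lam * a ^+ 4 * c * theta ^+ M.*2).
Let H i j := wmean W g (cls (lpt h N i) (rpt h N j)).
Let E i j : R := if (i + j <= M)%N then K * (D * SE i j) else 0.

Let K_gt0 : 0 < K.
Proof. by rewrite /K divr_gt0 // !mulr_gt0 ?exprn_gt0. Qed.

Let E_ge0 i j : 0 <= E i j.
Proof.
rewrite /E; case: ifP => // _; apply: mulr_ge0; first exact: ltW.
apply: mulr_ge0; last exact: SE_ge0.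
by rewrite /D addr_ge0 // !mulr_ge0 ?exprn_ge0.
Qed.

Let fpass_low i : (i <= M)%N -> a ^+ 2 * psi R h i <= fpass R h i.
Proof.
move=> iM; have := psi_le_fpass R i h_gt0.
have hi : h%:R + 2 * i%:R <= N%:R :> R.
  by rewrite -natrM -!natrD ler_nat; move: iM NE; clear; lia.
have f0 := fpass_gt0 R i h_gt0; have p0 := psi_gt0 R i h_gt0; have h0 : 0 < h%:R :> R by rewrite ltr0n.
have i0 : 0 <= i%:R :> R by [].
move=> le1; have N2 : 0 < N%:R ^+ 2 :> R by rewrite exprn_gt0.
rewrite -(ler_pM2l N2).
apply: (@le_trans _ _ (h%:R ^+ 2 * psi R h i)).
  rewrite mulrA -exprMn ler_pM2r // mulrC lerXn2r ?nnegrE //; by rewrite mulr_ge0 // ltW.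
apply: le_trans le1 _; rewrite ler_pM2r // lerXn2r ?nnegrE //; lra.
Qed.

Let edge_mass i j n (wU : R) : (i + j + n.+1 = M)%N ->
  wU = lam * fpass R h i * pinZ lam n.*2 * fpass R h j -> phi i * phi j <= K * wU.
Proof.
move=> ijn ->.
have fi : a ^+ 2 * psi R h i <= fpass R h i by apply: fpass_low; move: ijn; clear; lia.
have fj : a ^+ 2 * psi R h j <= fpass R h j by apply: fpass_low; move: ijn; clear; lia.
have pi0 := psi_gt0 R i h_gt0; have pj0 := psi_gt0 R j h_gt0.
have z1 : c * theta ^+ n.*2 / N%:R ^+ 2 <= pinZ lam n.*2.
  rewrite ler_pdivrMr ?exprn_gt0 //; apply: le_trans (Zlow n) _; rewrite mulrC.
  apply: ler_wpM2l; first exact: pinev_ge0.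
  by rewrite lerXn2r ?nnegrE // ler_nat; move: ijn NE; clear; lia.
have z0 : 0 <= c * theta ^+ n.*2 / N%:R ^+ 2.
  by rewrite divr_ge0 ?exprn_ge0 // mulr_ge0 ?exprn_ge0 // ltW.
have a2 : 0 < a ^+ 2 by rewrite exprn_gt0.
apply: (@le_trans _ _ (K * (lam * (a ^+ 2 * psi R h i) * (c * theta ^+ n.*2 / N%:R ^+ 2) * (a ^+ 2 * psi R h j)))).
  rewrite le_eqVlt; apply/orP; left; apply/eqP; rewrite /phi /K.
  have -> : theta ^+ M.*2 = theta ^+ i.*2 * theta ^+ j.*2 * theta ^+ n.*2 * theta ^+ 2.
    by rewrite -!exprD; congr (_ ^+ _); move: ijn; clear; lia.
  by field; rewrite !expf_neq0 // ?gt_eqF //.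
have P1 : 0 <= a ^+ 2 * psi R h i by apply: ltW; apply: mulr_gt0.
have P2 : 0 <= a ^+ 2 * psi R h j by apply: ltW; apply: mulr_gt0.
have P3 : 0 <= lam * (a ^+ 2 * psi R h i) by apply: mulr_ge0 => //; apply: ltW.
rewrite ler_pM2l ?K_gt0 //; apply: ler_pM => //; first exact: mulr_ge0.
by apply: ler_pM => //; rewrite ler_pM2l.
Qed.

Let edge_bound i j (P' U : pred {set 'I_N.+1}) tau (c0 : R) n :
  (i + j + n.+1 = M)%N ->
  (forall X, U X -> cls (lpt h N i) (rpt h N j) X) -> c0 != 0 ->
  (forall F : {set 'I_N.+1} -> R, \sum_(X | P' X) F X = \sum_(X | U X) F (tau X)) ->
  (forall X, U X -> W (tau X) = c0 * W X) ->
  (forall X, U X -> exists x, [/\ x \in X, X :\ x != set0 & tau X = X :\ x]) ->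
  wmass W P' = c0 * (lam * fpass R h i * pinZ lam n.*2 * fpass R h j) ->
  phi i * phi j * (wmean W g P' - H i j) ^+ 2 <= E i j.
Proof.
move=> ijn UP c00 tauP Wc tx mass.
have wU : wmass W U = lam * fpass R h i * pinZ lam n.*2 * fpass R h j.
  apply: (mulfI c00); rewrite -mass /wmass tauP mulr_sumr.
  by apply: eq_bigr => X /Wc.
have ce := class_edge g W_ge0 UP c00 tauP Wc.
apply: (@le_trans _ _ (K * (wmass W U * (wmean W g P' - H i j) ^+ 2))).
  by rewrite mulrA ler_wpM2r ?sqr_ge0 // (edge_mass ijn wU).
rewrite /E ifT; last by move: ijn; clear; lia.
rewrite ler_pM2l ?K_gt0 // -sqrrN opprB; apply: le_trans ce _.
have s1 : \sum_(X | U X) W X * (g X - g (tau X)) ^+ 2 <= SE i j.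
  rewrite /SE big_mkcond [X in _ <= X]big_mkcond /=; apply: ler_sum => X _.
  have nn : 0 <= \sum_(x in X | X :\ x != set0) W X * (g X - g (X :\ x)) ^+ 2.
    by apply: sumr_ge0 => x _; rewrite mulr_ge0 ?sqr_ge0.
  case: ifP => [UX|_]; last by case: ifP.
  rewrite UP //; have [x [xX x0 ->]] := tx X UX; rewrite (bigD1 x) /=; last by rewrite xX.
  by rewrite lerDl; apply: sumr_ge0 => y _; rewrite mulr_ge0 ?sqr_ge0.
have := wvar_le i j; rewrite /Wvar /D; move: s1; lra.
Qed.

Let H_E1 i j : (i.+1 + j <= M)%N -> phi i * phi j * (H i.+1 j - H i j) ^+ 2 <= E i j.
Proof.
move=> ij; pose l := lpt h N i; pose l' := lpt h N i.+1; pose r := rpt h N j.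
have iM : (i <= M)%N by move: ij; clear; lia.
have iM1 : (i.+1 <= M)%N by move: ij; clear; lia.
have jM : (j <= M)%N by move: ij; clear; lia.
have lE := lptE NE iM; have l'E := lptE NE iM1; have rE := rptE NE jM.
have ll : (l < l')%N by rewrite /l /l' [nat_of_ord _]lE [X in (_ < X)%N]l'E; clear; lia.
have l'r : (l' <= r)%N by move: l'E rE NE ij; rewrite -/l' -/r /=; clear; lia.
apply: (@edge_bound _ _ (cls l' r) (fun X => (l \in X) && cls l' r (X :\ l)) (fun X => X :\ l)
  (fpass R h i.+1 / (lam * fpass R h i)) (M - (i + j).+1)).
- by move: ij; clear; lia.
- move=> X /andP[lX /clsP[l'X rX HX]]; apply/clsP; split => //.
    by move: rX; rewrite inE => /andP[].
  move=> x xX; have [->|xl] := eqVneq x l; first by rewrite leqnn (leq_trans (ltnW ll)).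
  have /HX /andP[h1 ->] : x \in X :\ l by rewrite !inE xl.
  by rewrite andbT (leq_trans (ltnW ll)).
- by rewrite gt_eqF // divr_gt0 ?mulr_gt0 ?fpass_gt0.
- move=> F; rewrite (reindex_onto (fun X => X :\ l) (fun X => l |: X)) /=; last first.
    move=> X /clsP[l'X rX HX]; rewrite setU1K //; apply/negP => /HX /andP[h1 _].
    by move: h1; rewrite leqNgt ll.
  apply: eq_bigl => X; rewrite andbC; congr (_ && _).
  by apply/eqP/idP => [<-|lX]; rewrite ?setU11 // setD1K.
- by move=> X /andP[lX cX]; apply: left_edge_weight cX.
- move=> X /andP[lX /clsP[l'X _ _]]; exists l; split => //; by apply/set0Pn; exists l'.
- rewrite (cls_mass lam h_gt0 l'E rE l'r).
  have -> : (r - l' = (M - (i + j).+1).*2)%N.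
    by move: l'E rE NE ij; rewrite -/l' -/r /=; clear; lia.
  by field; rewrite !gt_eqF // fpass_gt0.
Qed.

Let H_E2 i j : (i + j.+1 <= M)%N -> phi i * phi j * (H i j.+1 - H i j) ^+ 2 <= E i j.
Proof.
move=> ij; pose l := lpt h N i; pose r' := rpt h N j.+1; pose r := rpt h N j.
have iM : (i <= M)%N by move: ij; clear; lia.
have jM1 : (j.+1 <= M)%N by move: ij; clear; lia.
have jM : (j <= M)%N by move: ij; clear; lia.
have lE := lptE NE iM; have r'E := rptE NE jM1; have rE := rptE NE jM.
have rr : (r' < r)%N by move: r'E rE; rewrite -/r -/r'; clear; lia.
have lr' : (l <= r')%N by move: lE r'E NE ij; rewrite -/l -/r' /=; clear; lia.
apply: (@edge_bound _ _ (cls l r') (fun X => (r \in X) && cls l r' (X :\ r)) (fun X => X :\ r)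
  (fpass R h j.+1 / (lam * fpass R h j)) (M - (i + j).+1)).
- by move: ij; clear; lia.
- move=> X /andP[rX /clsP[lX r'X HX]]; apply/clsP; split => //.
    by move: lX; rewrite inE => /andP[].
  move=> x xX; have [->|xr] := eqVneq x r; first by rewrite leqnn (leq_trans lr' (ltnW rr)).
  have /HX /andP[-> h1] : x \in X :\ r by rewrite !inE xr.
  by rewrite (leq_trans h1 (ltnW rr)).
- by rewrite gt_eqF // divr_gt0 ?mulr_gt0 ?fpass_gt0.
- move=> F; rewrite (reindex_onto (fun X => X :\ r) (fun X => r |: X)) /=; last first.
    move=> X /clsP[lX r'X HX]; rewrite setU1K //; apply/negP => /HX /andP[_ h1].
    by move: h1; rewrite leqNgt rr.
  apply: eq_bigl => X; rewrite andbC; congr (_ && _).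
  by apply/eqP/idP => [<-|rX]; rewrite ?setU11 // setD1K.
- move=> X /andP[rX cX]; apply: (right_edge_weight h_gt0 lam_gt0 rE r'E _ rX cX).
  by rewrite /l [nat_of_ord _]lE leq_addr.
- move=> X /andP[rX /clsP[lX _ _]]; exists r; split => //; by apply/set0Pn; exists l.
- rewrite (cls_mass lam h_gt0 lE r'E lr').
  have -> : (r' - l = (M - (i + j).+1).*2)%N.
    by move: lE r'E NE ij; rewrite -/l -/r' /=; clear; lia.
  by field; rewrite !gt_eqF // fpass_gt0.
Qed.

Let class_mass i j : (i + j <= M)%N ->
  wmass W (cls (lpt h N i) (rpt h N j)) <= lam * theta ^+ M.*2 * (phi i * phi j).
Proof.
move=> ij; have iM : (i <= M)%N by move: ij; clear; lia.
have jM : (j <= M)%N by move: ij; clear; lia.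
have lE := lptE NE iM; have rE := rptE NE jM.
have lr : (lpt h N i <= rpt h N j)%N by move: lE rE NE ij => /=; clear; lia.
rewrite (cls_mass lam h_gt0 lE rE lr).
have -> : (rpt h N j - lpt h N i = (M - (i + j)).*2)%N by move: lE rE NE ij => /=; clear; lia.
have -> : lam * theta ^+ M.*2 * (phi i * phi j) =
   psi R h i * (lam * theta ^+ (M - (i + j)).*2) * psi R h j.
  rewrite /phi; have -> : theta ^+ M.*2 = theta ^+ i.*2 * theta ^+ j.*2 * theta ^+ (M - (i + j)).*2.
    by rewrite -!exprD; congr (_ ^+ _); move: ij; clear; lia.
  by field; rewrite !expf_neq0 // gt_eqF.
have fi := fpass_gt0 R i h_gt0; have fj := fpass_gt0 R j h_gt0.
have z0 : 0 <= pinZ lam (M - (i + j)).*2 by apply: pinev_ge0.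
apply: ler_pM; [by rewrite mulr_ge0 // ltW|exact: ltW| |exact: fpass_le_psi].
by apply: ler_pM; [exact: ltW|exact: z0|exact: fpass_le_psi|exact: Zup].
Qed.

Lemma set_poincare : exists b : R, \sum_(X | X != set0) W X * (g X - b) ^+ 2 <=
  (8 + 80 * theta ^+ 2 / (a ^+ 5 * c)) * N%:R ^+ 9 * set_energy lam f.
Proof.
have [b Hb] := triangle_poincare phi_gt0 (fun i _ => phi_lc i) rho_ge1 phi_rho E_ge0 E_ge0 H_E1 H_E2.
exists b; set T := set_energy lam f.
have SEsum : \sum_(p : 'I_M.+1 * 'I_M.+1 | (p.1 + p.2 <= M)%N) SE p.1 p.2 <= T.
  apply: (pcls_pack NE) => X; apply: sumr_ge0 => x _.
  by apply: mulr_ge0; [apply: W_ge0|apply: sqr_ge0].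
have T0 : 0 <= T by apply: le_trans SEsum; apply: sumr_ge0.
have D0 : 0 <= D by rewrite /D addr_ge0 // !mulr_ge0 ?exprn_ge0.
have r0 : 0 <= rho by apply: le_trans rho_ge1.
have Esum : \sum_(i < M.+1) \sum_(j < M.+1) (E i j + E i j) <= 2 * (K * (D * T)).
  rewrite pair_bigA /=.
  have -> : \sum_(p : 'I_M.+1 * 'I_M.+1) (E p.1 p.2 + E p.1 p.2) =
     2 * (K * (D * \sum_(p : 'I_M.+1 * 'I_M.+1 | (p.1 + p.2 <= M)%N) SE p.1 p.2)).
    rewrite !mulr_sumr [RHS]big_mkcond /=; apply: eq_bigr => p _; rewrite /E.
    by case: ifP => _; ring.
  by rewrite ler_pM2l // ler_pM2l ?K_gt0 // ler_wpM2l.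
have N1 : 1 <= N%:R :> R by rewrite ler1n.
have M1 : M.+1%:R <= N%:R :> R by rewrite ler_nat; move: h_gt0 NE; clear; lia.
have N2 : N.+1%:R <= 2 * N%:R :> R by rewrite -natr1; lra.
have M0 : 0 <= M.+1%:R :> R by [].
set B3 := rho * (2 * M.+1)%:R * (2 * (K * (D * T))).
have b3 : lam * theta ^+ M.*2 * B3 <= 40 * theta ^+ 2 / (a ^+ 5 * c) * N%:R ^+ 7 * T.
  have -> : lam * theta ^+ M.*2 * B3 = theta ^+ 2 / (a ^+ 5 * c) * (N%:R ^+ 3 * (4 * M.+1%:R) * D) * T.
    rewrite /B3 /K /rho natrM; field; rewrite !expf_neq0 ?gt_eqF //.
  have -> : 40 * theta ^+ 2 / (a ^+ 5 * c) * N%:R ^+ 7 * T =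
     theta ^+ 2 / (a ^+ 5 * c) * (N%:R ^+ 3 * (4 * N%:R) * (10 * N%:R ^+ 3)) * T by ring.
  apply: ler_wpM2r => //; apply: ler_wpM2l.
    by rewrite divr_ge0 ?exprn_ge0 ?mulr_ge0 ?exprn_ge0 // ltW.
  have D1 : D <= 10 * N%:R ^+ 3.
    have e3 : N%:R ^+ 3 = N%:R * N%:R ^+ 2 :> R by rewrite exprS.
    have n2 : 1 <= N%:R ^+ 2 :> R by rewrite exprn_ege1.
    have m1 : N.+1%:R * N%:R ^+ 2 <= 2 * N%:R * N%:R ^+ 2 :> R by rewrite ler_wpM2r // exprn_ge0.
    have m2 : N%:R ^+ 2 <= N%:R ^+ 3 :> R by rewrite e3 ler_peMl // exprn_ge0.
    by rewrite /D; lra.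
  by apply: ler_pM => //; rewrite ler_wpM2l ?exprn_ge0 //; lra.
apply: (@le_trans _ _ (\sum_(p : 'I_M.+1 * 'I_M.+1 | (p.1 + p.2 <= M)%N)
   (2 * (2 * N.+1%:R * N%:R ^+ 2 * SE p.1 p.2) + 2 * (lam * theta ^+ M.*2 * B3)))).
  apply: le_trans (pcls_cover NE (K := fun X => W X * (g X - b) ^+ 2) _ _) _.
  - by move=> X; apply: mulr_ge0; [apply: W_ge0|apply: sqr_ge0].
  - by move=> X X0; rewrite /W /Wt X0 mulr0 mul0r.
  apply: ler_sum => -[i j] /= ij.
  apply: (@le_trans _ _ (\sum_(X | cls (lpt h N i) (rpt h N j) X)
     (2 * (W X * (g X - H i j) ^+ 2) + 2 * (W X * (H i j - b) ^+ 2)))).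
    apply: ler_sum => X _; have -> : g X - b = (g X - H i j) + (H i j - b) by ring.
    have := ler_wpM2l (W_ge0 X) (sqrD_le (g X - H i j) (H i j - b)); lra.
  rewrite big_split /= -!mulr_sumr -mulr_suml; apply: lerD; rewrite ler_pM2l //; first exact: wvar_le.
  apply: (@le_trans _ _ (lam * theta ^+ M.*2 * (phi i * phi j) * (H i j - b) ^+ 2)).
    by apply: ler_wpM2r; [apply: sqr_ge0|apply: class_mass].
  rewrite -[X in X <= _]mulrA; apply: ler_wpM2l; first by rewrite mulr_ge0 ?exprn_ge0 // ltW.
  apply: le_trans (Hb i j ij) _; rewrite /B3; apply: ler_wpM2l => //.
  by rewrite mulr_ge0.
rewrite big_split /= sumr_const -!mulr_sumr.
have N3 : 2 * N.+1%:R * N%:R ^+ 2 <= 4 * N%:R ^+ 9 :> R.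
  have : N.+1%:R * N%:R ^+ 2 <= 2 * N%:R * N%:R ^+ 2 :> R by rewrite ler_wpM2r // exprn_ge0.
  have : N%:R ^+ 3 <= N%:R ^+ 9 :> R by rewrite ler_weXn2l.
  have : N%:R ^+ 3 = N%:R * N%:R ^+ 2 :> R by rewrite exprS.
  lra.
have P1 : 2 * N.+1%:R * N%:R ^+ 2 * \sum_(p : 'I_M.+1 * 'I_M.+1 | (p.1 + p.2 <= M)%N) SE p.1 p.2 <= 4 * N%:R ^+ 9 * T.
  by apply: ler_pM => //; apply: sumr_ge0.
set cardp := #|_|; have cp : cardp%:R <= N%:R ^+ 2 :> R.
  apply: (@le_trans _ _ (M.+1 * M.+1)%:R).
    rewrite ler_nat /cardp; apply: leq_trans (max_card _) _; by rewrite card_prod card_ord.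
  by rewrite natrM expr2 ler_pM.
have B0 : 0 <= lam * theta ^+ M.*2 * B3.
  apply: mulr_ge0; first by rewrite mulr_ge0 ?exprn_ge0 // ltW.
  have K0 := ltW K_gt0; have KDT : 0 <= K * (D * T) by apply: mulr_ge0 => //; apply: mulr_ge0.
  by apply: mulr_ge0; [apply: mulr_ge0|apply: mulr_ge0].
rewrite -mulr_natr.
have P2 : lam * theta ^+ M.*2 * B3 * cardp%:R <= 40 * theta ^+ 2 / (a ^+ 5 * c) * N%:R ^+ 9 * T.
  apply: (@le_trans _ _ (40 * theta ^+ 2 / (a ^+ 5 * c) * N%:R ^+ 7 * T * N%:R ^+ 2)).
    by apply: ler_pM.
  by rewrite le_eqVlt; apply/orP; left; apply/eqP; ring.
lra.
Qed.

End Polymer.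

Lemma polymer_poincare (R : realType) (a lam : R) : 0 < a -> 0 < lam ->
  exists2 C : R, 0 < C & forall (h N : nat) (f : cfg h N -> R),
    (0 < h)%N -> ~~ odd N -> (h.*2 <= N)%N -> a * N%:R <= h%:R ->
    exists b : R, \sum_(e : cfg h N | isP e && (Zs e != set0)) lam ^+ #|Zs e| * (f e - b) ^+ 2 <=
      C * N%:R ^+ 12 * (flip_energy lam f + pin_energy lam f).
Proof.
move=> a0 lam0; have [theta [c [th2 c0 Zb]]] := pinZ_bounds lam0.
have th0 : 0 < theta by apply: lt_le_trans th2.
pose C9 := 8 + 80 * theta ^+ 2 / (a ^+ 5 * c).
have C90 : 0 < C9.
  by rewrite /C9 ltr_pwDl // divr_ge0 ?mulr_ge0 ?exprn_ge0 // ltW.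
exists (2 + 2 * C9 * (2 + lam)); first by apply: addr_gt0 => //; apply: mulr_gt0; [apply: mulr_gt0|apply: addr_gt0].
move=> h N f h0 No hN aN.
pose M := ((N - h.*2)./2)%N; have NE : N = (h.*2 + M.*2)%N by rewrite /M; move: No hN; clear; lia.
have [b Hb] := set_poincare a0 lam0 th2 c0 (fun m => proj1 (Zb m)) (fun m => proj2 (Zb m)) f h0 NE aN.
exists b.
have N2 : (2 <= N)%N by move: h0 hN; clear; lia.
have N1 : 1 <= N%:R :> R by rewrite ler1n; apply: leq_trans N2.
have iv := inner_var_le f N2 lam0; have se := set_energy_le f h0 lam0.
set Fl := flip_energy lam f in iv *; set Pi := pin_energy lam f in se *.
have Fl0 : 0 <= Fl.
  apply: sumr_ge0 => X _; apply: mulr_ge0; first by rewrite exprn_ge0 // ltW.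
  by do 2!(apply: sumr_ge0 => ? _); apply: sqr_ge0.
have Pi0 : 0 <= Pi.
  do 2!(apply: sumr_ge0 => ? _); apply: mulr_ge0; first by rewrite exprn_ge0 // ltW.
  by apply: sumr_ge0 => ? _; apply: sqr_ge0.
have dec : \sum_(e : cfg h N | isP e && (Zs e != set0)) lam ^+ #|Zs e| * (f e - b) ^+ 2 <=
   2 * inner_var lam f + 2 * \sum_(X | X != set0) Wt h lam X * (avg f X - b) ^+ 2.
  rewrite (partition_big (@Zs h N) (fun X => X != set0)) /=; last by move=> e /andP[].
  rewrite /inner_var !mulr_sumr -big_split /=; apply: ler_sum => X X0.
  rewrite (eq_bigl (fun e => e \in Om h X)); last first.
    by move=> e; rewrite inE; case: (eqVneq (Zs e) X) => [->|_]; rewrite ?X0 ?andbT ?andbF.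
  rewrite /Wt -sumr_const !mulr_sumr !mulr_suml !mulr_sumr -big_split /=.
  apply: ler_sum => e /OmP[_ ->].
  have l0 : 0 <= lam ^+ #|X| by rewrite exprn_ge0 // ltW.
  have := ler_wpM2l l0 (sqrD_le (f e - avg f X) (avg f X - b)).
  have -> : f e - avg f X + (avg f X - b) = f e - b by ring.
  lra.
have n12 k : (k <= 12)%N -> N%:R ^+ k <= N%:R ^+ 12 :> R by move=> kk; rewrite ler_weXn2l.
have iv2 : inner_var lam f <= N%:R ^+ 12 * (Fl + Pi).
  apply: le_trans iv _; have := n12 2%N isT => q; have q2 : 0 <= N%:R ^+ 2 :> R by rewrite exprn_ge0.
  by apply: ler_pM => //; lra.
have se2 : set_energy lam f <= (2 + lam) * N%:R ^+ 3 * (Fl + Pi).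
  apply: le_trans se _.
  have N3 : 1 <= N%:R ^+ 3 :> R by rewrite exprn_ege1.
  have t1 : 2 * Pi <= 2 * N%:R ^+ 3 * (Fl + Pi).
    have : Fl + Pi <= N%:R ^+ 3 * (Fl + Pi) by rewrite ler_peMl // addr_ge0.
    lra.
  have t2 : 2 * lam * N.+1%:R * inner_var lam f <= lam * N%:R ^+ 3 * (Fl + Pi).
    apply: (@le_trans _ _ (2 * lam * (2 * N%:R) * (N%:R ^+ 2 / 16 * Fl))).
      apply: ler_pM => //.
      - by rewrite !mulr_ge0 // ltW.
      - by apply: sumr_ge0 => X _; apply: mulr_ge0; [rewrite exprn_ge0 // ltW|apply: sumr_ge0 => e _; apply: sqr_ge0].
      - by rewrite ler_wpM2l ?mulr_ge0 ?(ltW lam0) // -natr1; lra.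
    have -> : 2 * lam * (2 * N%:R) * (N%:R ^+ 2 / 16 * Fl) = lam * N%:R ^+ 3 * (Fl / 4) by field.
    by apply: ler_wpM2l; [rewrite mulr_ge0 ?exprn_ge0 // ltW|lra].
  lra.
have Hb2 : \sum_(X | X != set0) Wt h lam X * (avg f X - b) ^+ 2 <= C9 * (2 + lam) * N%:R ^+ 12 * (Fl + Pi).
  apply: le_trans Hb _; rewrite -/C9.
  apply: (@le_trans _ _ (C9 * N%:R ^+ 9 * ((2 + lam) * N%:R ^+ 3 * (Fl + Pi)))).
    by apply: ler_wpM2l => //; rewrite mulr_ge0 ?exprn_ge0 // ltW.
  by rewrite le_eqVlt; apply/orP; left; apply/eqP; ring.
lra.
Qed.

(** * The restricted dynamics *)

Section Chain.
Variables (R : realType) (a lam : R) (N : nat).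
Hypotheses (a_gt0 : 0 < a) (lam_gt0 : 0 < lam) (N_gt0 : (0 < N)%N).
Notation h := (hgt a N).
Implicit Types (e : cfg h N) (f : cfg h N -> R).

Lemma ceil_half_gt0 : 0 < Num.ceil (a * N%:R / 2).
Proof. by rewrite ceil_gt0 !mulr_gt0 ?invr_gt0 ?ltr0n. Qed.

Lemma evenceilE : evenceil (a * N%:R) = h%:Z.
Proof.
rewrite /hgt; have := ceil_half_gt0; rewrite /evenceil; move: (Num.ceil _) => z z0.
by rewrite gez0_abs // mulr_ge0 // ltW.
Qed.

Lemma hgt_gt0 : (0 < h)%N.
Proof.
have := ceil_half_gt0; have := evenceilE; rewrite /evenceil; move: (Num.ceil _) => z; clear; lia.
Qed.

Lemma hgt_ge : a * N%:R <= h%:R.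
Proof.
have -> : h%:R = (evenceil (a * N%:R))%:~R :> R by rewrite evenceilE.
rewrite /evenceil intrM; have := ceil_ge (a * N%:R / 2); lra.
Qed.

Lemma inCheckSE e : inCheckS (a := a) e = isP e && (Zs e != set0).
Proof.
rewrite /inCheckS /inS evenceilE !eqz_nat; congr (_ && _).
apply/existsP/set0Pn => -[x xz]; exists x; first by rewrite inE.
by move: xz; rewrite inE.
Qed.

Lemma HzeroE e : Hzero (a := a) e = #|Zs e|.
Proof.
by apply: eq_card => x; apply/idP/idP => [/set_mem|xz]; [rewrite inE|apply: mem_set; rewrite inE in xz].
Qed.

Lemma is_flipP e e' x : reflect (forall y, (y <= N)%N ->
   (hh e' y)%:Z = if y == x then newval (a := a) e x else (hh e y)%:Z) (is_flip (a := a) e e' x).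
Proof.
apply: (iffP forallP) => [H y yN|H y]; last by apply/eqP; apply: H; rewrite -ltnS.
by have /eqP := H (Ordinal (yN : (y < N.+1)%N)).
Qed.

Lemma is_flip_sym e e' x : (0 < x < N)%N -> is_flip (a := a) e e' x -> is_flip (a := a) e' e x.
Proof.
move=> /andP[x0 xN] /is_flipP H; apply/is_flipP => y yN.
have h1 := H x.+1 xN; have h2 : (x.-1 <= N)%N by move: xN; clear; lia.
have {}h2 := H _ h2; have h3 := H x (ltnW xN).
have n1 : (x.+1 == x) = false by clear; lia.
have n2 : (x.-1 == x) = false by move: x0; clear; lia.
rewrite n1 in h1; rewrite n2 in h2; rewrite eqxx in h3.
case: (eqVneq y x) => [->|nyx]; last by have := H y yN; rewrite (negbTE nyx).
move: h1 h2 h3; rewrite /newval -![ht _ _]/(hh _ _); clear; lia.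
Qed.

Lemma rateE e e' x : (0 < x < N)%N -> is_flip (a := a) e e' x -> e' != e ->
  rate (a := a) lam e e' = rate_at (a := a) lam e x.
Proof.
move=> xN fl ne; rewrite /rate; case: pickP => [z /andP[zN fz]|none]; last first.
  have xN1 : (x < N.+1)%N by move: xN; clear; lia.
  by have := none (Ordinal xN1); rewrite /= xN fl.
have [<-//|nzx] := eqVneq (nat_of_ord z) x.
case/negP: ne; apply/eqP; apply: hh_inj => y; have [yN|yN] := leqP y N; last by rewrite !hh_out.
move/is_flipP: fl => /(_ _ yN); move/is_flipP: fz => /(_ _ yN).
case: (eqVneq y x) => [->|_]; last by move=> _ [].
by rewrite eq_sym (negbTE nzx) => -[].
Qed.

Lemma rate_none e e' : (forall x, (0 < x < N)%N -> ~~ is_flip (a := a) e e' x) -> rate (a := a) lam e e' = 0.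
Proof.
by move=> H; rewrite /rate; case: pickP => // x /andP[xN fl]; have := H x xN; rewrite fl.
Qed.

Lemma up_flip_balance e e' x : isP e -> isP e' -> (0 < x < N)%N -> is_flip (a := a) e e' x ->
  (hh e x < hh e' x)%N ->
  lam ^+ #|Zs e| * rate_at (a := a) lam e x = lam ^+ #|Zs e'| * rate_at (a := a) lam e' x.
Proof.
move=> eP eP' xx fl lt; have /andP[x0 xN] := xx.
have H := is_flipP _ _ _ fl.
have x1N : (x.-1 <= N)%N by move: xN; clear; lia.
have n1 : (x.+1 == x) = false by clear; lia.
have n2 : (x.-1 == x) = false by move: x0; clear; lia.
have h1 := H x.+1 xN; rewrite n1 in h1; case: h1 => h1.
have h2 := H _ x1N; rewrite n2 in h2; case: h2 => h2.
have h3 := H x (ltnW xN); rewrite eqxx /newval -![ht _ _]/(hh _ _) in h3.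
have [_ _ st] := isPP _ eP; have s1 := st x xN; have s2 := st x.-1; rewrite prednK // in s2.
have {}s2 := s2 (ltnW xN).
have eu : hh e x.-1 = (hh e x).+1 by move: lt h3 s1 s2; clear; lia.
have ev : hh e x.+1 = (hh e x).+1 by move: lt h3 s1 s2; clear; lia.
have eu' : hh e' x = (hh e x).+2 by move: lt h3 s1 s2; clear; lia.
have xN1 : (x < N.+1)%N by apply: ltnW.
have other (y : 'I_N.+1) : y != Ordinal xN1 -> hh e' y = hh e y.
  move=> ny; have yN : (y <= N)%N by rewrite -ltnS.
  by have := H y yN; rewrite -[nat_of_ord y == x]/(y == Ordinal xN1) (negbTE ny) => -[].
rewrite /rate_at /newval -![ht _ _]/(hh _ _) h1 h2 eu ev eu' /=.
have [z0|z0] := posnP (hh e x).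
  rewrite z0 /=; have -> : Zs e = Ordinal xN1 |: Zs e'.
    apply/setP => y; rewrite !inE; have [->|ny] := eqVneq y (Ordinal xN1); first by rewrite /= z0.
    by rewrite other.
  rewrite cardsU1 inE /= eu' /= exprS; field.
  by rewrite gt_eqF // addr_gt0.
have -> : Zs e = Zs e'.
  apply/setP => y; rewrite !inE; have [->|ny] := eqVneq y (Ordinal xN1); last by rewrite other.
  by rewrite /= eu' gtn_eqF.
case: (hh e x) z0 => [|u] // _ /=; congr (_ * _).
by rewrite !ifT //; clear; lia.
Qed.

Lemma detailed_balance e e' : isP e -> isP e' ->
  lam ^+ #|Zs e| * rate (a := a) lam e e' = lam ^+ #|Zs e'| * rate (a := a) lam e' e.
Proof.
move=> eP eP'; have [->//|ne] := eqVneq e' e.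
have [/existsP[x /andP[xx fl]]|/existsPn none] :=
  boolP [exists x : 'I_N.+1, (0 < x < N)%N && is_flip (a := a) e e' x]; last first.
  have nf x : (0 < x < N)%N -> ~~ is_flip (a := a) e e' x.
    move=> xx; have xN1 : (x < N.+1)%N by move: xx; clear; lia.
    by have := none (Ordinal xN1); rewrite /= xx.
  rewrite !rate_none ?mulr0 // => x xx; apply: contra (nf x xx); exact: is_flip_sym.
have fl' := is_flip_sym xx fl.
rewrite (rateE xx fl ne) (rateE xx fl') 1?eq_sym //.
have [lt|gt|E] := ltngtP (hh e x) (hh e' x).
- exact: up_flip_balance.
- by apply/esym; apply: up_flip_balance.
- case/negP: ne; apply/eqP; apply: hh_inj => y; have [yN|yN] := leqP y N; last by rewrite !hh_out.
  have [->|nyx] := eqVneq y x; first by [].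
  by move/is_flipP: fl => /(_ _ yN); rewrite (negbTE nyx) => -[].
Qed.

Definition nb e (y : 'I_N.+1) : cfg h N := if hh e y == 0%N then lift0 y e else flip y e.

Definition minrate : R := Num.min (1 / 2) (1 / (lam + 1)).

Lemma minrate_gt0 : 0 < minrate.
Proof. by rewrite lt_min !divr_gt0 // addr_gt0. Qed.

Lemma nb_spec e y : isP e -> nb e y != e ->
  [/\ (0 < y < N)%N, is_flip (a := a) e (nb e y) y & minrate <= rate_at (a := a) lam e y].
Proof.
move=> eP; rewrite /nb; have [z0|z0] := eqVneq (hh e y) 0%N => ne.
  have yz : y \in Zs e by rewrite inE z0.
  have [yN p1 p2] := isP_zero_nbr hgt_gt0 eP yz; split => //.
    apply/is_flipP => x xN; rewrite (hh_lift0 _ hgt_gt0 eP yz); case: eqP => // _.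
    by rewrite /newval -![ht _ _]/(hh _ _) p1 p2 z0.
  rewrite /rate_at -![ht _ _]/(hh _ _) p1 p2 z0 /=.
  by rewrite /minrate ge_min lexx orbT.
have fl : flippable e y by apply: contraNT ne => nf; rewrite /flip (negbTE nf).
case/and4P: (fl) => yN /eqP c1 c2 c3; split => //.
  apply/is_flipP => x xN; rewrite hh_flip // fl andTb; case: eqP => // _.
  by rewrite /newval -![ht _ _]/(hh _ _) -c1; move: c3; clear; lia.
rewrite /rate_at /newval -![ht _ _]/(hh _ _) -c1 (negbTE z0).
have -> : (hh e y.-1 == 0%N) = false by move: c3; clear; lia.
rewrite /=; have -> : (hh e y.-1 == 1%N) && ((hh e y.-1 == 1%N) && (hh e y == 2%N)) = false.
  by move: c3; clear; lia.
rewrite ifT; first by rewrite /minrate ge_min lexx.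
by rewrite c2 /=; move: c3; clear; lia.
Qed.

Lemma nb_inj e y z : isP e -> nb e y != e -> nb e z != e -> nb e y = nb e z -> y = z.
Proof.
move=> eP ny nz E; have [_ /is_flipP fy _] := nb_spec eP ny; have [_ /is_flipP fz _] := nb_spec eP nz.
have [//|nyz] := eqVneq y z; case/negP: ny; apply/eqP; apply: hh_inj => x.
have [xN|xN] := leqP x N; last by rewrite !hh_out.
have := fy x xN; have := fz x xN; rewrite -E; case: (eqVneq x y) => [->|_]; last by move=> _ [].
by rewrite -[nat_of_ord y == z]/(y == z) (negbTE nyz) => -[].
Qed.

Lemma rate_ge0 e e' : 0 <= rate (a := a) lam e e'.
Proof.
have l1 : 0 < lam + 1 by rewrite addr_gt0.
rewrite /rate; case: pickP => // x _; rewrite /rate_at.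
by do 4?case: ifP => // _; rewrite divr_ge0 // ltW.
Qed.

Definition nb_energy f e : R :=
  \sum_(y | (nb e y != e) && inCheckS (a := a) (nb e y)) (f e - f (nb e y)) ^+ 2.

Lemma nb_energy_le f e : isP e ->
  minrate * nb_energy f e <=
  \sum_(e' : cfg h N | inCheckS (a := a) e') rate (a := a) lam e e' * (f e' - f e) ^+ 2.
Proof.
move=> eP; pose Y := [set y : 'I_N.+1 | (nb e y != e) && inCheckS (a := a) (nb e y)].
have inj : {in Y &, injective (nb e)}.
  by move=> y z; rewrite !inE => /andP[ny _] /andP[nz _]; apply: nb_inj.
apply: (@le_trans _ _ (\sum_(e' in nb e @: Y) rate (a := a) lam e e' * (f e' - f e) ^+ 2)).
  rewrite (big_imset (fun e' => rate (a := a) lam e e' * (f e' - f e) ^+ 2) inj) /= /nb_energy mulr_sumr.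
  rewrite big_mkcond [X in _ <= X]big_mkcond /=; apply: ler_sum => y _; rewrite inE.
  case: ifP => // /andP[ny _]; have [yN fl mr] := nb_spec eP ny.
  by rewrite (rateE yN fl ny) -sqrrN opprB ler_wpM2r // sqr_ge0.
rewrite big_mkcond [X in _ <= X]big_mkcond /=; apply: ler_sum => e' _.
have t0 : 0 <= rate (a := a) lam e e' * (f e' - f e) ^+ 2 by rewrite mulr_ge0 ?sqr_ge0 ?rate_ge0.
case: ifP => [/imsetP[y]|_]; last by case: ifP.
by rewrite inE => /andP[_ cy] ->; rewrite cy.
Qed.

Lemma sum_by_zero_set (G : {set 'I_N.+1} -> cfg h N -> R) :
  \sum_(X : {set 'I_N.+1} | X != set0) \sum_(e in Om h X) G X e =
  \sum_(e : cfg h N | isP e && (Zs e != set0)) G (Zs e) e.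
Proof.
rewrite [RHS](partition_big (@Zs h N) (fun X => X != set0)) /=; last by move=> e /andP[].
apply: eq_bigr => X X0; apply: eq_big => e.
  by rewrite inE; case: (eqVneq (Zs e) X) => [->|_]; rewrite ?X0 ?andbT ?andbF.
by case/OmP => _ ->.
Qed.

Lemma energy_le f : flip_energy lam f + pin_energy lam f <=
  \sum_(e : cfg h N | isP e && (Zs e != set0)) lam ^+ #|Zs e| * nb_energy f e.
Proof.
have -> : flip_energy lam f = \sum_(e : cfg h N | isP e && (Zs e != set0))
   lam ^+ #|Zs e| * \sum_(1 <= y < N) (f e - f (flip y e)) ^+ 2.
  rewrite -(sum_by_zero_set (fun X e => lam ^+ #|X| * \sum_(1 <= y < N) (f e - f (flip y e)) ^+ 2)).
  by apply: eq_bigr => X _; rewrite mulr_sumr.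
have -> : pin_energy lam f = \sum_(e : cfg h N | isP e && (Zs e != set0))
   lam ^+ #|Zs e| * \sum_(x in Zs e | Zs e :\ x != set0) (f e - f (lift0 x e)) ^+ 2.
  rewrite -(sum_by_zero_set (fun X e => lam ^+ #|X| * \sum_(x in X | X :\ x != set0) (f e - f (lift0 x e)) ^+ 2)).
  apply: eq_bigr => X _; under [RHS]eq_bigr do rewrite mulr_sumr.
  rewrite [RHS]exchange_big /=; apply: eq_bigr => x _; by rewrite mulr_sumr.
rewrite -big_split /=; apply: ler_sum => e /andP[eP e0]; rewrite -mulrDr.
apply: ler_wpM2l; first by rewrite exprn_ge0 // ltW.
have -> : \sum_(1 <= y < N) (f e - f (flip y e)) ^+ 2 =
   \sum_(y < N.+1) (if (0 < y < N)%N then (f e - f (flip y e)) ^+ 2 else 0).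
  rewrite -(big_mkord xpredT (fun y => if (0 < y < N)%N then (f e - f (flip y e)) ^+ 2 else 0)).
  rewrite big_nat_recr //= ltnn andbF addr0 [RHS]big_ltn //= add0r.
  by apply: eq_big_nat => y ->.
rewrite /nb_energy [X in _ + X <= _]big_mkcond [X in _ <= X]big_mkcond -big_split /=; apply: ler_sum => y _.
rewrite !inE /nb; have [z0|z0] := eqVneq (hh e y) 0%N.
  have -> : flip y e = e by rewrite /flip /flippable z0 /= !andbF.
  have -> : (if (0 < y < N)%N then (f e - f e) ^+ 2 else 0) = 0.
    by case: ifP => // _; rewrite subrr expr0n.
  rewrite add0r /=; have [nz|] := boolP (Zs e :\ y != set0); last by case: ifP => // *; apply: sqr_ge0.
  have yz : y \in Zs e by rewrite inE z0.
  have eO : e \in Om h (Zs e) by apply/OmP.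
  have /OmP[lP lZ] := lift0_Om hgt_gt0 eO yz.
  rewrite inCheckSE lP lZ nz ifT //.
  apply/andP; split => //; apply/eqP => E; have := congr1 (fun e' => hh e' y) E.
  by rewrite (hh_lift0 _ hgt_gt0 eP yz) eqxx z0.
rewrite addr0; have [->|ne] := eqVneq (flip y e) e.
  by case: ifP => // _; rewrite subrr expr0n.
rewrite inCheckSE isP_flip // Zs_flip // e0 /=.
by case: ifP => // _; apply: sqr_ge0.
Qed.

Lemma dirichlet1E f : dirichlet1 (a := a) lam f =
  (\sum_(e : cfg h N | inCheckS (a := a) e) \sum_(e' : cfg h N | inCheckS (a := a) e')
     piC (a := a) lam e * (rate (a := a) lam e e' * (f e' - f e) ^+ 2)) / 2.
Proof.
rewrite /dirichlet1 /L1.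
set k := fun e e' => piC (a := a) lam e * rate (a := a) lam e e'.
have ksym e e' : inCheckS (a := a) e -> inCheckS (a := a) e' -> k e e' = k e' e.
  move=> ce ce'; rewrite /k /piC ce ce' !HzeroE ![_ / _ * _]mulrAC.
  congr (_ / _); move: ce ce'; rewrite !inCheckSE => /andP[eP _] /andP[eP' _].
  exact: detailed_balance.
set S := \sum_(e | _) _.
have S1 : S = \sum_(e : cfg h N | inCheckS (a := a) e) \sum_(e' : cfg h N | inCheckS (a := a) e')
   k e e' * (f e * (f e' - f e)).
  by apply: eq_bigr => e _; rewrite mulr_sumr; apply: eq_bigr => e' _; rewrite /k; ring.
have S2 : S = \sum_(e : cfg h N | inCheckS (a := a) e) \sum_(e' : cfg h N | inCheckS (a := a) e')
   k e e' * (f e' * (f e - f e')).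
  rewrite S1 exchange_big /=; apply: eq_bigr => e ce; apply: eq_bigr => e' ce'.
  by rewrite ksym.
have -> : \sum_(e : cfg h N | inCheckS (a := a) e) \sum_(e' : cfg h N | inCheckS (a := a) e')
     piC (a := a) lam e * (rate (a := a) lam e e' * (f e' - f e) ^+ 2) = - (S + S).
  rewrite {1}S1 S2 -big_split -sumrN /=; apply: eq_bigr => e _.
  rewrite -big_split -sumrN /=; apply: eq_bigr => e' _; rewrite /k; ring.
lra.
Qed.

Let Zt : R := \sum_(e : cfg h N | inCheckS (a := a) e) lam ^+ Hzero (a := a) e.

Lemma dirichlet1_ge f :
  minrate / 2 / Zt * (flip_energy lam f + pin_energy lam f) <= dirichlet1 (a := a) lam f.
Proof.
have Z0 : 0 <= Zt by apply: sumr_ge0 => e _; rewrite exprn_ge0 // ltW.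
have m0 := minrate_gt0.
apply: (@le_trans _ _ (minrate / 2 / Zt * \sum_(e : cfg h N | inCheckS (a := a) e) lam ^+ #|Zs e| * nb_energy f e)).
  apply: ler_wpM2l; first by rewrite divr_ge0 // divr_ge0 // ltW.
  by apply: le_trans (energy_le f) _; rewrite (eq_bigl _ _ inCheckSE).
rewrite dirichlet1E mulr_sumr mulr_suml; apply: ler_sum => e ce.
have eP : isP e by move: ce; rewrite inCheckSE => /andP[].
rewrite -mulr_sumr /piC ce HzeroE -/Zt.
have -> : minrate / 2 / Zt * (lam ^+ #|Zs e| * nb_energy f e) =
   (lam ^+ #|Zs e| / Zt) * (minrate * nb_energy f e) / 2 by ring.
apply: ler_wpM2r; first by rewrite invr_ge0.
apply: ler_wpM2l; last exact: nb_energy_le.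
by rewrite divr_ge0 // exprn_ge0 // ltW.
Qed.

Lemma varC_le f b : (exists e : cfg h N, inCheckS (a := a) e) ->
  varC (a := a) lam f <= Zt^-1 * \sum_(e : cfg h N | isP e && (Zs e != set0)) lam ^+ #|Zs e| * (f e - b) ^+ 2.
Proof.
case=> e0 ce0; have Z0 : 0 < Zt.
  rewrite /Zt (bigD1 e0) //= ltr_pwDl ?exprn_gt0 //; apply: sumr_ge0 => e _.
  by rewrite exprn_ge0 // ltW.
have pE e : inCheckS (a := a) e -> piC (a := a) lam e = Zt^-1 * lam ^+ #|Zs e|.
  by move=> ce; rewrite /piC ce HzeroE mulrC.
have p1 : \sum_(e : cfg h N | inCheckS (a := a) e) piC (a := a) lam e = 1.
  rewrite (eq_bigr (fun e => Zt^-1 * lam ^+ Hzero (a := a) e)) => [|e ce]; last by rewrite pE // HzeroE.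
  by rewrite -mulr_sumr mulVf // gt_eqF.
have -> : Zt^-1 * \sum_(e : cfg h N | isP e && (Zs e != set0)) lam ^+ #|Zs e| * (f e - b) ^+ 2 =
   \sum_(e : cfg h N | inCheckS (a := a) e) piC (a := a) lam e * (f e - b) ^+ 2.
  rewrite -(eq_bigl _ _ inCheckSE) mulr_sumr; apply: eq_bigr => e ce.
  by rewrite pE // mulrA.
rewrite /varC; set m := meanC _ _.
have -> : \sum_(e : cfg h N | inCheckS (a := a) e) piC (a := a) lam e * (f e - b) ^+ 2 =
  \sum_(e : cfg h N | inCheckS (a := a) e) piC (a := a) lam e * (f e - m) ^+ 2 +
  (m - b) ^+ 2 * \sum_(e : cfg h N | inCheckS (a := a) e) piC (a := a) lam e +
  2 * (m - b) * (\sum_(e : cfg h N | inCheckS (a := a) e) piC (a := a) lam e * f e -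
     m * \sum_(e : cfg h N | inCheckS (a := a) e) piC (a := a) lam e).
  rewrite !mulr_sumr -sumrB mulr_sumr -!big_split /=; apply: eq_bigr => e _; ring.
by rewrite p1 -/(meanC (a := a) lam f) -/m !mulr1 subrr mulr0 addr0 lerDl sqr_ge0.
Qed.

Lemma chain_gap (C : R) f : 0 < C -> (exists e : cfg h N, inCheckS (a := a) e) ->
  (exists b : R, \sum_(e : cfg h N | isP e && (Zs e != set0)) lam ^+ #|Zs e| * (f e - b) ^+ 2 <=
      C * N%:R ^+ 12 * (flip_energy lam f + pin_energy lam f)) ->
  minrate / (2 * C) * N%:R ^- 12 * varC (a := a) lam f <= dirichlet1 (a := a) lam f.
Proof.
move=> C0 ex [b Hb]; have m0 := minrate_gt0.
have Z0 : 0 <= Zt by apply: sumr_ge0 => e _; rewrite exprn_ge0 // ltW.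
have n0 : N%:R ^+ 12 != 0 :> R by rewrite expf_neq0 // pnatr_eq0 -lt0n.
apply: le_trans (dirichlet1_ge f).
have -> : minrate / 2 / Zt * (flip_energy lam f + pin_energy lam f) = minrate / (2 * C) * N%:R ^- 12 *
   (Zt^-1 * (C * N%:R ^+ 12 * (flip_energy lam f + pin_energy lam f))).
  rewrite invfM; have -> : forall u w x y z t : R, u * (w * x) * y * (z * (C * N%:R ^+ 12 * t)) =
    u * w * z * t * (x * C) * (y * N%:R ^+ 12) by move=> *; ring.
  by rewrite mulVf ?gt_eqF // mulVf // !mulr1.
apply: ler_wpM2l.
  by rewrite mulr_ge0 ?invr_ge0 ?exprn_ge0 // divr_ge0 ?mulr_ge0 // ltW.
apply: le_trans (varC_le f b ex) _; apply: ler_wpM2l => //; by rewrite invr_ge0.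
Qed.

End Chain.

Theorem theorem4p4 (R : realType) (a lam : R) :
  0 < a -> a < 1 / 2 -> 0 < lam ->
  exists2 c : R, 0 < c &
    forall N : nat, ~~ odd N -> (1 <= N)%N ->
      (exists eta : config a N, inCheckS eta) ->
      ((c * (N%:R ^- 12))%:E <= gap1 a lam N)%E.
Proof.
move=> a0 _ lam0; have [C C0 HC] := polymer_poincare a0 lam0.
have m0 := minrate_gt0 lam0.
exists (minrate lam / (2 * C)); first by rewrite divr_gt0 // mulr_gt0.
move=> N No N0 ex; apply: le_ereal_inf_tmp => _ [f /= fv <-]; rewrite lee_fin.
have h0 := hgt_gt0 a0 N0.
have hN : ((hgt a N).*2 <= N)%N.
  case: ex => e; rewrite (inCheckSE a0 N0) => /andP[eP /set0Pn[x xz]].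
  have oX : (0 < #|Om (hgt a N) (Zs (h := hgt a N) e)|)%N by apply/card_gt0P; exists e; apply/OmP.
  have [h1 _] := Om_parity oX xz; have := Om_parity_right oX xz; move: h1; clear; lia.
have := chain_gap a0 lam0 N0 C0 ex (HC _ _ f h0 No hN (hgt_ge a0 N0)) => H.
have v0 : 0 < varC lam f.
  rewrite lt_def fv; apply: sumr_ge0 => e ce; rewrite mulr_ge0 ?sqr_ge0 // /piC ce divr_ge0 //.
    by rewrite exprn_ge0 // ltW.
  by apply: sumr_ge0 => e' _; rewrite exprn_ge0 // ltW.
by rewrite ler_pdivlMr.
Qed.
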